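(* For $\lambda>0$ let $(\overline{G}^\circ_t)_{t\ge 0}$ be the full process with parameter $\lambda$ started from a single vertex. Then the time $t=\lambda$ is a sharp threshold for both connectedness of $\overline{G}^\circ_t$ and the existence of isolated vertices, that is, for any $\varepsilon>0$: with probability tending to $1$ as $\lambda\to\infty$, the graph $\overline{G}^\circ_{(1-\varepsilon)\lambda}$ is connected (where $\varepsilon\le 1$, so that this time is nonnegative), but the graph $\overline{G}^\circ_{(1+\varepsilon)\lambda}$ is disconnected and has isolated vertices.
   Context: A multigraph is a graph in which two vertices may be joined by several parallel edges; multigraphs here have no loops. Full process started from a single vertex. Let $\lambda>0$. The process $(\overline{G}^\circ_t)_{t\ge 0}$ is defined as follows. $\overline{G}^\circ_0$ is a single vertex with no edges. Each vertex $v$ has a splitting time $\tau_v$; for the initial vertex it is an $\operatorname{Exp}(1)$ variable (exponential of rate $1$). When $t=\tau_v$, replace $v$ with two new vertices $v_1,v_2$, and give each a splitting time of $t$ plus an independent $\operatorname{Exp}(1)$ variable. Add $\operatorname{Po}(\lambda/2)$ (a Poisson random number with mean $\lambda/2$) edges between $v_1$ and $v_2$. Moreover, replace each edge of the form $uv$ with one of the edges $uv_1,uv_2$ chosen uniformly at random. All these random choices are made independently of each other. $\overline{G}^\circ_t$ is the resulting multigraph at time $t$. (The process is also rooted: it starts with the initial vertex as root, and whenever the root splits, one of its two replacements, chosen uniformly at random, becomes the root; the root plays no role in this statement.) *)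

(* Defs.v *)
From HB Require Import structures.
From Stdlib Require Import Relation_Operators.
From mathcomp Require Import all_boot all_order all_algebra finmap.
From mathcomp Require Import all_classical all_reals all_analysis.
Set Implicit Arguments.
Unset Strict Implicit.
Unset Printing Implicit Defensive.
Import Order.TTheory GRing.Theory Num.Theory.
Import numFieldNormedType.Exports.
Local Open Scope classical_set_scope.
Local Open Scope ring_scope.

(** * Multigraphs *)

(* A multigraph whose vertices and edges have names in [V] and [E]; parallel
   edges are edges with different names and the same set of ends. *)
Record multigraph (V E : Type) := Multigraph {
  vertices : set V;
  edges : set E;
  ends : E -> set V }.

Section Multigraph.
Variables (V E : Type) (G : multigraph V E).

Definition adjacent_vertices (u v : V) : Prop :=
  [/\ vertices G u, vertices G v, u <> v &
      exists e, [/\ edges G e, ends G e u & ends G e v]].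

Definition connected_graph : Prop :=
  vertices G !=set0 /\
  (forall u v, vertices G u -> vertices G v -> clos_refl_trans V adjacent_vertices u v).

Definition isolated_vertex (v : V) : Prop :=
  vertices G v /\ forall e, edges G e -> ~ ends G e v.

End Multigraph.

(** * Independence *)

Definition mutually_independent (R : realType) (d : measure_display)
    (T : measurableType d) (P : probability T R)
    (I : choiceType) (F : I -> set (set T)) : Prop :=
  forall (J : {fset I}) (A : I -> set T),
    (forall i, i \in J -> F i (A i)) ->
    P (\bigcap_(i in [set` J]) A i) = (\prod_(i <- J) P (A i))%E.

Definition has_law (R : realType) (d d' : measure_display)
    (T : measurableType d) (T' : measurableType d') (P : probability T R)
    (X : {RV P >-> T'}) (Q : set T' -> \bar R) : Prop :=
  forall A, measurable A -> distribution P X A = Q A.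

(** * The full process started from a single vertex *)

(* The initial vertex is [[::]]; the vertices replacing [v] when it splits are
   [false :: v] and [true :: v]. *)
Definition vertex := seq bool.

(* [(v, k)] is the [k]-th edge added between the two vertices that replace [v];
   an edge keeps its name when one of its ends splits. *)
Definition edge := (vertex * nat)%type.

(* [lifetime v] is the time between the birth of [v] and its splitting time;
   [new_edges v] is the number of edges added when [v] splits; and the end [v]
   of [e] is replaced with [side e v :: v] when [v] splits. *)
Record randomness (R : realType) (d : measure_display) (T : measurableType d)
    (P : probability T R) := Randomness {
  lifetime : vertex -> {RV P >-> R};
  new_edges : vertex -> {RV P >-> nat};
  side : edge -> vertex -> {RV P >-> bool} }.

Section FullProcess.
Variables (R : realType) (d : measure_display) (T : measurableType d).
Variables (P : probability T R) (X : randomness P).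

Definition sources (i : vertex + vertex + edge * vertex) : set (set T) :=
  match i with
  | inl (inl v) => preimage_set_system setT (lifetime X v) measurable
  | inl (inr v) => preimage_set_system setT (new_edges X v) measurable
  | inr (e, v) => preimage_set_system setT (side X e v) measurable
  end.

(* The second argument of [poisson_prob] is not used in its definition. *)
Definition full_process_randomness (lambda : R) : Prop :=
  [/\ forall v, has_law (lifetime X v) (exponential_prob 1),
      forall v, has_law (new_edges X v) (poisson_prob (lambda / 2) 0),
      forall e v, has_law (side X e v) (bernoulli_prob (1 / 2)) &
      mutually_independent P sources].

Fixpoint birth_time (v : vertex) (w : T) : R :=
  if v is _ :: u then birth_time u w + lifetime X u w else 0.

Definition splitting_time (v : vertex) (w : T) : R :=
  birth_time v w + lifetime X v w.

Definition alive (t : R) (w : T) : set vertex :=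
  [set v | birth_time v w <= t < splitting_time v w].

(* The vertices that, in turn, are the end of [e] that started at
   [b :: e.1]. *)
Definition end_trace (e : edge) (b : bool) (w : T) : set vertex :=
  [set iter j (fun u : vertex => side X e u w :: u) (b :: e.1)
     | j in [set: nat]].

Definition full_process (t : R) (w : T) : multigraph vertex edge :=
  {| vertices := alive t w;
     edges := [set e | splitting_time e.1 w <= t /\ (e.2 < new_edges X e.1 w)%N];
     ends := fun e => alive t w `&` \bigcup_b end_trace e b w |}.

End FullProcess.

(** * Asymptotics *)

(* The events with [lambda <= 0] play no role. *)
Definition with_high_probability (R : realType) (d : measure_display)
    (T : R -> measurableType d) (P : forall lambda, probability (T lambda) R)
    (A : forall lambda, set (T lambda)) : Prop :=
  (forall lambda : R, 0 < lambda -> measurable (A lambda)) /\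
  P lambda (A lambda) @[lambda --> +oo] --> 1%E.

(* Main.v *)
Require Import Defs.
From HB Require Import structures.
From Stdlib Require Import Relation_Operators.
From mathcomp Require Import all_boot all_order all_algebra finmap.
From mathcomp Require Import all_classical all_reals all_analysis.
From mathcomp Require Import ring lra zify.
Import Order.TTheory GRing.Theory Num.Theory.
Import numFieldNormedType.Exports.
Set Implicit Arguments.
Unset Strict Implicit.
Unset Printing Implicit Defensive.
Local Open Scope classical_set_scope.
Local Open Scope ring_scope.

(* The graph at time [t] is a random graph on the leaves of a binary tree that
   depends only on the lifetimes, and it is independent of that tree.  For a
   fixed tree, the numbers of edges created at the internal nodes and meeting a
   prescribed set of leaves, or crossing a prescribed cut, are independent
   Poisson variables; so every cut has an explicit probability
   [expR (- (lambda * energy))] of not being crossed, and a leaf at depth [n] is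
   isolated with probability [expR (- (lambda * (1 - 2^-n)))].

   For any tree with at most [expR ((1 - c) * lambda)] leaves, the expected
   number of uncrossed cuts tends to [0].  This is proved by induction on the
   tree, weighting a cut of energy [E] and harmonic measure [p] (the probability
   that a fair random descent from the root ends on the marked side) by
   [expR (- (lambda * (E + s * (1 - eta) * min p (1 - p))))]: the potential
   anticipates the cost that the ancestors will still add.  For any tree with at
   least [expR ((1 + c) * lambda)] leaves, a second moment computation gives an
   isolated leaf.  Finally the number of leaves at time [t] is
   [expR (t * (1 + o(1)))] with high probability: the upper bound is a first
   moment bound on the number of births, and the lower bound comes from a slower
   process in discrete time, whose generating function [F] satisfies the
   recursion [F' = q F + (1 - q) F^2]. *)

(** * Independence of blocks of random variables *)

(** A bare union bound over cuts does not close by induction: a cut of small measure [p] has paid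
    little energy inside its subtree, and most of its cost is added higher up. To first order in [p]
    and [q] a new root adds energy [(p + q) / 2], so slope [s] at a node calls for slope
    [(1 + s) / 2] at its children; from [0] at the root this gives [1 - 2^-j] at depth [j], which is
    the isolation cost of a leaf there. The obstacle is the second-order loss [p * q], up to [1 / 4]
    for two balanced cuts. The factor [1 - eta] undercharges on purpose, so that a cut gains a
    little each time its subtree is joined to an undivided one; this makes balanced cuts so rare
    that the loss is affordable. The total is then governed by cuts that appear at one internal
    node, of weight about [expR (- (lambda * (1 + s) / 2))]: near the root this is only
    [expR (- lambda / 2)], but boundedly many nodes lie there. Since both graph estimates hold for
    every tree shape, only the number of leaves of the random tree has to be controlled. *)

Section SigmaAlgebraClosure.
Variables (T : Type) (G : set (set T)) (sG : sigma_algebra setT G).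

Lemma sigma_setC A : G A -> G (~` A).
Proof. by case: sG => _ GC _ /GC; rewrite setTD. Qed.

Lemma sigma_cst (Q : Prop) : G [set _ | Q].
Proof.
case: (pselect Q) => q.
  rewrite (_ : [set _ | _] = ~` set0) ?setC0; last by apply/seteqP; split.
  by rewrite -setC0; apply: sigma_setC; case: sG.
by rewrite (_ : [set _ | _] = set0); [case: sG|apply/seteqP; split].
Qed.

(** With this lemma and the connectives below, membership of an event in a sigma-algebra is proved
    by following the formula that defines it, as long as its quantifiers range over countable
    types. *)
Lemma sigma_exists (I : countType) (Q : I -> T -> Prop) :
  (forall i, G [set w | Q i w]) -> G [set w | exists i, Q i w].
Proof.
pose Q' n : set T := fun w => if @choice.unpickle I n is Some i then Q i w else False.
move=> GQ; rewrite (_ : [set w | _] = \bigcup_n Q' n).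
  rewrite /Q'; case: sG => G0 _; apply => n; case: (@choice.unpickle I n) => [i|]; first exact: GQ.
  exact: sigma_cst.
apply/seteqP; split => w /=.
  by case=> i Qi; exists (choice.pickle i) => //=; rewrite /Q' choice.pickleK.
by case=> n _; rewrite /Q' /=; case: (@choice.unpickle I n) => // i Qi; exists i.
Qed.

Lemma sigma_not (Q : T -> Prop) : G [set w | Q w] -> G [set w | ~ Q w].
Proof. exact: sigma_setC. Qed.

Lemma sigma_forall (I : countType) (Q : I -> T -> Prop) :
  (forall i, G [set w | Q i w]) -> G [set w | forall i, Q i w].
Proof.
move=> GQ; have := sigma_not (sigma_exists (fun i => sigma_not (GQ i))).
congr (G _); apply/seteqP; split => w /=; last by move=> Qw [].
by move=> nQ i; apply: contrapT => nQi; apply: nQ; exists i.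
Qed.

Lemma sigma_and (Q1 Q2 : T -> Prop) : G [set w | Q1 w] -> G [set w | Q2 w] ->
  G [set w | Q1 w /\ Q2 w].
Proof.
move=> G1 G2.
have /sigma_forall := (fun b : bool => if b as b return
   G [set w | (if b then Q1 else Q2) w] then G1 else G2).
congr (G _); apply/seteqP; split => w /= Hw; last by case; case: Hw.
by split; [exact: (Hw true)|exact: (Hw false)].
Qed.

Lemma sigma_imply (Q1 Q2 : T -> Prop) : G [set w | Q1 w] -> G [set w | Q2 w] ->
  G [set w | Q1 w -> Q2 w].
Proof.
move=> G1 G2; have := sigma_not (sigma_and G1 (sigma_not G2)).
congr (G _); apply/seteqP; split => w /= Hw; last by move=> [/Hw].
by move=> Q1w; apply: contrapT => nQ2; exact: Hw.
Qed.

Lemma sigma_or (Q1 Q2 : T -> Prop) : G [set w | Q1 w] -> G [set w | Q2 w] ->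
  G [set w | Q1 w \/ Q2 w].
Proof.
move=> G1 G2; have := sigma_imply (sigma_not G1) G2.
congr (G _); apply/seteqP; split => w /= Hw; last by case: Hw.
by case: (pselect (Q1 w)) => Q1w; [left|right; exact: Hw].
Qed.

End SigmaAlgebraClosure.

(** * Real-valued probabilities, union bounds and independence of generated sigma-algebras *)

Definition pr (R : realType) (d : measure_display) (T : measurableType d)
  (P : probability T R) (A : set T) : R := fine (P A).

Section Pr.
Variables (R : realType) (d : measure_display) (T : measurableType d).
Variable (P : probability T R).
Local Notation pr := (pr P).

Lemma prE A : measurable A -> P A = (pr A)%:E.
Proof. by move=> mA; rewrite fineK// fin_num_measure. Qed.

Lemma pr_ge0 A : 0 <= pr A.
Proof. by rewrite fine_ge0. Qed.

Lemma pr_le A B : measurable A -> measurable B -> A `<=` B -> pr A <= pr B.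
Proof. by move=> mA mB AB; rewrite -lee_fin -!prE// le_measure// inE. Qed.

Lemma prT : pr setT = 1.
Proof. by rewrite /pr probability_setT. Qed.

Lemma pr0 : pr set0 = 0.
Proof. by rewrite /pr measure0. Qed.

Lemma pr_le1 A : measurable A -> pr A <= 1.
Proof. by move=> mA; rewrite -prT pr_le. Qed.

Lemma prU A B : measurable A -> measurable B -> A `&` B = set0 ->
  pr (A `|` B) = pr A + pr B.
Proof.
move=> mA mB AB; apply: EFin_inj; rewrite EFinD -!prE//; last exact: measurableU.
by rewrite measureU.
Qed.

Lemma prD A B : measurable A -> measurable B ->
  pr (A `&` B) + pr (A `\` B) = pr A.
Proof.
move=> mA mB; rewrite -prU ?setUIDK//; [exact: measurableI|exact: measurableD|].
by apply/seteqP; split => w //= -[[_ ?] []].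
Qed.

Lemma prC A : measurable A -> pr (~` A) = 1 - pr A.
Proof.
move=> mA; have := prD measurableT mA.
by rewrite prT setTI setTD => <-; ring.
Qed.

Lemma pr_leU A B : measurable A -> measurable B -> pr (A `|` B) <= pr A + pr B.
Proof.
move=> mA mB; have mBA : measurable (B `\` A) by exact: measurableD.
have -> : A `|` B = A `|` (B `\` A).
  apply/seteqP; split => w /= [Aw|Bw]; [by left| |by left|by right; case: Bw].
  by case: (pselect (A w)); [left|right].
rewrite prU//; last by apply/seteqP; split => w //= -[? []].
by rewrite lerD2l pr_le//; exact: subDsetl.
Qed.

Lemma pr_bigcup_seq (I : Type) (s : seq I) (A : I -> set T) :
  (forall i, measurable (A i)) ->
  pr (\big[setU/set0]_(i <- s) A i) <= \sum_(i <- s) pr (A i).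
Proof.
move=> mA; elim: s => [|i s IHs]; first by rewrite !big_nil pr0.
rewrite !big_cons; apply: le_trans (pr_leU _ _) _ => //.
  exact: bigsetU_measurable.
by rewrite lerD2l.
Qed.

Lemma pr_union_bound (I : Type) (s : seq I) (A : I -> set T) (B : set T) :
  (forall i, measurable (A i)) -> measurable B ->
  B `<=` \big[setU/set0]_(i <- s) A i ->
  pr B <= \sum_(i <- s) pr (A i).
Proof.
move=> mA mB BA; apply: le_trans (pr_bigcup_seq s mA).
by apply: pr_le => //; exact: bigsetU_measurable.
Qed.

Lemma pr_null_bigcup (A : nat -> set T) : (forall n, measurable (A n)) ->
  (forall n, pr (A n) = 0) -> pr (\bigcup_n A n) = 0.
Proof.
move=> mA A0; apply: EFin_inj; rewrite -prE; last exact: bigcupT_measurable.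
by apply/eqP; rewrite -measure_le0 (le_trans (measure_sigma_subadditive P mA _ (subset_refl _))) //;
  [exact: bigcupT_measurable|rewrite eseries0// => i _ _ /=; rewrite prE// A0].
Qed.

Lemma pr_null_exists (I : countType) (A : I -> set T) :
  (forall i, measurable (A i)) -> (forall i, pr (A i) = 0) ->
  pr [set w | exists i, A i w] = 0.
Proof.
move=> mA A0; pose B n := if @choice.unpickle I n is Some i then A i else set0.
rewrite (_ : [set w | _] = \bigcup_n B n).
  by apply: pr_null_bigcup => n; rewrite /B; case: choice.unpickle => //; rewrite pr0.
apply/seteqP; split => w /=.
  by case=> i Ai; exists (choice.pickle i) => //; rewrite /B choice.pickleK.
by case=> n _; rewrite /B; case: choice.unpickle => // i Ai; exists i.
Qed.

(** Law of total probability: the bounds are summed over a countable partition of [A], and the sets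
    [B i] have total mass at most [1]. *)
Lemma pr_partition_le (I : countType) (B : I -> set T) (A : set T) (c : R) :
  0 <= c -> (forall i, measurable (B i)) -> measurable A ->
  (forall i j w, B i w -> B j w -> i = j) ->
  (forall w, A w -> exists i, B i w) ->
  (forall i, pr (A `&` B i) <= c * pr (B i)) -> pr A <= c.
Proof.
move=> c0 mB mA dB cB AB.
(* Several numbers could decode to the same [i]; keeping only the canonical code [pickle i] makes
   the sequence disjoint. *)
pose B' n := if @choice.unpickle I n is Some i then
  (if choice.pickle i == n then B i else set0) else set0.
have mB' n : measurable (B' n).
  by rewrite /B'; case: choice.unpickle => // i; case: eqP.
have AB' n : pr (A `&` B' n) <= c * pr (B' n).
  rewrite /B'; case: choice.unpickle => [i|]; last by rewrite setI0 pr0 mulr0.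
  by case: eqP => _ //; rewrite setI0 pr0 mulr0.
have tB' : trivIset setT B'.
  apply/trivIsetP => m n _ _ mn; rewrite /B'.
  case: (@choice.unpickle I m) => [i|]; last by rewrite set0I.
  case: eqP => [im|]; last by rewrite set0I.
  case: (@choice.unpickle I n) => [j|]; last by rewrite setI0.
  case: eqP => [jn|]; last by rewrite setI0.
  apply/seteqP; split => w //= -[Bi Bj].
  by move: mn; rewrite -im -jn (dB _ _ _ Bi Bj) eqxx.
have -> : A = \bigcup_n (A `&` B' n).
  rewrite -setI_bigcupr; apply/seteqP; split => w /=; last by case.
  move=> Aw; split => //; have [i Bi] := cB _ Aw.
  by exists (choice.pickle i) => //; rewrite /B' choice.pickleK eqxx.
have mAB' n : measurable (A `&` B' n) by exact: measurableI.
rewrite -lee_fin -prE; last exact: bigcupT_measurable.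
rewrite measure_semi_bigcup//; last 2 first.
- exact: trivIset_setIl.
- exact: bigcupT_measurable.
apply: (@le_trans _ _ (\sum_(0 <= n <oo) c%:E * P (B' n))%E).
  apply: lee_nneseries => n _ //; rewrite /= prE// prE// -EFinM lee_fin; exact: AB'.
rewrite nneseriesZl//.
have <- : P (\bigcup_n B' n) = (\sum_(0 <= n <oo) P (B' n))%E.
  by rewrite measure_semi_bigcup//; exact: bigcupT_measurable.
rewrite prE; last exact: bigcupT_measurable.
rewrite -EFinM lee_fin -[leRHS]mulr1 ler_wpM2l// pr_le1//.
exact: bigcupT_measurable.
Qed.

(** Positivity of the expectation of a simple function. The Markov and Chebyshev bounds below are
    obtained from it by writing a pointwise inequality between counts as a combination of
    indicators. *)
Lemma indic_combination_ge0 (I : Type) (s : seq I) (c : I -> R) (A : I -> set T) :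
  (forall i, measurable (A i)) ->
  (forall w, 0 <= \sum_(i <- s) c i * \1_(A i) w) ->
  0 <= \sum_(i <- s) c i * pr (A i).
Proof.
move=> mA c_ge0.
have iA (i : I) : P.-integrable setT (fun w => (c i * \1_(A i) w)%:E).
  under eq_fun do rewrite EFinM.
  by apply: integrableZl => //; exact: integrable_indic.
have -> : \sum_(i <- s) c i * pr (A i) =
    fine (\int[P]_w (\sum_(i <- s) c i * \1_(A i) w)%:E).
  transitivity (fine (\sum_(i <- s) \int[P]_w (c i * \1_(A i) w)%:E)%E).
    transitivity (fine (\sum_(i <- s) (c i * pr (A i))%:E)%E); first by rewrite sumEFin.
    congr fine; apply: eq_bigr => i _; rewrite EFinM -prE//.
    under eq_integral do rewrite EFinM.
    by rewrite integralZl//; [rewrite integral_indic// setIT|exact: integrable_indic].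
  by congr fine; rewrite -integral_sum//; apply: eq_integral => w _; rewrite sumEFin.
by apply: fine_ge0; apply: integral_ge0 => w _; rewrite lee_fin.
Qed.

Definition indep (A B : set T) := pr (A `&` B) = pr A * pr B.

Lemma indepC A B : indep A B -> indep B A.
Proof. by rewrite /indep setIC mulrC. Qed.

Lemma dynkin_indep A : measurable A ->
  dynkin [set B | measurable B /\ indep A B].
Proof.
move=> mA; split => /=.
- by rewrite /indep setIT prT mulr1.
- move=> B [mB AB]; split; first exact: measurableC.
  rewrite /indep prC// mulrBr mulr1 -AB -(prD mA mB) setDE; ring.
- move=> F tF mF; have mF' n : measurable (F n) by case: (mF n).
  split; first exact: bigcupT_measurable.
  apply: EFin_inj; rewrite EFinM -!prE//; last 2 first.
  + exact: bigcupT_measurable.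
  + by apply: measurableI => //; exact: bigcupT_measurable.
  rewrite setI_bigcupr !measure_semi_bigcup//; last 4 first.
  + exact: bigcupT_measurable.
  + by move=> n; exact: measurableI.
  + exact: trivIset_setIl.
  + by apply: bigcupT_measurable => n; exact: measurableI.
  rewrite [X in (X * _)%E]prE// -nneseriesZl//; apply: eq_eseriesr => n _ /=.
  have mAF : measurable (A `&` F n) by exact: measurableI.
  by rewrite !prE// -EFinM; congr EFin; case: (mF n).
Qed.

(** The pi-lambda theorem is applied twice: first over [G2] with the other event fixed in [G1], then
    over [G1] with the other event fixed in the sigma-algebra generated by [G2]. *)
Lemma indep_sigma (G1 G2 : set (set T)) :
  setI_closed G1 -> setI_closed G2 ->
  G1 `<=` measurable -> G2 `<=` measurable ->
  (forall A B, G1 A -> G2 B -> indep A B) ->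
  forall A B, <<s G1 >> A -> <<s G2 >> B -> indep A B.
Proof.
have aux (G : set (set T)) A : setI_closed G -> G `<=` measurable -> measurable A ->
    (forall B, G B -> indep A B) -> forall B, <<s G >> B -> indep A B.
  move=> IG mG mA AG B sB.
  suff: [set B | measurable B /\ indep A B] B by case.
  move: B sB; apply: lambda_system_subset => //.
    by apply/dynkin_lambda_system; exact: dynkin_indep.
  by move=> B GB; split; [exact: mG|exact: AG].
move=> I1 I2 m1 m2 G12 A B sA sB; apply: indepC.
have mB : measurable B.
  by apply: (smallest_sub (sigma_algebra_measurable T) m2).
apply: (aux G1) => // A' G1A'; apply: indepC; apply: (aux G2) => //.
  exact: m1.
by move=> B' G2B'; exact: G12.
Qed.

(** * Independence of sigma-algebras generated by disjoint blocks of sources *)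

Section Blocks.
Variables (I : choiceType) (F : I -> set (set T)).
Hypothesis IF : forall i, setI_closed (F i).
Hypothesis TF : forall i, F i setT.
Hypothesis mF : forall i, F i `<=` measurable.
Hypothesis indF : mutually_independent P F.

Definition block (J : set I) : set (set T) := <<s \bigcup_(i in J) F i >>.

(** A pi-system generating [block J]; the union of the families [F i] is not stable under
    intersection, so it cannot serve in [indep_sigma]. *)
Definition rectangles (J : set I) : set (set T) :=
  [set \bigcap_(i in [set` K]) A i | K in [set K : {fset I} | [set` K] `<=` J]
                                   & A in [set A | forall i, F i (A i)]].

Lemma rectangles_setI_closed J : setI_closed (rectangles J).
Proof.
move=> _ _ [K KJ [A FA <-]] [K' KJ' [A' FA' <-]].
exists (K `|` K')%fset.
  by move=> i /=; rewrite inE => /orP[]; [exact: KJ|exact: KJ'].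
exists (fun i => (if i \in K then A i else setT) `&`
                 (if i \in K' then A' i else setT)).
  by move=> i /=; apply: IF; case: ifP.
apply/seteqP; split => w /=.
  move=> H; split => i /= Ki.
    by have := H i; rewrite /= inE Ki /= => /(_ isT)[].
  by have := H i; rewrite /= inE Ki orbT /= => /(_ isT)[].
move=> [H H'] i /= Ki; split; case: ifP => // k; [exact: H|exact: H'].
Qed.

Lemma rectangles_measurable J : rectangles J `<=` measurable.
Proof.
move=> _ [K KJ [A FA <-]]; apply: fin_bigcap_measurable => //= i _; exact/mF/FA.
Qed.

Lemma rectangles_indep J1 J2 : J1 `&` J2 = set0 ->
  forall A B, rectangles J1 A -> rectangles J2 B -> indep A B.
Proof.
move=> J12 _ _ [K KJ [A FA <-]] [K' KJ' [A' FA' <-]].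
have KK' i : i \in K -> i \in K' -> False.
  move=> iK iK'; have : (J1 `&` J2) i by split; [exact: KJ|exact: KJ'].
  by rewrite J12.
pose C i := if i \in K then A i else A' i.
have FC i : F i (C i) by rewrite /C; case: ifP.
have mcap (L : {fset I}) (E : I -> set T) : (forall i, F i (E i)) ->
    measurable (\bigcap_(i in [set` L]) E i).
  by move=> FE; apply: fin_bigcap_measurable => //= i _; exact/mF/FE.
rewrite /indep; have -> : \bigcap_(i in [set` K]) A i `&` \bigcap_(i in [set` K']) A' i =
    \bigcap_(i in [set` (K `|` K')%fset]) C i.
  apply/seteqP; split => w /=.
    move=> [H H'] i /=; rewrite inE /C; case: ifP => /= [iK _|_ iK'].
      exact: H.
    exact: H'.
  move=> H; split => i /= Ki.
    by have := H i; rewrite /= inE /C Ki; exact.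
  have := H i; rewrite /= inE /C Ki orbT; case: ifP => [iK|_]; last exact.
  by case: (KK' i).
apply: EFin_inj; rewrite EFinM -!prE; try exact: mcap.
rewrite !indF//; rewrite (big_fsetID _ (mem K))/=.
rewrite (_ : [fset _ | _ in _ & _]%fset = K); last first.
  apply/fsetP => i; rewrite !inE /=; case iK: (i \in K); rewrite /= ?andbF//.
rewrite (_ : [fset _ | _ in _ & _]%fset = K'); last first.
  apply/fsetP => i; rewrite !inE /=; case iK: (i \in K); rewrite /= ?andbT//.
  by case iK': (i \in K') => //; case: (KK' i).
congr (_ * _)%E; apply: eq_big_seq => i Ki; rewrite /C ?Ki//.
by case: ifP => // iK; case: (KK' i).
Qed.

Lemma block_rectangles J : block J `<=` <<s rectangles J >>.
Proof.
apply: smallest_sub; first exact: smallest_sigma_algebra.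
move=> A [i Ji FA]; apply: sub_sigma_algebra; exists [fset i]%fset.
  by move=> j /=; rewrite inE => /eqP ->.
exists (fun j => if pselect (j = i) is left _ then A else setT).
  by move=> j; case: pselect => [->|].
apply/seteqP; split => w /=.
  by move=> /(_ i); rewrite /= inE eqxx; case: pselect => //= _; exact.
by move=> Aw j _; case: pselect.
Qed.

Lemma block_indep J1 J2 : J1 `&` J2 = set0 ->
  forall A B, block J1 A -> block J2 B -> indep A B.
Proof.
move=> J12 A B /block_rectangles bA /block_rectangles bB; apply: indep_sigma bA bB.
- exact: rectangles_setI_closed.
- exact: rectangles_setI_closed.
- exact: rectangles_measurable.
- exact: rectangles_measurable.
- exact: rectangles_indep.
Qed.

Lemma block_sigma_algebra J : sigma_algebra setT (block J).
Proof. exact: smallest_sigma_algebra. Qed.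

Lemma block_sub J1 J2 : J1 `<=` J2 -> block J1 `<=` block J2.
Proof. by move=> J12; apply: sub_sigma_algebra2 => A [i /J12]; exists i. Qed.

Lemma block_measurable J : block J `<=` measurable.
Proof.
apply: smallest_sub (sigma_algebra_measurable T) _.
by move=> A [i _] /mF.
Qed.

Lemma block_source J i A : J i -> F i A -> block J A.
Proof. by move=> Ji FA; apply: sub_sigma_algebra; exists i. Qed.

End Blocks.
End Pr.


(** * Edges of the graph on a fixed tree *)

Lemma suffix_child (b : bool) (r u : vertex) : suffix (b :: r) u -> suffix r u.
Proof. by move=> /(catl_suffix (s := [:: b])). Qed.

Lemma suffix_child_self (b : bool) (r : vertex) : ~~ suffix (b :: r) r.
Proof. by apply/negP => /size_suffix; rewrite ltnn. Qed.

Lemma suffix_children (r u : vertex) :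
  suffix (false :: r) u -> suffix (true :: r) u -> False.
Proof.
move=> /suffixP[s ->] /suffixP[s' /(congr1 rev)].
rewrite !rev_cat !rev_cons !cat_rcons => /eqP; rewrite eqseq_cat//.
by rewrite eqxx.
Qed.

(* A finite binary tree with its leaves split into two classes.  Together with
   the name [r] of its root it describes a set of vertices: the children of the
   root are named [false :: r] and [true :: r], so the descendants of [r] are the
   vertices with suffix [r]. *)
Inductive ltree := LLeaf of bool | LNode of ltree & ltree.

Section Law.
Variables (R : realType) (d : measure_display) (T : measurableType d).
Variables (P : probability T R) (X : randomness P).
Local Notation pr := (pr P).
Local Notation block := (block (sources X)).

Lemma sources_setI_closed i : setI_closed (sources X i).
Proof.
by case: i => [[v|v]|[e v]] _ _ [A mA <-] [B mB <-]; exists (A `&` B);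
  rewrite ?setTI//; exact: measurableI.
Qed.

Lemma sources_setT i : sources X i setT.
Proof. by case: i => [[v|v]|[e v]]; exists setT; rewrite ?setTI. Qed.

Lemma sources_measurable i : sources X i `<=` measurable.
Proof.
by case: i => [[v|v]|[e v]] _ [A mA <-]; apply: measurable_funP.
Qed.

Lemma mblock J A : block J A -> measurable A.
Proof. by move/(block_measurable sources_measurable). Qed.

Lemma block_lifetime (J : set _) v (B : set R) : J (inl (inl v)) ->
  measurable B -> block J [set w | B (lifetime X v w)].
Proof. by move=> Jv mB; apply: (block_source Jv); exists B; rewrite ?setTI. Qed.

Lemma block_new_edges (J : set _) v (B : set nat) : J (inl (inr v)) ->
  block J [set w | B (new_edges X v w)].
Proof. by move=> Jv; apply: (block_source Jv); exists B; rewrite ?setTI. Qed.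

Lemma block_side (J : set _) e v (B : set bool) : J (inr (e, v)) ->
  block J [set w | B (side X e v w)].
Proof. by move=> Jv; apply: (block_source Jv); exists B; rewrite ?setTI. Qed.

Definition side_block (e : edge) (r : vertex) :
    set (vertex + vertex + edge * vertex) :=
  [set i | exists2 u, i = inr (e, u) & suffix r u].

Definition edges_block (r : vertex) (n : nat) :
    set (vertex + vertex + edge * vertex) :=
  [set i | exists k u, [/\ i = inr (r, k, u), suffix r u & (k < n)%N]].

(** An edge is attributed to the vertex [e.1] at which it was created, not to the vertices that its
    ends visit. Edges created at [r] descend through both subtrees below, yet their sides belong to
    neither child's block. *)
Definition graph_block (r : vertex) : set (vertex + vertex + edge * vertex) :=
  [set i | match i with
    | inl (inl _) => False | inl (inr u) => suffix r u
    | inr (e, _) => suffix r e.1 end].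

Definition life_block (r : vertex) : set (vertex + vertex + edge * vertex) :=
  [set i | if i is inl (inl u) then suffix r u else False].

Fixpoint end_label (e : edge) (r : vertex) (s : ltree) (w : T) : bool :=
  match s with
  | LLeaf b => b
  | LNode x y => if side X e r w then end_label e (true :: r) y w
                 else end_label e (false :: r) x w
  end.

Variable Rl : bool -> bool -> bool.

(* With [Rl := eqb], no edge crosses the cut; with [Rl := untouched] below, no edge
   meets a marked leaf. *)
Fixpoint edges_ok (r : vertex) (s : ltree) (w : T) : Prop :=
  if s is LNode x y then
    [/\ forall k, (k < new_edges X r w)%N ->
          Rl (end_label (r, k) (false :: r) x w) (end_label (r, k) (true :: r) y w),
        edges_ok (false :: r) x w & edges_ok (true :: r) y w]
  else True.

(* The probability that an end of an edge that starts at the root moves to a leaf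
   labelled [true]. *)
Fixpoint hmass (s : ltree) : R :=
  if s is LNode x y then (hmass x + hmass y) / 2 else if s is LLeaf true then 1 else 0.

Definition bern (p : R) (b : bool) : R := if b then p else 1 - p.

Definition pair_ok (p q : R) : R :=
  \sum_(a : bool) \sum_(b : bool) (Rl a b)%:R * (bern p a * bern q b).

(* [lambda * energy s] is the mean number of edges violating [Rl]; the mean number
   of edges created at a node is [lambda / 2], hence the factor [1 / 2]. *)
Fixpoint energy (s : ltree) : R :=
  if s is LNode x y then
    energy x + energy y + (1 - pair_ok (hmass x) (hmass y)) / 2
  else 0.

Lemma block_end_label e r s b :
  block (side_block e r) [set w | end_label e r s w = b].
Proof.
elim: s r => [c|x IHx y IHy] r /=.
  exact: (sigma_cst (block_sigma_algebra _ _) (c = b)).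
have sB := block_sigma_algebra (sources X) (side_block e r).
have sub c : side_block e (c :: r) `<=` side_block e r.
  by move=> _ [u -> /suffix_child]; exists u.
have H : block (side_block e r) [set w | (side X e r w = true -> end_label e (true :: r) y w = b)
   /\ (side X e r w = false -> end_label e (false :: r) x w = b)].
  have Sr : side_block e r (inr (e, r)) by exists r => //; exact: suffix_refl.
  apply: (sigma_and sB); apply: (sigma_imply sB).
  - exact: (block_side [set true]).
  - exact: (block_sub (sub _) (IHy _)).
  - exact: (block_side [set false]).
  - exact: (block_sub (sub _) (IHx _)).
move: H; congr (block _ _); apply/seteqP; split => w /=.
  by case=> Ht Hf; case: ifP.
by case: ifP => _ H; split.
Qed.

Arguments block_end_label e r s b : clear implicits.

Lemma block_edges_ok r s : block (graph_block r) [set w | edges_ok r s w].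
Proof.
have sB := block_sigma_algebra (sources X) (graph_block _).
elim: s r => [c|x IHx y IHy] r /=; first exact: sigma_cst.
have sub c : graph_block (c :: r) `<=` graph_block r.
  by case=> [[u|u]|[e u]] //= /suffix_child.
have sub' k c : side_block (r, k) c `<=` graph_block r.
  by move=> _ [u -> _] /=; exact: suffix_refl.
have H : block (graph_block r) [set w | (forall k, (k < new_edges X r w)%N ->
    forall a b, end_label (r, k) (false :: r) x w = a ->
      end_label (r, k) (true :: r) y w = b -> Rl a b) /\
    (edges_ok (false :: r) x w /\ edges_ok (true :: r) y w)].
  apply: (sigma_and (sB _)); last first.
    by apply: (sigma_and (sB _)); [exact: (block_sub (sub _) (IHx _))|exact: (block_sub (sub _) (IHy _))].
  apply: (sigma_forall (sB _)) => k; apply: (sigma_imply (sB _)).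
    by apply: (block_new_edges [set n | (k < n)%N]); exact: suffix_refl.
  apply: (sigma_forall (sB _)) => a; apply: (sigma_forall (sB _)) => b.
  apply: (sigma_imply (sB _)); last apply: (sigma_imply (sB _)).
  - exact: (block_sub (sub' _ _) (block_end_label _ _ _ _)).
  - exact: (block_sub (sub' _ _) (block_end_label _ _ _ _)).
  - exact: sigma_cst.
move: H; congr (block _ _); apply/seteqP; split => w /=.
  by case=> H [? ?]; split=> // k /H; exact.
by case=> H ? ?; split=> // k /H + a b <- <-.
Qed.

Arguments block_edges_ok r s : clear implicits.

Variable lambda : R.
Hypothesis lambda_gt0 : 0 < lambda.
Hypothesis XP : full_process_randomness X lambda.

Lemma indep_blocks J1 J2 : J1 `&` J2 = set0 ->
  forall A B, block J1 A -> block J2 B -> pr (A `&` B) = pr A * pr B.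
Proof.
case: XP => _ _ _ ind J12 A B bA bB.
exact: (block_indep sources_setI_closed sources_setT sources_measurable ind J12).
Qed.

Lemma pr_side e v b : pr [set w | side X e v w = b] = 1 / 2.
Proof.
case: XP => _ _ /(_ e v [set b]) + _; rewrite /distribution /pushforward /pr => H.
rewrite (_ : [set w | _] = side X e v @^-1` [set b])//.
rewrite H//.
rewrite /bernoulli_prob fsbig_set1 /bernoulli_pmf ifT; last by apply/andP; split; lra.
by case: (b) => /=; lra.
Qed.

Lemma pr_new_edges v n :
  pr [set w | new_edges X v w = n] = (lambda / 2) ^+ n / n`!%:R * expR (- (lambda / 2)).
Proof.
case: XP => _ /(_ v [set n]) + _ _; rewrite /distribution /pushforward /pr => H.
rewrite (_ : [set w | _] = new_edges X v @^-1` [set n])// H//.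
have l2 : 0 < lambda / 2 by move: lambda_gt0; lra.
rewrite /poisson_prob l2 esum_set1 /poisson_pmf ?l2//.
by rewrite lee_fin !mulr_ge0// ?expR_ge0// ?invr_ge0// exprn_ge0// ltW.
Qed.

Lemma pr_end_label e r s b :
  pr [set w | end_label e r s w = b] = bern (hmass s) b.
Proof.
have mE r' s' b' : measurable [set w | end_label e r' s' w = b'].
  exact: mblock (block_end_label _ _ _ _).
suff H : forall r, pr [set w | end_label e r s w = true] = hmass s.
  case: b => /=; first exact: H.
  rewrite (_ : [set w | _] = ~` [set w | end_label e r s w = true]) ?prC ?H//.
  by apply/seteqP; split => w /=; case: end_label.
elim: s {r b} => [c|x IHx y IHy] r /=.
  case: c; first by rewrite (_ : [set w | _] = setT) ?prT//; apply/seteqP; split.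
  by rewrite (_ : [set w | _] = set0) ?pr0//; apply/seteqP; split.
have bS c : block [set inr (e, r)] [set w | side X e r w = c].
  exact: (block_side [set c]).
have mS c : measurable [set w | side X e r w = c] by exact: mblock (bS c).
rewrite (_ : [set w | _] =
   ([set w | side X e r w = false] `&` [set w | end_label e (false :: r) x w = true]) `|`
   ([set w | side X e r w = true] `&` [set w | end_label e (true :: r) y w = true])); last first.
  apply/seteqP; split => w /=; first by case: ifP => ? ?; [right|left].
  by case=> -[->].
have dis c : [set inr (e, r)] `&` side_block e (c :: r) = set0.
  apply/seteqP; split => i //= [-> [u [<-]]].
  by rewrite (negbTE (suffix_child_self _ _)).
rewrite prU; try exact: measurableI; last first.
  by apply/seteqP; split => w //= [[-> _] []].
rewrite (indep_blocks (dis false))//; last exact: block_end_label.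
rewrite (indep_blocks (dis true))//; last exact: block_end_label.
by rewrite !pr_side IHx IHy; lra.
Qed.

(** The two ends of an edge descend through different children of [r], so they read disjoint
    families of sides and their final labels are independent. *)
Lemma pr_pair_ok e r x y :
  pr [set w | Rl (end_label e (false :: r) x w) (end_label e (true :: r) y w)]
  = pair_ok (hmass x) (hmass y).
Proof.
have bE := block_end_label e.
have mE c s b : measurable [set w | end_label e c s w = b] by exact: mblock (bE _ _ _).
have dis : side_block e (false :: r) `&` side_block e (true :: r) = set0.
  apply/seteqP; split => i //= [[u -> Hu] [u' [<-]]].
  exact: suffix_children Hu.
have mEE a b : measurable ([set w | end_label e (false :: r) x w = a] `&`
       [set w | end_label e (true :: r) y w = b]) by exact: measurableI.
pose A a b := if Rl a b then [set w | end_label e (false :: r) x w = a] `&`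
       [set w | end_label e (true :: r) y w = b] else set0.
have mA a b : measurable (A a b) by rewrite /A; case: ifP.
have prA a b : pr (A a b) = (Rl a b)%:R * (bern (hmass x) a * bern (hmass y) b).
  rewrite /A; case: (Rl a b); last by rewrite pr0 mul0r.
  by rewrite mul1r (indep_blocks dis)// !pr_end_label.
rewrite /pair_ok !big_bool -!prA.
rewrite (_ : [set w | _] = (A true true `|` A true false) `|` (A false true `|` A false false)).
  have dA a b a' b' : (a, b) != (a', b') -> A a b `&` A a' b' = set0.
    move=> /eqP ab; rewrite /A; case: ifP => _; last by rewrite set0I.
    case: ifP => _; last by rewrite setI0.
    apply/seteqP; split => w //= [[e1 e2] [e3 e4]].
    by apply: ab; rewrite -e1 -e2 -e3 -e4.
  rewrite prU; try exact: measurableU; last first.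
    by rewrite setIUl !setIUr !dA// !setU0.
  by rewrite !prU// dA.
apply/seteqP; split => w /=; rewrite /A.
  case ax: (end_label e (false :: r) x w); case ay: (end_label e (true :: r) y w) => Ray.
  - by left; left; rewrite Ray.
  - by left; right; rewrite Ray.
  - by right; left; rewrite Ray.
  - by right; right; rewrite Ray.
by move=> [[]|[]]; case: ifP => //= ? [-> ->].
Qed.

(** This is the generating function of the Poisson law of mean [x], evaluated at [g]. *)
Lemma sum_poisson_pow (x g : R) : 
  (\sum_(0 <= n <oo) ((x ^+ n / n`!%:R * expR (- x)) * g ^+ n)%:E = (expR (- (x * (1 - g))))%:E)%E.
Proof.
have H : series (fun n => (x ^+ n / n`!%:R * expR (- x)) * g ^+ n) @ \oo -->
    expR (- (x * (1 - g))).
  have -> : expR (- (x * (1 - g))) = expR (- x) * expR (x * g).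
    by rewrite -expRD; congr expR; ring.
  rewrite (_ : series _ = (fun n => expR (- x) * series (exp_coeff (x * g)) n)); last first.
    apply/funext => n; rewrite /series /= mulr_sumr; apply: eq_bigr => i _.
    by rewrite /exp_coeff /= exprMn; ring.
  by apply: cvgMr; rewrite /expR; exact: is_cvg_series_exp_coeff.
apply/cvg_lim => //; rewrite (_ : (fun n => _) = EFin \o series
   (fun n => (x ^+ n / n`!%:R * expR (- x)) * g ^+ n)).
  by apply: cvg_comp H _.
by apply/funext => n; rewrite /series /= sumEFin.
Qed.

Lemma pr_edges_pow (r : vertex) (E : nat -> set T) (g : R) :
  (forall k, block (side_block (r, k) r) (E k)) ->
  (forall k, pr (E k) = g) -> forall n,
  block (edges_block r n) [set w | forall k, (k < n)%N -> E k w] /\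
  pr [set w | forall k, (k < n)%N -> E k w] = g ^+ n.
Proof.
move=> bE Eg; have sub n k : (k < n)%N -> side_block (r, k) r `<=` edges_block r n.
  by move=> kn _ [u -> ru]; exists k, u.
have bA n : block (edges_block r n) [set w | forall k, (k < n)%N -> E k w].
  have sB := block_sigma_algebra (sources X) (edges_block r n).
  apply: (sigma_forall sB) => k; have [kn|kn] := ltnP k n; last first.
    by have := sigma_cst sB True; congr (block _ _); apply/seteqP; split.
  have := block_sub (sub _ _ kn) (bE k).
  by congr (block _ _); apply/seteqP; split => w /=; [|exact].
elim=> [|n [_ IHn]]; split=> //.
  by rewrite expr0 (_ : [set w | _] = setT) ?prT//; apply/seteqP; split.
rewrite (_ : [set w | _] = [set w | forall k, (k < n)%N -> E k w] `&` E n); last first.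
  apply/seteqP; split => w /=.
    by move=> H; split; [move=> k kn; exact/H/ltnW|exact: H].
  by move=> [H En] k; rewrite ltnS leq_eqVlt => /orP[/eqP ->//|/H].
rewrite (@indep_blocks (edges_block r n) (side_block (r, n) r))//.
  by rewrite IHn Eg exprSr.
apply/seteqP; split => i //= [[k [u [-> _ kn]]] [u' [kk _]]].
by move: kn; rewrite kk ltnn.
Qed.

(** Given that [n] edges are created, distinct edges read disjoint sides and all behave well with
    probability [g ^+ n]; averaging over the Poisson number [n] gives the exponential. *)
Lemma pr_all_edges (r : vertex) (E : nat -> set T) (g : R) :
  (forall k, block (side_block (r, k) r) (E k)) -> (forall k, pr (E k) = g) ->
  pr [set w | forall k, (k < new_edges X r w)%N -> E k w] =
  expR (- (lambda / 2 * (1 - g))).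
Proof.
move=> bE Eg; pose A n := [set w | forall k, (k < n)%N -> E k w].
pose N n := [set w | new_edges X r w = n].
have bA n : block (edges_block r n) (A n) by case: (pr_edges_pow bE Eg n).
have bN n : block [set inl (inr r)] (N n) by exact: (block_new_edges [set n]).
have mA n : measurable (N n `&` A n).
  by apply: measurableI; [exact: mblock (bN n)|exact: mblock (bA n)].
rewrite (_ : [set w | _] = \bigcup_n (N n `&` A n)); last first.
  apply/seteqP; split => w /=; first by exists (new_edges X r w).
  by move=> [n _ [<-]].
apply: EFin_inj; rewrite -sum_poisson_pow -prE; last exact: bigcupT_measurable.
rewrite measure_semi_bigcup//; last 2 first.
- apply/trivIsetP => i j _ _ /eqP ij; apply/seteqP; split => w //= [[iw _] [jw _]].
  by apply: ij; rewrite -iw -jw.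
- exact: bigcupT_measurable.
apply: eq_eseriesr => n _ /=; rewrite prE//; congr EFin.
rewrite (@indep_blocks [set inl (inr r)] (edges_block r n))//; last first.
  by apply/seteqP; split => i //= [-> [k [u []]]].
by case: (pr_edges_pow bE Eg n) => _; rewrite /A => ->; rewrite pr_new_edges.
Qed.

(** The edges created at [r], those created below its first child and those created below its second
    child use disjoint sources: the three probabilities multiply, hence the energies add. *)
Lemma pr_edges_ok r s :
  pr [set w | edges_ok r s w] = expR (- (lambda * energy s)).
Proof.
elim: s r => [c|x IHx y IHy] r /=.
  rewrite (_ : [set w | _] = setT) ?prT; last by apply/seteqP; split.
  by rewrite mulr0 oppr0 expR0.
pose E k := [set w | Rl (end_label (r, k) (false :: r) x w) (end_label (r, k) (true :: r) y w)].
pose A := [set w | forall k, (k < new_edges X r w)%N -> E k w].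
pose J : set (vertex + vertex + edge * vertex) :=
  [set i | match i with | inl (inr u) => u = r | inr (e, _) => e.1 = r | _ => False end].
have bE k : block (side_block (r, k) r) (E k).
  have sB := block_sigma_algebra (sources X) (side_block (r, k) r).
  have H : block (side_block (r, k) r) [set w | forall a b,
      end_label (r, k) (false :: r) x w = a ->
      end_label (r, k) (true :: r) y w = b -> Rl a b].
    have sub c : side_block (r, k) (c :: r) `<=` side_block (r, k) r.
      by move=> _ [u -> /suffix_child]; exists u.
    apply: (sigma_forall sB) => a; apply: (sigma_forall sB) => b.
    apply: (sigma_imply sB); last apply: (sigma_imply sB).
    - exact: (block_sub (sub _) (block_end_label _ _ _ _)).
    - exact: (block_sub (sub _) (block_end_label _ _ _ _)).
    - exact: sigma_cst.
  move: H; congr (block _ _); apply/seteqP; split => w /=; first exact.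
  by move=> H a b <- <-.
have bA : block J A.
  have sB := block_sigma_algebra (sources X) J.
  apply: (sigma_forall sB) => k; apply: (sigma_imply sB).
    exact: (block_new_edges [set n | (k < n)%N]).
  by apply: (block_sub _ (bE k)) => _ [u -> _].
have sJ i c : J i -> graph_block (c :: r) i -> False.
  by case: i => [[u|u]|[e u]] //=; rewrite /J /= => ->; exact/negP/suffix_child_self.
rewrite (_ : [set w | _] = A `&`
   ([set w | edges_ok (false :: r) x w] `&` [set w | edges_ok (true :: r) y w])); last first.
  by apply/seteqP; split => w /=; [case|case=> ? []].
have bxy : block (graph_block (false :: r) `|` graph_block (true :: r))
   ([set w | edges_ok (false :: r) x w] `&` [set w | edges_ok (true :: r) y w]).
  apply: (sigma_and (block_sigma_algebra _ _)).
  - by apply: (block_sub _ (block_edges_ok _ _)); exact: subsetUl.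
  - by apply: (block_sub _ (block_edges_ok _ _)); exact: subsetUr.
rewrite (indep_blocks _ bA bxy); last first.
  by apply/seteqP; split => i //= [Ji [/(sJ _ _ Ji)|/(sJ _ _ Ji)]].
rewrite (indep_blocks _ (block_edges_ok _ _) (block_edges_ok _ _)); last first.
  by apply/seteqP; split => -[[u|u]|[e u]] //= [] //; exact: suffix_children.
rewrite (pr_all_edges bE (fun k => pr_pair_ok _ _ _ _)) IHx IHy -!expRD.
by congr expR; field.
Qed.

End Law.


(** * The expected number of uncrossed cuts of a fixed tree *)

Section CutCost.
Variables (R : realType) (eta : R).
Hypotheses (eta_gt0 : 0 < eta) (eta_le : eta <= 1 / 48).

Implicit Types s p q : R.

(** The minimum treats a cut and its complement alike, as they separate the same two classes. The
    factor [1 - eta] creates the slack found in [merge_cost0]. *)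
Definition potential (p : R) : R := (1 - eta) * Num.min p (1 - p).

(* What is gained when two trees whose cuts have measures [p] and [q] are joined
   under a new root: the energy of the new root, plus the potential at slope [s],
   minus the two potentials at the slope [(1 + s) / 2] of the children. *)
Definition merge_cost (s p q : R) : R :=
  (p + q - 2 * p * q) / 2 + s * potential ((p + q) / 2) -
  (1 + s) / 2 * (potential p + potential q).

(* A lower bound for the merge cost when one cut is the whole of its subtree and the
   other one is empty or has measure at most [eta]. *)
Definition cherry_cost (s : R) : R := (1 - 2 * eta) * (1 + s * (1 - eta)) / 2.

Lemma merge_costC s p q : merge_cost s p q = merge_cost s q p.
Proof. by rewrite /merge_cost [p + q]addrC [potential p + _]addrC; congr (_ + _ - _); lra. Qed.

Lemma potentialC p : potential (1 - p) = potential p.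
Proof. by rewrite /potential (_ : 1 - (1 - p) = p); [rewrite minC|ring]. Qed.

Lemma merge_cost_compl s p q : merge_cost s (1 - p) (1 - q) = merge_cost s p q.
Proof.
rewrite /merge_cost !potentialC.
rewrite (_ : (1 - p + (1 - q)) / 2 = 1 - (p + q) / 2) ?potentialC; last by lra.
by congr (_ + _ - _); lra.
Qed.

Lemma potential0 : potential 0 = 0.
Proof. by rewrite /potential subr0 minEle ler01 mulr0. Qed.

Lemma potential1 : potential 1 = 0.
Proof. by rewrite -{1}(subr0 1) potentialC potential0. Qed.

(** For [p <= 1 / 2] the first-order terms cancel, thanks to the slope [(1 + s) / 2] of the
    children, and exactly the slack [eta * p / 2] is left. Beyond [1 / 2] the fold of the minimum
    only adds to it. *)
Lemma merge_cost0 s p : 0 <= s <= 1 -> 0 <= p <= 1 ->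
  eta * p / 2 <= merge_cost s p 0.
Proof.
move: eta_gt0 eta_le => e0 e1 /andP[s0 s1] /andP[p0 p1].
rewrite /merge_cost potential0 addr0 /potential !minEle.
rewrite addr0; have -> : (p / 2 <= 1 - p / 2) = true by apply/idP; lra.
case: (leP p (1 - p)) => h2; first by lra.
have : 0 <= (1 + s) * (1 - eta) * (2 * p - 1) by rewrite !mulr_ge0//; lra.
lra.
Qed.

Lemma merge_cost1 s p : 0 <= s <= 1 -> 0 <= p <= 1 ->
  eta * (1 - p) / 2 <= merge_cost s p 1.
Proof.
move=> s01 p01; rewrite -merge_cost_compl subrr; apply: merge_cost0 => //.
by move: p01; lra.
Qed.

(** At [p = 0] the cost is exactly [(1 + s * (1 - eta)) / 2]; the factor [1 - 2 * eta] in
    [cherry_cost] pays for moving [p] up to [eta]. *)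
Lemma merge_cost_small1 s p : 0 <= s <= 1 -> 0 <= p <= eta ->
  cherry_cost s <= merge_cost s p 1.
Proof.
move: eta_gt0 eta_le => e0 e1 /andP[s0 s1] /andP[p0 p1].
rewrite /merge_cost /cherry_cost potential1 addr0 /potential !minEle.
have -> : (p <= 1 - p) = true by apply/idP; lra.
have -> : ((p + 1) / 2 <= 1 - (p + 1) / 2) = (p == 0).
  by apply/idP/eqP => H; lra.
have : 0 <= s * (1 - eta) * (eta - p) by rewrite !mulr_ge0//; lra.
case: eqP => [->|_]; nra.
Qed.

Lemma merge_cost_big0 s p : 0 <= s <= 1 -> 1 - eta <= p <= 1 ->
  cherry_cost s <= merge_cost s p 0.
Proof.
move=> s01 p01; rewrite -merge_cost_compl subr0; apply: merge_cost_small1 => //.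
by move: p01; lra.
Qed.

Lemma merge_cost01 s : 0 <= s <= 1 -> cherry_cost s <= merge_cost s 0 1.
Proof. by move=> s01; apply: merge_cost_small1 => //; move: eta_gt0; lra. Qed.

(** The critical case is [p = q = 1 / 2], where the cost is [eta / 2 - 1 / 4]: the loss is the
    second-order term [p * q]. Swapping and complementing reduce to [p <= q] and [p + q <= 1]. *)
Lemma merge_cost_ge s p q : 0 <= s <= 1 -> 0 <= p <= 1 -> 0 <= q <= 1 ->
  - (1 / 4) <= merge_cost s p q.
Proof.
wlog: p q / p + q <= 1 => [H s01 p01 q01|].
  have [pq|pq] := leP (p + q) 1; first exact: H.
  by rewrite -merge_cost_compl; apply: H => //; lra.
wlog: p q / p <= q => [H pq s01 p01 q01|].
  have [p_le_q|q_lt_p] := leP p q; first exact: H.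
  by rewrite merge_costC; apply: H => //; lra.
move: eta_gt0 eta_le => e0 e1 pq1 pq /andP[s0 s1] /andP[p0 p1] /andP[q0 q1].
rewrite /merge_cost /potential !minEle.
have -> : ((p + q) / 2 <= 1 - (p + q) / 2) = true by apply/idP; lra.
have -> : (p <= 1 - p) = true by apply/idP; lra.
case: (leP q (1 - q)) => h.
  have -> : (p + q - 2 * p * q) / 2 + s * ((1 - eta) * ((p + q) / 2)) -
   (1 + s) / 2 * ((1 - eta) * p + (1 - eta) * q) = eta * (p + q) / 2 - p * q by lra.
  nra.
have -> : (p + q - 2 * p * q) / 2 + s * ((1 - eta) * ((p + q) / 2)) -
   (1 + s) / 2 * ((1 - eta) * p + (1 - eta) * (1 - q)) =
   eta * (p + q) / 2 - p * q + (1 - eta) * (1 + s) * (2 * q - 1) / 2 by lra.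
have pq' : p * q <= (1 - q) * q by nra.
have : 0 <= (1 - eta) * s * (2 * q - 1) by rewrite !mulr_ge0//; lra.
nra.
Qed.

Lemma potential_ge0 p : 0 <= p <= 1 -> 0 <= potential p.
Proof.
move: eta_le => e1 /andP[p0 p1]; rewrite /potential mulr_ge0//; first by lra.
by rewrite le_min p0; lra.
Qed.

Lemma potential_le p : 0 <= p <= 1 -> potential p <= p.
Proof.
move: eta_gt0 eta_le => e0 e1 /andP[p0 p1]; rewrite /potential.
apply: (@le_trans _ _ ((1 - eta) * p)); last by nra.
by rewrite ler_wpM2l//; [lra|rewrite ge_min lexx].
Qed.

(** An edge created at the new root is almost surely cut, which is worth nearly [1 / 2], while each
    of the two potentials to be refunded is at most [eta]. *)
Lemma merge_cost_opposite s p q : 0 <= s <= 1 -> 0 <= p <= eta -> 1 - eta <= q <= 1 ->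
  1 / 2 - 3 * eta <= merge_cost s p q.
Proof.
move: eta_gt0 eta_le => e0 e1 /andP[s0 s1] /andP[p0 p1] /andP[q0 q1].
have fp : potential p <= eta by apply: (le_trans _ p1); apply: potential_le; lra.
have fq : potential q <= eta.
  by rewrite -potentialC; apply: (@le_trans _ _ (1 - q)); [apply: potential_le; lra|lra].
have fpq : 0 <= s * potential ((p + q) / 2) by rewrite mulr_ge0// potential_ge0//; lra.
have : (1 + s) / 2 * (potential p + potential q) <= 2 * eta by nra.
have : (1 - eta) * (1 - eta) <= p * (1 - q) + q * (1 - p).
  have : 0 <= p * (1 - q) by rewrite mulr_ge0//; lra.
  nra.
rewrite /merge_cost; nra.
Qed.

(** After complementing, [p <= eta]; unless [q] is close to [1], where the cost is positive, the
    only loss is [p * q <= eta]. *)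
Lemma merge_cost_small s p q : 0 <= s <= 1 -> 0 <= p <= 1 -> 0 <= q <= 1 ->
  (p <= eta) || (1 - eta <= p) -> - eta <= merge_cost s p q.
Proof.
wlog: p q / p <= eta => [H s01 p01 q01|].
  move=> /orP[pe|pe]; first by apply: H => //; rewrite pe.
  by rewrite -merge_cost_compl; apply: H => //; lra.
move: eta_gt0 eta_le => e0 e1 pe /andP[s0 s1] /andP[p0 p1] /andP[q0 q1] _.
have [qe|qe] := leP (1 - eta) q.
  apply: (@le_trans _ _ (1 / 2 - 3 * eta)); first by lra.
  by apply: merge_cost_opposite; rewrite ?s0 ?p0 ?qe.
rewrite /merge_cost /potential !minEle.
have -> : (p <= 1 - p) = true by apply/idP; lra.
have -> : ((p + q) / 2 <= 1 - (p + q) / 2) = true by apply/idP; lra.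
case: (leP q (1 - q)) => h2.
- have -> : (p + q - 2 * p * q) / 2 + s * ((1 - eta) * ((p + q) / 2)) -
   (1 + s) / 2 * ((1 - eta) * p + (1 - eta) * q) = eta * (p + q) / 2 - p * q by lra.
  nra.
- have -> : (p + q - 2 * p * q) / 2 + s * ((1 - eta) * ((p + q) / 2)) -
   (1 + s) / 2 * ((1 - eta) * p + (1 - eta) * (1 - q)) =
   eta * (p + q) / 2 - p * q + (1 - eta) * (1 + s) * (2 * q - 1) / 2 by lra.
  have : 0 <= (1 - eta) * (1 + s) * (2 * q - 1) by rewrite !mulr_ge0//; lra.
  nra.
Qed.

End CutCost.


Lemma expR_le_1D2x (R : realType) (x : R) : 0 <= x <= 1 / 2 -> expR x <= 1 + 2 * x.
Proof.
move=> /andP[x0 x1]; have := expR_ge1Dx (- x); rewrite expRN => H.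
have e0 := expR_gt0 x; have e1 : expR x * (expR x)^-1 = 1 by rewrite mulfV ?gt_eqF.
have ei : 0 < (expR x)^-1 by rewrite invr_gt0.
nra.
Qed.

(** * Enumeration of the cuts of a tree *)

Inductive btree := BLeaf | BNode of btree & btree.

Fixpoint leaves (t : btree) : nat :=
  if t is BNode a b then (leaves a + leaves b)%N else 1%N.

Fixpoint uniform (c : bool) (t : btree) : ltree :=
  if t is BNode a b then LNode (uniform c a) (uniform c b) else LLeaf c.

Fixpoint ltree_shape (s : ltree) : btree :=
  if s is LNode x y then BNode (ltree_shape x) (ltree_shape y) else BLeaf.

(** The labellings using both labels, sorted by whether each subtree is unmarked, fully marked or
    itself mixed. A cut and its complement are both listed, which costs only a factor two in a union
    bound. *)
Fixpoint mixed (t : btree) : seq ltree :=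
  if t is BNode a b then
    [:: LNode (uniform false a) (uniform true b), LNode (uniform true a) (uniform false b) &
      [seq LNode x (uniform false b) | x <- mixed a] ++
      [seq LNode x (uniform true b) | x <- mixed a] ++
      [seq LNode (uniform false a) y | y <- mixed b] ++
      [seq LNode (uniform true a) y | y <- mixed b] ++
      [seq LNode x y | x <- mixed a, y <- mixed b]]
  else [::].

Fixpoint ltree_code (s : ltree) : GenTree.tree bool :=
  match s with
  | LLeaf c => GenTree.Leaf c
  | LNode x y => GenTree.Node 0 [:: ltree_code x; ltree_code y]
  end.

Fixpoint ltree_decode (c : GenTree.tree bool) : ltree :=
  match c with
  | GenTree.Leaf c => LLeaf c
  | GenTree.Node _ [:: x; y] => LNode (ltree_decode x) (ltree_decode y)
  | _ => LLeaf false
  end.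

Lemma ltree_codeK : cancel ltree_code ltree_decode.
Proof. by elim=> //= x -> y ->. Qed.

HB.instance Definition _ := Countable.copy ltree (can_type ltree_codeK).

Lemma mixedP (s : ltree) :
  [\/ s = uniform false (ltree_shape s), s = uniform true (ltree_shape s) | s \in mixed (ltree_shape s)].
Proof.
elim: s => [[]|x IHx y IHy]; [exact: Or32|exact: Or31|].
have inj (f : ltree -> ltree) (l : seq ltree) z : z \in l -> f z \in [seq f z | z <- l].
  exact: map_f.
rewrite /= !inE !mem_cat.
move: (ltree_shape x) (ltree_shape y) IHx IHy => a b.
case=> [->|->|mx]; case=> [->|->|my].
- exact: Or31.
- by apply: Or33; rewrite eqxx.
- by apply: Or33; rewrite (inj (LNode _))// !orbT.
- by apply: Or33; rewrite eqxx orbT.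
- exact: Or32.
- by apply: Or33; rewrite (inj (LNode _) _ _ my) !orbT.
- by apply: Or33; rewrite (inj (fun z => LNode z _) _ _ mx) !orbT.
- by apply: Or33; rewrite (inj (fun z => LNode z _) _ _ mx) !orbT.
- by apply: Or33; rewrite (allpairs_f _ mx my) !orbT.
Qed.

Section CutSum.
Variables (R : realType) (eta : R).
Hypotheses (eta_gt0 : 0 < eta) (eta_le : eta <= 1 / 48).
Variable lam : R.
Hypothesis lam_gt0 : 0 < lam.
Hypothesis lam_large : expR (- (lam * (eta ^+ 2 / 2))) <= 1 / 32.

Local Notation energy := (energy R eqb).
Local Notation hmass := (hmass R).
Local Notation merge_cost := (merge_cost eta).
Local Notation cherry_cost := (cherry_cost eta).
Local Notation potential := (potential eta).

Lemma hmass_ge0_le1 s : 0 <= hmass s <= 1.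
Proof.
elim: s => [[]|x IHx y IHy] /=; rewrite ?lexx ?ler01//.
by move: IHx IHy; lra.
Qed.

Lemma hmass_uniform c t : hmass (uniform c t) = c%:R.
Proof. by elim: t => [|a IHa b IHb] /=; [|rewrite IHa IHb]; case: (c) => /=; lra. Qed.

Lemma pair_ok_eqb (p q : R) : pair_ok eqb p q = p * q + (1 - p) * (1 - q).
Proof. by rewrite /pair_ok !big_bool /=; lra. Qed.

Lemma energy_uniform c t : energy (uniform c t) = 0.
Proof.
elim: t => [|a IHa b IHb] //=; rewrite IHa IHb !hmass_uniform pair_ok_eqb.
by case: (c) => /=; lra.
Qed.

(* Starting from slope [0] at the root of the whole tree, the slopes increase to
   [1] with the depth; at slope close to [1] a cut is charged almost the cost
   [lambda] of isolating one vertex, as soon as it appears. *)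
Definition child_slope (s : R) : R := (1 + s) / 2.

Definition weight (s : R) (x : ltree) : R :=
  expR (- (lam * (energy x + s * potential (hmass x)))).

Definition merge_weight (s p q : R) : R := expR (- (lam * merge_cost s p q)).

(** [merge_cost] is the defect of additivity of the exponent, so the two subtrees interact only
    through [merge_weight], that is, through their harmonic measures. *)
Lemma weight_node s x y : weight s (LNode x y) =
  weight (child_slope s) x * weight (child_slope s) y *
  merge_weight s (hmass x) (hmass y).
Proof.
rewrite /weight /merge_weight -!expRD; congr expR.
by rewrite /= pair_ok_eqb /merge_cost /child_slope; lra.
Qed.

Lemma weight_uniform s c t : weight s (uniform c t) = 1.
Proof.
rewrite /weight energy_uniform hmass_uniform; case: c.
  by rewrite potential1 mulr0 addr0 mulr0 oppr0 expR0.
by rewrite potential0 mulr0 addr0 mulr0 oppr0 expR0.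
Qed.

Lemma weight_ge0 s x : 0 <= weight s x.
Proof. exact: expR_ge0. Qed.

(* Joining two large cuts may cost [- 1 / 4], which is not affordable if there are
   many of them; so large cuts are also counted separately, by an induction in
   which the number of leaves plays no role: their weight decreases by a factor
   [tau] each time the tree grows. *)
Definition large (p : R) : bool := (eta < p) && (p < 1 - eta).

Definition cut_sum (s : R) (t : btree) : R := \sum_(x <- mixed t) weight s x.

Definition large_cut_sum (s : R) (t : btree) : R :=
  \sum_(x <- mixed t) (large (hmass x))%:R * weight s x.

Definition cherry_weight (s : R) : R := expR (- (lam * cherry_cost s)).

(** One term per internal node, for the cuts born there with one child subtree on each side;
    [cut_sum_bound] shows that these dominate the sum over all cuts. *)
Fixpoint cherry_sum (s : R) (t : btree) : R :=
  if t is BNode a b then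
    cherry_weight s + cherry_sum (child_slope s) a + cherry_sum (child_slope s) b
  else 0.

Lemma big_mixed_node (F : ltree -> R) a b :
  \sum_(x <- mixed (BNode a b)) F x =
  F (LNode (uniform false a) (uniform true b)) +
  F (LNode (uniform true a) (uniform false b)) +
  \sum_(x <- mixed a) (F (LNode x (uniform false b)) + F (LNode x (uniform true b))) +
  \sum_(y <- mixed b) (F (LNode (uniform false a) y) + F (LNode (uniform true a) y)) +
  \sum_(x <- mixed a) \sum_(y <- mixed b) F (LNode x y).
Proof.
rewrite /= !big_cons !big_cat/= !big_map big_allpairs_dep !big_split/=; ring.
Qed.

Lemma cut_sum_ge0 s t : 0 <= cut_sum s t.
Proof. by apply: sumr_ge0 => x _; exact: weight_ge0. Qed.

Lemma large_cut_sum_ge0 s t : 0 <= large_cut_sum s t.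
Proof. by apply: sumr_ge0 => x _; rewrite mulr_ge0// weight_ge0. Qed.

Lemma cherry_sum_ge0 s t : 0 <= cherry_sum s t.
Proof. by elim: t s => [|a IHa b IHb] s //=; rewrite !addr_ge0// expR_ge0. Qed.

Lemma merge_weight_le s p q c : c <= merge_cost s p q ->
  merge_weight s p q <= expR (- (lam * c)).
Proof. by move=> H; rewrite ler_expR lerN2 ler_wpM2l// ltW. Qed.

Lemma merge_weightC s p q : merge_weight s p q = merge_weight s q p.
Proof. by rewrite /merge_weight merge_costC. Qed.

Lemma expR_lam_le (c c' : R) : c' <= c -> expR (- (lam * c)) <= expR (- (lam * c')).
Proof. by move=> H; rewrite ler_expR lerN2 ler_wpM2l// ltW. Qed.

(** These bound four kinds of merging: [tau], a large cut with an undivided sibling; [K], two cuts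
    of which one is not large; [Q], two large cuts; [kappa], two cuts that are not large but on
    opposite sides. *)
Local Notation tau := (expR (- (lam * (eta ^+ 2 / 2)))).
Local Notation K := (expR (- (lam * - eta))).
Local Notation Q := (expR (- (lam * - (1 / 4)))).
Local Notation kappa := (expR (- (lam * (1 / 2 - 3 * eta)))).

Lemma largeN p : ~~ large p -> (p <= eta) || (1 - eta <= p).
Proof. by rewrite /large negb_and -!leNgt. Qed.

Lemma cherry_weight_le s : 0 <= s -> cherry_weight s <= kappa.
Proof.
move=> s0; apply: expR_lam_le; rewrite /cherry_cost.
by move: eta_gt0 eta_le => e0 e1; nra.
Qed.

Section Step.
Variables (s p : R).
Hypotheses (s01 : 0 <= s <= 1) (p01 : 0 <= p <= 1).

Lemma merge_weight0_le1 : merge_weight s p 0 <= 1.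
Proof.
apply: (@le_trans _ _ (expR (- (lam * 0)))); last by rewrite mulr0 oppr0 expR0.
apply: merge_weight_le.
apply: (le_trans _ (merge_cost0 eta_gt0 eta_le s01 p01)).
by move: eta_gt0 p01 => e0 /andP[p0 _]; nra.
Qed.

Lemma merge_weight1_le1 : merge_weight s p 1 <= 1.
Proof.
apply: (@le_trans _ _ (expR (- (lam * 0)))); last by rewrite mulr0 oppr0 expR0.
apply: merge_weight_le.
apply: (le_trans _ (merge_cost1 eta_gt0 eta_le s01 p01)).
by move: eta_gt0 p01 => e0 /andP[_ p0]; nra.
Qed.

Lemma merge_weight_large : large p ->
  merge_weight s p 0 <= tau /\ merge_weight s p 1 <= tau.
Proof.
move=> /andP[pl pr]; split; apply: merge_weight_le.
  apply: (le_trans _ (merge_cost0 eta_gt0 eta_le s01 p01)).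
  by move: eta_gt0 => e0; nra.
apply: (le_trans _ (merge_cost1 eta_gt0 eta_le s01 p01)).
by move: eta_gt0 => e0; nra.
Qed.

(** Of the two ways to label the sibling, the one agreeing with the majority of a small cut is free
    and the other pays a cherry. A large cut pays [tau] both times, and [2 * tau <= 1 / 16] yields
    the gain [15 / 16]. *)
Lemma merge_weight_pure : merge_weight s p 0 + merge_weight s p 1 <=
  1 + cherry_weight s - (large p)%:R * (15 / 16).
Proof.
have [lp|/largeN/orP[ps|pb]] /= := boolP (large p).
- have [h1 h2] := merge_weight_large lp.
  by have := expR_ge0 (- (lam * cherry_cost s)); rewrite -/(cherry_weight s); move: lam_large; lra.
- have := merge_weight0_le1.
  have : merge_weight s p 1 <= cherry_weight s.
    by apply: merge_weight_le; apply: merge_cost_small1 => //; rewrite ps; move: p01 => /andP[->].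
  by lra.
- have := merge_weight1_le1.
  have : merge_weight s p 0 <= cherry_weight s.
    by apply: merge_weight_le; apply: merge_cost_big0 => //; rewrite pb; move: p01 => /andP[_ ->].
  by lra.
Qed.

(** A cut that is not large stays so when its sibling carries its majority label, and otherwise it
    pays a cherry, at most [kappa]. A cut that is already large loses the factor [2 * tau]. *)
Lemma large_merge_weight_pure :
  (large ((p + 0) / 2))%:R * merge_weight s p 0 +
  (large ((p + 1) / 2))%:R * merge_weight s p 1 <= (large p)%:R * (1 / 16) + kappa.
Proof.
have w0 := expR_ge0 (- (lam * merge_cost s p 0)).
have w1 := expR_ge0 (- (lam * merge_cost s p 1)).
have k0 := expR_ge0 (- (lam * (1 / 2 - 3 * eta))).
rewrite -/(merge_weight _ _ _) in w0; rewrite -/(merge_weight _ _ _) in w1.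
have s0 : 0 <= s by case/andP: s01.
have le_ind (b : bool) (w : R) : 0 <= w -> b%:R * w <= w by case: b; rewrite ?mul1r ?mul0r.
have [lp|/largeN/orP[ps|pb]] /= := boolP (large p).
- have [h1 h2] := merge_weight_large lp.
  have := le_ind (large ((p + 0) / 2)) _ w0; have := le_ind (large ((p + 1) / 2)) _ w1.
  by move: lam_large; lra.
- have -> : large ((p + 0) / 2) = false.
    by apply/negbTE; rewrite /large negb_and -!leNgt; apply/orP; left; move: p01 => /andP[? ?]; lra.
  rewrite !mul0r; have := le_ind (large ((p + 1) / 2)) _ w1.
  have : merge_weight s p 1 <= cherry_weight s.
    by apply: merge_weight_le; apply: merge_cost_small1 => //; rewrite ps; move: p01 => /andP[->].
  by have := cherry_weight_le s0; lra.
- have -> : large ((p + 1) / 2) = false.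
    by apply/negbTE; rewrite /large negb_and -!leNgt; apply/orP; right; move: p01 => /andP[? ?]; lra.
  rewrite !mul0r; have := le_ind (large ((p + 0) / 2)) _ w0.
  have : merge_weight s p 0 <= cherry_weight s.
    by apply: merge_weight_le; apply: merge_cost_big0 => //; rewrite pb; move: p01 => /andP[_ ->].
  by have := cherry_weight_le s0; lra.
Qed.

Variable q : R.
Hypothesis q01 : 0 <= q <= 1.

Lemma merge_weight_small : ~~ large p -> merge_weight s p q <= K.
Proof. by move=> /largeN h; apply: merge_weight_le; exact: merge_cost_small. Qed.

End Step.

Lemma merge_weight_pair s p q : 0 <= s <= 1 -> 0 <= p <= 1 -> 0 <= q <= 1 ->
  merge_weight s p q <= K + (large p)%:R * (large q)%:R * Q.
Proof.
move=> s01 p01 q01; have K0 : 0 <= K := expR_ge0 _; have Q0 : 0 <= Q := expR_ge0 _.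
have [lp|lp] /= := boolP (large p); last first.
  by rewrite !mul0r addr0 merge_weight_small.
have [lq|lq] /= := boolP (large q); last first.
  by rewrite mulr0 mul0r addr0 merge_weightC merge_weight_small.
have := merge_weight_le (merge_cost_ge eta_gt0 eta_le s01 p01 q01); lra.
Qed.

(** Two cuts that are not large can average to a large one only if one measure is near [0] and the
    other near [1], and this costs [kappa]. *)
Lemma large_merge_weight_pair s p q : 0 <= s <= 1 -> 0 <= p <= 1 -> 0 <= q <= 1 ->
  (large ((p + q) / 2))%:R * merge_weight s p q <=
  K * ((large p)%:R + (large q)%:R) + (large p)%:R * (large q)%:R * Q + kappa.
Proof.
move=> s01 p01 q01; have K0 : 0 <= K := expR_ge0 _; have Q0 : 0 <= Q := expR_ge0 _.
have k0 : 0 <= kappa := expR_ge0 _.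
have w0 : 0 <= merge_weight s p q := expR_ge0 _.
have le_ind : (large ((p + q) / 2))%:R * merge_weight s p q <= merge_weight s p q.
  by case: large; rewrite ?mul1r ?mul0r.
have := merge_weight_pair s01 p01 q01.
have [lp|/largeN lp] /= := boolP (large p); first by case: (large q) => /=; lra.
have [lq|/largeN lq] /= := boolP (large q); first by lra.
move=> _; rewrite -[leRHS]/(K * (0 + 0) + 0 * 0 * Q + kappa).
rewrite (_ : K * _ + _ + kappa = kappa); last by ring.
case/orP: lp => lp; case/orP: lq => lq.
- have -> : large ((p + q) / 2) = false.
    by apply/negbTE; rewrite /large negb_and -!leNgt; apply/orP; left; lra.
  by rewrite mul0r.
- apply: le_trans le_ind _; apply: merge_weight_le; apply: merge_cost_opposite => //; lra.
- apply: le_trans le_ind _; rewrite merge_weightC.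
  by apply: merge_weight_le; apply: merge_cost_opposite => //; lra.
- have -> : large ((p + q) / 2) = false.
    by apply/negbTE; rewrite /large negb_and -!leNgt; apply/orP; right; lra.
  by rewrite mul0r.
Qed.

End CutSum.


(** * The recursion for the sums of cut weights *)

Section CutSumBound.
Variables (R : realType) (eta : R).
Hypotheses (eta_gt0 : 0 < eta) (eta_le : eta <= 1 / 48).
Variable lam : R.
Hypothesis lam_gt0 : 0 < lam.
Hypothesis lam_large : expR (- (lam * (eta ^+ 2 / 2))) <= 1 / 32.
Implicit Types s p q : R.

Local Notation hmass := (hmass R).
Local Notation cherry_cost := (cherry_cost eta).
Local Notation weight := (weight eta lam).
Local Notation merge_weight := (merge_weight eta lam).
Local Notation large := (large eta).
Local Notation cut_sum := (cut_sum eta lam).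
Local Notation large_cut_sum := (large_cut_sum eta lam).
Local Notation cherry_weight := (cherry_weight eta lam).
Local Notation cherry_sum := (cherry_sum eta lam).
Local Notation K := (expR (- (lam * - eta))).
Local Notation Q := (expR (- (lam * - (1 / 4)))).
Local Notation kappa := (expR (- (lam * (1 / 2 - 3 * eta)))).
(** The exponent [3 / 8] exceeds the [1 / 4] lost in [Q], and it stays below that of [kappa] by at
    least [1 / 16]: the inequality [3 / 8 + 1 / 16 <= 1 / 2 - 3 * eta] is the origin of
    [eta <= 1 / 48]. *)
Local Notation ell := (expR (- (lam * (3 / 8)))).

Lemma cut_sum_node s a b : 0 <= s <= 1 ->
  cut_sum s (BNode a b) <= 2 * cherry_weight s +
   ((1 + cherry_weight s) * cut_sum (child_slope s) a
      - 15 / 16 * large_cut_sum (child_slope s) a) +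
   ((1 + cherry_weight s) * cut_sum (child_slope s) b
      - 15 / 16 * large_cut_sum (child_slope s) b) +
   (K * cut_sum (child_slope s) a * cut_sum (child_slope s) b +
    Q * large_cut_sum (child_slope s) a * large_cut_sum (child_slope s) b).
Proof.
move=> s01; rewrite /cut_sum big_mixed_node.
have H t : \sum_(x <- mixed t) weight (child_slope s) x *
    (merge_weight s (hmass x) 0 + merge_weight s (hmass x) 1) <=
    (1 + cherry_weight s) * cut_sum (child_slope s) t
      - 15 / 16 * large_cut_sum (child_slope s) t.
  rewrite /cut_sum /large_cut_sum !mulr_sumr -sumrB; apply: ler_sum => x _.
  apply: (@le_trans _ _ (weight (child_slope s) x *
    (1 + cherry_weight s - (large (hmass x))%:R * (15 / 16)))); last by lra.
  rewrite ler_wpM2l ?expR_ge0// merge_weight_pure//.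
  exact: hmass_ge0_le1.
have m01 := merge_weight_le lam_gt0 (merge_cost01 eta_gt0 eta_le s01).
apply: lerD; first (apply: lerD; first apply: lerD).
- rewrite !weight_node !weight_uniform !hmass_uniform !mul1r.
  by rewrite [X in _ + X]merge_weightC /cherry_weight; lra.
- apply: le_trans (H a); apply: ler_sum => x _.
  by rewrite !weight_node !weight_uniform !hmass_uniform !mulr1 -mulrDr.
- apply: le_trans (H b); apply: ler_sum => x _.
  rewrite !weight_node !weight_uniform !hmass_uniform !mul1r -mulrDr.
  by rewrite [X in _ * (X + _)]merge_weightC [X in _ * (_ + X)]merge_weightC.
- rewrite /large_cut_sum -!mulrA !big_distrlr /= !mulr_sumr -big_split/=.
  apply: ler_sum => x _; rewrite !mulr_sumr -big_split/=; apply: ler_sum => y _.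
  rewrite weight_node; have wx := weight_ge0 eta lam (child_slope s) x.
  have wy := weight_ge0 eta lam (child_slope s) y.
  apply: (@le_trans _ _ (weight (child_slope s) x * weight (child_slope s) y *
    (K + (large (hmass x))%:R * (large (hmass y))%:R * Q))); last by lra.
  by rewrite ler_wpM2l ?mulr_ge0// merge_weight_pair// hmass_ge0_le1.
Qed.

Lemma large_cut_sum_node s a b : 0 <= s <= 1 ->
  large_cut_sum s (BNode a b) <= 2 * kappa +
   (1 / 16 * large_cut_sum (child_slope s) a + kappa * cut_sum (child_slope s) a) +
   (1 / 16 * large_cut_sum (child_slope s) b + kappa * cut_sum (child_slope s) b) +
   (K * (large_cut_sum (child_slope s) a * cut_sum (child_slope s) b +
        cut_sum (child_slope s) a * large_cut_sum (child_slope s) b) +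
    Q * (large_cut_sum (child_slope s) a * large_cut_sum (child_slope s) b) +
    kappa * (cut_sum (child_slope s) a * cut_sum (child_slope s) b)).
Proof.
move=> s01; rewrite {1}/large_cut_sum big_mixed_node.
have s0 : 0 <= s by case/andP: s01.
have H t : \sum_(x <- mixed t) weight (child_slope s) x *
    ((large ((hmass x + 0) / 2))%:R * merge_weight s (hmass x) 0 +
     (large ((hmass x + 1) / 2))%:R * merge_weight s (hmass x) 1) <=
    1 / 16 * large_cut_sum (child_slope s) t + kappa * cut_sum (child_slope s) t.
  rewrite /cut_sum /large_cut_sum !mulr_sumr -big_split/=; apply: ler_sum => x _.
  apply: (@le_trans _ _ (weight (child_slope s) x *
    ((large (hmass x))%:R * (1 / 16) + kappa))); last by lra.
  rewrite ler_wpM2l ?expR_ge0// large_merge_weight_pure//.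
  exact: hmass_ge0_le1.
have m01 := merge_weight_le lam_gt0 (merge_cost01 eta_gt0 eta_le s01).
have c01 := cherry_weight_le eta_gt0 eta_le lam_gt0 s0.
have lew (c : bool) (w : R) : 0 <= w -> c%:R * w <= w by case: c; rewrite ?mul1r ?mul0r.
apply: lerD; first (apply: lerD; first apply: lerD).
- apply: (@le_trans _ _ (weight s (LNode (uniform false a) (uniform true b)) +
     weight s (LNode (uniform true a) (uniform false b)))).
    by rewrite lerD// lew// weight_ge0.
  rewrite !weight_node !weight_uniform !hmass_uniform (mul1r 1) !(mul1r (merge_weight _ _ _)).
  rewrite -[false%:R]/(0 : R) -[true%:R]/(1 : R) [X in _ + X]merge_weightC.
  by move: c01; rewrite /cherry_weight; lra.
- apply: le_trans (H a); apply: ler_sum => x _.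
  rewrite !weight_node !weight_uniform /= !hmass_uniform !mulr1.
  by rewrite -[false%:R]/(0 : R) -[true%:R]/(1 : R); lra.
- apply: le_trans (H b); apply: ler_sum => x _.
  rewrite !weight_node !weight_uniform /= !hmass_uniform !(mul1r (weight _ _)).
  rewrite -[false%:R]/(0 : R) -[true%:R]/(1 : R).
  rewrite [merge_weight _ 0 _]merge_weightC [merge_weight _ 1 _]merge_weightC.
  by rewrite [0 + _]addrC [1 + _]addrC; lra.
- rewrite /large_cut_sum !big_distrlr /= -!big_split/= !mulr_sumr -!big_split/=.
  apply: ler_sum => x _; rewrite -!big_split/= !mulr_sumr -!big_split/=; apply: ler_sum => y _.
  rewrite weight_node; have wx := weight_ge0 eta lam (child_slope s) x.
  have wy := weight_ge0 eta lam (child_slope s) y.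
  have := large_merge_weight_pair eta_gt0 eta_le lam_gt0 s01 (hmass_ge0_le1 _ x) (hmass_ge0_le1 _ y).
  move=> /(ler_wpM2l (mulr_ge0 wx wy)); lra.
Qed.

(** The quadratic recursion becomes multiplicative for [1 + K * cut_sum]: the value at a node is at
    most [1 + 2 * K * cherry_weight s] times the values at its children, so the exponents add up to
    [cherry_sum]. The bound on large cuts is carried along because it makes the term in [Q]
    harmless; the smallness hypothesis keeps [K * cut_sum] below [1 / 16], so that this bound
    reproduces itself. *)
Lemma cut_sum_bound t s : 0 <= s <= 1 -> 2 * K * cherry_sum s t <= 1 / 32 ->
  1 + K * cut_sum s t <= expR (2 * K * cherry_sum s t) /\ large_cut_sum s t <= ell.
Proof.
elim: t s => [|a IHa b IHb] s s01.
  rewrite /= mulr0 expR0 /cut_sum /large_cut_sum !big_nil mulr0 addr0 => _.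
  by rewrite lexx expR_ge0.
have s'01 : 0 <= child_slope s <= 1 by rewrite /child_slope; move: s01 => /andP[? ?]; lra.
have K1 : 1 <= K.
  by rewrite -[leLHS]expR0 ler_expR mulrN opprK mulr_ge0// ltW.
have Ya := cherry_sum_ge0 eta lam (child_slope s) a.
have Yb := cherry_sum_ge0 eta lam (child_slope s) b.
have c0 : 0 <= cherry_weight s := expR_ge0 _.
rewrite [cherry_sum _ _]/= => Ysum.
have {}IHa := IHa _ s'01; have {}IHb := IHb _ s'01.
case: IHa => [|IHa La]; first by nra.
case: IHb => [|IHb Lb]; first by nra.
have := cut_sum_node a b s01; have := large_cut_sum_node a b s01.
have := cut_sum_ge0 eta lam (child_slope s) a.
have := cut_sum_ge0 eta lam (child_slope s) b.
have := large_cut_sum_ge0 eta lam (child_slope s) a.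
have := large_cut_sum_ge0 eta lam (child_slope s) b.
set wa := cut_sum _ a in IHa *; set wb := cut_sum _ b in IHb *.
set la := large_cut_sum _ a in La *; set lb := large_cut_sum _ b in Lb *.
set ya := cherry_sum _ a in Ya IHa Ysum *; set yb := cherry_sum _ b in Yb IHb Ysum *.
move=> lb0 la0 wb0 wa0 Lnode Wnode.
have e2 (y : R) : 0 <= y <= 1 / 32 -> expR y <= 1 + 2 * y by move=> /andP[? ?]; apply: expR_le_1D2x; lra.
have Kya : 0 <= 2 * K * ya by rewrite !mulr_ge0// ltW// (lt_le_trans _ K1).
have Kyb : 0 <= 2 * K * yb by rewrite !mulr_ge0// ltW// (lt_le_trans _ K1).
have Kc0 : 0 <= 2 * K * cherry_weight s by rewrite !mulr_ge0// ltW// (lt_le_trans _ K1).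
have Ea : K * wa <= 1 / 16.
  have : 2 * K * ya <= 1 / 32 by move: Ysum; rewrite !mulrDr; lra.
  by have := e2 (2 * K * ya); rewrite Kya andTb => H /H; lra.
have Eb : K * wb <= 1 / 16.
  have : 2 * K * yb <= 1 / 32 by move: Ysum; rewrite !mulrDr; lra.
  by have := e2 (2 * K * yb); rewrite Kyb andTb => H /H; lra.
have tau16 : expR (- (lam * (1 / 16))) <= 1 / 32.
  apply: le_trans lam_large; apply: expR_lam_le => //.
  by move: eta_gt0 eta_le => e0 e1; nra.
have Qell : Q * ell <= 1 / 32.
  rewrite -expRD; apply: le_trans tau16; rewrite ler_expR.
  by move: lam_gt0; lra.
have kell : kappa <= ell * (1 / 32).
  apply: (@le_trans _ _ (ell * expR (- (lam * (1 / 16))))); last by rewrite ler_wpM2l// expR_ge0.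
  by rewrite -expRD ler_expR; move: lam_gt0 eta_le => l0 e1; nra.
have ell0 : 0 < ell := expR_gt0 _.
have ka0 : 0 <= kappa := expR_ge0 _.
have Q0 : 0 <= Q := expR_ge0 _.
have wa1 : wa <= 1 / 16 by apply: le_trans Ea; rewrite ler_peMl.
have wb1 : wb <= 1 / 16 by apply: le_trans Eb; rewrite ler_peMl.
move: K1 Q0 ka0 ell0 Qell kell Lnode Wnode Ea Eb IHa IHb Kya Kyb Ysum Kc0 La Lb {tau16}.
move: K Q kappa ell => k Qq kap l k1 Q0 ka0 l0 Ql kl Lnode Wnode Ea Eb IHa IHb Kya Kyb Ysum Kc0 La Lb.
(* The costly pairs of large cuts are thereby absorbed in the gain [15 / 16 * la] of
   [cut_sum_node]. *)
have QLab : Qq * la * lb <= 1 / 32 * la.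
  have : Qq * lb <= Qq * l by rewrite ler_wpM2l.
  move=> H; have : Qq * lb <= 1 / 32 by lra.
  by move=> /(ler_wpM2l la0); lra.
split.
- have E3 : 2 * k * (cherry_weight s + ya + yb) =
    2 * k * cherry_weight s + 2 * k * ya + 2 * k * yb by ring.
  rewrite E3 !expRD.
  apply: (@le_trans _ _ ((1 + 2 * k * cherry_weight s) * (1 + k * wa) * (1 + k * wb))); last first.
    have kwa0 : 0 <= k * wa by rewrite mulr_ge0//; lra.
    have kwb0 : 0 <= k * wb by rewrite mulr_ge0//; lra.
    apply: ler_pM; [|by rewrite addr_ge0| |exact: IHb].
      by rewrite mulr_ge0// addr_ge0.
    by apply: ler_pM; [rewrite addr_ge0|rewrite addr_ge0|exact: expR_ge1Dx|exact: IHa].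
  have : k * cut_sum s (BNode a b) <=
     k * (2 * cherry_weight s + (1 + cherry_weight s) * (wa + wb) + k * wa * wb).
    rewrite ler_wpM2l//; first by lra.
    by move: Wnode; nra.
  have kw : 0 <= (k * k) * cherry_weight s * (wa + wb).
    by rewrite !mulr_ge0// ?addr_ge0//; lra.
  have kww : 0 <= 2 * k * cherry_weight s * (k * wa * (k * wb)).
    by rewrite !mulr_ge0//; lra.
  have : k * cherry_weight s * (wa + wb) <= k * k * cherry_weight s * (wa + wb).
    by rewrite -!mulrA ler_peMl// !mulr_ge0// ?addr_ge0//; lra.
  nra.
- have QLab' : Qq * (la * lb) <= 1 / 32 * l by rewrite mulrA; lra.
  have H1 : k * (la * wb + wa * lb) <= 1 / 16 * (l + l).
    have : (k * wb) * la <= 1 / 16 * l by apply: ler_pM => //; rewrite mulr_ge0//; lra.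
    have : (k * wa) * lb <= 1 / 16 * l by apply: ler_pM => //; rewrite mulr_ge0//; lra.
    lra.
  have H2 : kap * (wa * wb) <= kap * 1 by rewrite ler_wpM2l// mulr_ile1//; lra.
  have H3 : kap * wa <= kap * 1 by rewrite ler_wpM2l//; lra.
  have H4 : kap * wb <= kap * 1 by rewrite ler_wpM2l//; lra.
  lra.
Qed.

Lemma cherry_weight_nincr s s' : s <= s' -> cherry_weight s' <= cherry_weight s.
Proof.
move=> ss'; apply: expR_lam_le => //; rewrite /cherry_cost.
by move: eta_gt0 eta_le => e0 e1; rewrite ler_pM2r// ler_wpM2l//; [lra|rewrite lerD2l ler_wpM2r//; lra].
Qed.

(** Fewer than [2 ^+ J] internal nodes have depth below [J]; the others are fewer than the leaves,
    and their slope is at least [1 - (1 - s) / 2 ^+ J]. *)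
Lemma cherry_sum_le J t s : 0 <= s <= 1 ->
  cherry_sum s t <= 2 ^+ J * cherry_weight 0 +
    (leaves t)%:R * cherry_weight (1 - (1 - s) / 2 ^+ J).
Proof.
move=> s01; have cw0 s' : 0 <= cherry_weight s' := expR_ge0 _.
have s'01 s' : 0 <= s' <= 1 -> 0 <= child_slope s' <= 1.
  by rewrite /child_slope => /andP[? ?]; lra.
have H0 u s' : 0 <= s' <= 1 -> cherry_sum s' u + cherry_weight s' <= (leaves u)%:R * cherry_weight s'.
  elim: u s' => [|a IHa b IHb] s' hs /=; first by lra.
  have := IHa _ (s'01 _ hs); have := IHb _ (s'01 _ hs).
  have : cherry_weight (child_slope s') <= cherry_weight s'.
    by apply: cherry_weight_nincr; rewrite /child_slope; move: hs => /andP[? ?]; lra.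
  have la : (1 : R) <= (leaves a)%:R by rewrite ler1n; elim: (a) => //= *; rewrite addn_gt0; apply/orP; left.
  have lb : (1 : R) <= (leaves b)%:R by rewrite ler1n; elim: (b) => //= *; rewrite addn_gt0; apply/orP; left.
  rewrite natrD => hc h1 h2.
  have : ((leaves a)%:R - 1) * cherry_weight (child_slope s') <= ((leaves a)%:R - 1) * cherry_weight s'.
    by rewrite ler_wpM2l//; lra.
  have : ((leaves b)%:R - 1) * cherry_weight (child_slope s') <= ((leaves b)%:R - 1) * cherry_weight s'.
    by rewrite ler_wpM2l//; lra.
  lra.
(* The extra term turns the count [2 ^+ J] into [2 ^+ J - 1]; in the induction the two spare terms
   of the children pay for the root and for its own spare term. *)
suff H : cherry_sum s t + cherry_weight 0 <= 2 ^+ J * cherry_weight 0 +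
    (leaves t)%:R * cherry_weight (1 - (1 - s) / 2 ^+ J) by have := cw0 0; lra.
elim: J t s s01 => [|J IHJ] t s s01.
  have s0 : 0 <= s by case/andP: s01.
  rewrite (_ : 1 - (1 - s) / 2 ^+ 0 = s); last by rewrite expr0 divr1; lra.
  rewrite expr0.
  by have := H0 t s s01; have := cw0 s; lra.
have s0 : 0 <= s by case/andP: s01.
have p2 : (1 : R) <= 2 ^+ J.+1 by rewrite exprn_ege1//; lra.
case: t => [|a b] /=.
  by rewrite add0r; have := cw0 0; have := cw0 (1 - (1 - s) / 2 ^+ J.+1); nra.
have := IHJ a _ (s'01 _ s01); have := IHJ b _ (s'01 _ s01).
have -> : 1 - (1 - child_slope s) / 2 ^+ J = 1 - (1 - s) / 2 ^+ J.+1.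
  by rewrite /child_slope exprS; field; rewrite expf_neq0//; apply/eqP; lra.
have := cherry_weight_nincr s0.
by rewrite natrD exprS; lra.
Qed.

End CutSumBound.


(** * Isolated leaves of a fixed tree *)

Fixpoint lunion (x y : ltree) : ltree :=
  match x, y with
  | LNode a b, LNode a' b' => LNode (lunion a a') (lunion b b')
  | LLeaf c, LLeaf c' => LLeaf (c || c')
  | _, _ => x
  end.

Fixpoint marked_leaf (t : btree) : seq ltree :=
  if t is BNode a b then
    [seq LNode x (uniform false b) | x <- marked_leaf a] ++
    [seq LNode (uniform false a) y | y <- marked_leaf b]
  else [:: LLeaf true].

Lemma ltree_shape_uniform c t : ltree_shape (uniform c t) = t.
Proof. by elim: t => //= a -> b ->. Qed.

Lemma ltree_shape_marked_leaf t x : x \in marked_leaf t -> ltree_shape x = t.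
Proof.
elim: t x => [|a IHa b IHb] x /=; first by rewrite inE => /eqP ->.
by rewrite mem_cat => /orP[] /mapP[y my ->] /=; rewrite ltree_shape_uniform ?(IHa _ my) ?(IHb _ my).
Qed.

Lemma lunion_uniform x : lunion x (uniform false (ltree_shape x)) = x.
Proof. by elim: x => [c|a IHa b IHb] /=; rewrite ?orbF ?IHa ?IHb. Qed.

Lemma uniform_lunion x : lunion (uniform false (ltree_shape x)) x = x.
Proof. by elim: x => [c|a IHa b IHb] //=; rewrite IHa IHb. Qed.

Definition untouched (a b : bool) : bool := ~~ a && ~~ b.

Section IsolatedMoments.
Variables (R : realType) (lam : R).
Hypothesis lam_gt0 : 0 < lam.
Implicit Types s p q : R.
Local Notation energy := (energy R untouched).
Local Notation hmass := (hmass R).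

Lemma pair_ok_untouched p q : pair_ok untouched p q = (1 - p) * (1 - q).
Proof. by rewrite /pair_ok !big_bool /=; lra. Qed.

Lemma energy_untouched_uniform t : energy (uniform false t) = 0.
Proof.
elim: t => [|a IHa b IHb] //=; rewrite IHa IHb !hmass_uniform pair_ok_untouched.
by rewrite -[false%:R]/(0 : R); lra.
Qed.

(** The ancestor at distance [i] contributes [2^-i], the probability that an end of an edge created
    there and sent to the right child also descends to the leaf, times [1 / 2]; at depth [n] the
    measure is [2^-n] and the sum is [1 - 2^-n]. *)
Lemma energy_marked_leaf t x : x \in marked_leaf t -> energy x = 1 - hmass x.
Proof.
elim: t x => [|a IHa b IHb] x /=; first by rewrite inE => /eqP -> /=; lra.
rewrite mem_cat => /orP[] /mapP[y my ->] /=;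
  rewrite energy_untouched_uniform hmass_uniform pair_ok_untouched -[false%:R]/(0 : R).
  by rewrite (IHa _ my); lra.
by rewrite (IHb _ my); lra.
Qed.

Lemma sum_hmass_marked_leaf t : \sum_(x <- marked_leaf t) hmass x = 1.
Proof.
elim: t => [|a IHa b IHb] /=; first by rewrite big_seq1.
rewrite big_cat !big_map /=.
under eq_bigr => x _ do rewrite hmass_uniform -[false%:R]/(0 : R) addr0.
under [X in _ + X]eq_bigr => x _ do rewrite hmass_uniform -[false%:R]/(0 : R) add0r.
by rewrite -!mulr_suml IHa IHb; lra.
Qed.

Lemma size_marked_leaf t : size (marked_leaf t) = leaves t.
Proof. by elim: t => //= a IHa b IHb; rewrite size_cat !size_map IHa IHb. Qed.

(** The potential is linear here and has no slack, so joining an unmarked subtree leaves the weight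
    exactly unchanged once the slope is updated. *)
Definition iso_weight s (x : ltree) : R := expR (- (lam * (energy x + s * hmass x))).

Lemma iso_weight_nodel s x b : iso_weight s (LNode x (uniform false b)) =
  iso_weight (child_slope s) x.
Proof.
rewrite /iso_weight /= energy_untouched_uniform hmass_uniform pair_ok_untouched.
by rewrite -[false%:R]/(0 : R) /child_slope; congr expR; lra.
Qed.

Lemma iso_weight_noder s a y : iso_weight s (LNode (uniform false a) y) =
  iso_weight (child_slope s) y.
Proof.
rewrite /iso_weight /= energy_untouched_uniform hmass_uniform pair_ok_untouched.
by rewrite -[false%:R]/(0 : R) /child_slope; congr expR; lra.
Qed.

Lemma iso_weight_node s x y : iso_weight s (LNode x y) =
  iso_weight (child_slope s) x * iso_weight (child_slope s) y *
  expR (lam * (hmass x * hmass y) / 2).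
Proof.
rewrite /iso_weight -!expRD /= pair_ok_untouched /child_slope.
by congr expR; lra.
Qed.

Definition first_moment s t : R := \sum_(x <- marked_leaf t) iso_weight s x.

Definition second_moment s t : R :=
  \sum_(x <- marked_leaf t) \sum_(y <- marked_leaf t) iso_weight s (lunion x y).

Lemma first_moment_node s a b : first_moment s (BNode a b) =
  first_moment (child_slope s) a + first_moment (child_slope s) b.
Proof.
rewrite /first_moment /= big_cat !big_map; congr (_ + _); apply: eq_bigr => x _.
  exact: iso_weight_nodel.
exact: iso_weight_noder.
Qed.

Lemma second_moment_node s a b : second_moment s (BNode a b) =
  second_moment (child_slope s) a + second_moment (child_slope s) b +
  2 * \sum_(x <- marked_leaf a) \sum_(y <- marked_leaf b)
    iso_weight (child_slope s) x * iso_weight (child_slope s) y *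
      expR (lam * (hmass x * hmass y) / 2).
Proof.
rewrite {1}/second_moment /= big_cat !big_map /=.
under eq_bigr => x _ do rewrite big_cat !big_map /=.
under [X in _ + X]eq_bigr => x _ do rewrite big_cat !big_map /=.
rewrite !big_split /=.
have u0 t : lunion (uniform false t) (uniform false t) = uniform false t.
  by have := lunion_uniform (uniform false t); rewrite ltree_shape_uniform.
have -> : \sum_(i <- marked_leaf a) \sum_(j <- marked_leaf a)
    iso_weight s (LNode (lunion i j) (lunion (uniform false b) (uniform false b))) =
    second_moment (child_slope s) a.
  by apply: eq_bigr => x _; apply: eq_bigr => y _; rewrite u0 iso_weight_nodel.
have -> : \sum_(i <- marked_leaf b) \sum_(j <- marked_leaf b)
    iso_weight s (LNode (lunion (uniform false a) (uniform false a)) (lunion i j)) =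
    second_moment (child_slope s) b.
  by apply: eq_bigr => x _; apply: eq_bigr => y _; rewrite u0 iso_weight_noder.
set S := \sum_(x <- _) \sum_(y <- _) _ * _.
have -> : \sum_(i <- marked_leaf a) \sum_(j <- marked_leaf b)
    iso_weight s (LNode (lunion i (uniform false a)) (lunion (uniform false b) j)) = S.
  rewrite /S !big_seq; apply: eq_bigr => x mx; rewrite !big_seq; apply: eq_bigr => y my.
  rewrite -{1}(ltree_shape_marked_leaf mx) -{1}(ltree_shape_marked_leaf my).
  by rewrite lunion_uniform uniform_lunion iso_weight_node.
have -> : \sum_(i <- marked_leaf b) \sum_(j <- marked_leaf a)
    iso_weight s (LNode (lunion (uniform false a) j) (lunion i (uniform false b))) = S.
  rewrite exchange_big /=.
  rewrite /S !big_seq; apply: eq_bigr => x mx; rewrite !big_seq; apply: eq_bigr => y my.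
  rewrite -{1}(ltree_shape_marked_leaf mx) -{1}(ltree_shape_marked_leaf my).
  by rewrite lunion_uniform uniform_lunion iso_weight_node.
by ring.
Qed.

(* Since [expR c - 1 <= c * expR c], the excess is at most [c] times either weight. *)
Lemma iso_weight_pair_le s a b x y : 0 <= s <= 1 ->
  x \in marked_leaf a -> y \in marked_leaf b ->
  2 * (iso_weight (child_slope s) x * iso_weight (child_slope s) y *
       expR (lam * (hmass x * hmass y) / 2)) <=
  2 * (iso_weight (child_slope s) x * iso_weight (child_slope s) y) +
  lam / 2 * (iso_weight (child_slope s) x * hmass x * hmass y +
             iso_weight (child_slope s) y * hmass y * hmass x).
Proof.
move=> /andP[s0 s1] mx my; set w := iso_weight _.
have /andP[p0 p1] := hmass_ge0_le1 R x; have /andP[q0 q1] := hmass_ge0_le1 R y.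
have wE z c : z \in marked_leaf c ->
    w z = expR (- (lam * (1 - (1 - s) / 2 * hmass z))).
  by move=> mz; rewrite /w /iso_weight (energy_marked_leaf mz) /child_slope; congr expR; lra.
have c0 : 0 <= lam * (hmass x * hmass y) / 2 by rewrite !mulr_ge0// ltW.
set c := lam * _ / 2 in c0 *.
have ec : expR c - 1 <= c * expR c.
  have := expR_ge1Dx (- c); rewrite expRN => H.
  have e0 := expR_gt0 c.
  have : (1 - c) * expR c <= (expR c)^-1 * expR c by rewrite ler_wpM2r// ltW.
  by rewrite mulVf ?gt_eqF//; lra.
have pq1 : hmass x * hmass y <= 1 by rewrite mulr_ile1.
(* The exponent of a single leaf is at least [lam / 2], and the correlation [c] is at most
   [lam / 2]. *)
have small z t : z \in marked_leaf t -> w z * expR c <= 1.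
  move=> mz; rewrite (wE _ _ mz) -expRD -[leRHS]expR0 ler_expR.
  have /andP[z0 z1] := hmass_ge0_le1 R z.
  have : (1 - s) / 2 * hmass z <= 1 / 2 by nra.
  rewrite /c => H; have := ltW lam_gt0 => l0; nra.
have wx0 : 0 <= w x := expR_ge0 _; have wy0 : 0 <= w y := expR_ge0 _.
have H0 : w x * w y * (expR c - 1) <= w x * w y * (c * expR c).
  by rewrite ler_wpM2l// mulr_ge0.
have H1 : w x * c * (w y * expR c) <= w x * c * 1.
  by apply: ler_wpM2l; [rewrite mulr_ge0|exact: (small y b my)].
have H2 : w y * c * (w x * expR c) <= w y * c * 1.
  by apply: ler_wpM2l; [rewrite mulr_ge0|exact: (small x a mx)].
have -> : lam / 2 * (w x * hmass x * hmass y + w y * hmass y * hmass x) =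
  w x * c + w y * c by rewrite /c; lra.
by lra.
Qed.

(** The harmonic measures of the leaves of the sibling subtree sum to [1], so the correlations
    created at a node charge each leaf [x] below it at most [lam * (hmass x / 2)]. This is exactly
    how much [lam * (1 - hmass x)] grows when the measure of [x] is halved by the new root. *)
Lemma second_moment_le t s : 0 <= s <= 1 ->
  second_moment s t <= first_moment s t ^+ 2 +
    \sum_(x <- marked_leaf t) iso_weight s x * (1 + lam * (1 - hmass x)).
Proof.
elim: t s => [|a IHa b IHb] s s01.
  rewrite /second_moment /first_moment /= !big_seq1 /=.
  rewrite subrr mulr0 addr0 mulr1 lerDr.
  by rewrite sqr_ge0.
have s'01 : 0 <= child_slope s <= 1 by rewrite /child_slope; move: s01 => /andP[? ?]; lra.
rewrite second_moment_node first_moment_node.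
have := IHa _ s'01; have := IHb _ s'01.
have cross : 2 * \sum_(x <- marked_leaf a) \sum_(y <- marked_leaf b)
    iso_weight (child_slope s) x * iso_weight (child_slope s) y *
      expR (lam * (hmass x * hmass y) / 2) <=
  2 * (first_moment (child_slope s) a * first_moment (child_slope s) b) +
  (\sum_(x <- marked_leaf a) iso_weight (child_slope s) x * (lam * (hmass x / 2)) +
   \sum_(y <- marked_leaf b) iso_weight (child_slope s) y * (lam * (hmass y / 2))).
  have half t : \sum_(x <- marked_leaf t) iso_weight (child_slope s) x * (lam * (hmass x / 2)) =
      lam / 2 * \sum_(x <- marked_leaf t) iso_weight (child_slope s) x * hmass x.
    by rewrite mulr_sumr; apply: eq_bigr => x _; lra.
  rewrite !half; set A := \sum_(x <- marked_leaf a) _ * hmass x.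
  set B := \sum_(x <- marked_leaf b) _ * hmass x.
  have inner x : \sum_(y <- marked_leaf b)
     (2 * (iso_weight (child_slope s) x * iso_weight (child_slope s) y) +
      lam / 2 * (iso_weight (child_slope s) x * hmass x * hmass y +
             iso_weight (child_slope s) y * hmass y * hmass x)) =
     iso_weight (child_slope s) x * (2 * first_moment (child_slope s) b) +
     (iso_weight (child_slope s) x * hmass x * (lam / 2) + hmass x * (lam / 2 * B)).
    rewrite big_split/= -!mulr_sumr big_split/= -mulr_sumr -mulr_suml.
    by rewrite sum_hmass_marked_leaf -/B /first_moment; lra.
  apply: (@le_trans _ _ (\sum_(x <- marked_leaf a)
     (iso_weight (child_slope s) x * (2 * first_moment (child_slope s) b) +
     (iso_weight (child_slope s) x * hmass x * (lam / 2) + hmass x * (lam / 2 * B))))).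
    rewrite mulr_sumr !big_seq; apply: ler_sum => x mx.
    rewrite -inner mulr_sumr !big_seq; apply: ler_sum => y my.
    exact: iso_weight_pair_le mx my.
  rewrite !big_split/= -!mulr_suml sum_hmass_marked_leaf -/A.
  by rewrite -/(first_moment _ a); lra.
have -> : \sum_(x <- marked_leaf (BNode a b)) iso_weight s x * (1 + lam * (1 - hmass x)) =
   \sum_(x <- marked_leaf a) iso_weight (child_slope s) x * (1 + lam * (1 - hmass x)) +
   \sum_(x <- marked_leaf a) iso_weight (child_slope s) x * (lam * (hmass x / 2)) +
   (\sum_(x <- marked_leaf b) iso_weight (child_slope s) x * (1 + lam * (1 - hmass x)) +
   \sum_(x <- marked_leaf b) iso_weight (child_slope s) x * (lam * (hmass x / 2))).
  rewrite /= big_cat !big_map -!big_split/=; congr (_ + _); apply: eq_bigr => x _.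
    by rewrite iso_weight_nodel hmass_uniform -[false%:R]/(0 : R); lra.
  by rewrite iso_weight_noder hmass_uniform -[false%:R]/(0 : R); lra.
by move: cross; lra.
Qed.

Lemma second_moment0_le t :
  second_moment 0 t <= first_moment 0 t ^+ 2 + (1 + lam) * first_moment 0 t.
Proof.
apply: le_trans (second_moment_le _ _) _; first by rewrite lexx ler01.
rewrite lerD2l /first_moment mulr_sumr; apply: ler_sum => x _.
rewrite mulrC ler_wpM2r ?expR_ge0// lerD2l.
by have /andP[? ?] := hmass_ge0_le1 R x; move: lam_gt0 => l0; nra.
Qed.

Lemma first_moment0_ge t : (leaves t)%:R * expR (- lam) <= first_moment 0 t.
Proof.
have -> : (leaves t)%:R * expR (- lam) = \sum_(x <- marked_leaf t) expR (- lam).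
  by rewrite big_const_seq count_predT size_marked_leaf iter_addr_0 mulr_natl.
rewrite /first_moment.
rewrite !big_seq; apply: ler_sum => x mx.
rewrite /iso_weight (energy_marked_leaf mx) ler_expR lerN2.
by have /andP[? ?] := hmass_ge0_le1 R x; move: lam_gt0 => l0; nra.
Qed.

End IsolatedMoments.


(** * The graph of the process *)

Section Graph.
Variables (R : realType) (d : measure_display) (T : measurableType d).
Variables (P : probability T R) (X : randomness P) (t : R) (w : T).

Fixpoint tree_at (tau : btree) (r : vertex) : Prop :=
  if tau is BNode a b then
    [/\ splitting_time X r w <= t, tree_at a (false :: r) & tree_at b (true :: r)]
  else alive X t w r.

Fixpoint leaf_in (tau : btree) (r v : vertex) : Prop :=
  if tau is BNode a b then leaf_in a (false :: r) v \/ leaf_in b (true :: r) v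
  else v = r.

Fixpoint label_tree (tau : btree) (r : vertex) (S : vertex -> bool) : ltree :=
  if tau is BNode a b then
    LNode (label_tree a (false :: r) S) (label_tree b (true :: r) S)
  else LLeaf (S r).

Fixpoint final (e : edge) (tau : btree) (r : vertex) : vertex :=
  if tau is BNode a b then
    if side X e r w then final e b (true :: r) else final e a (false :: r)
  else r.

Lemma tree_at_inj tau tau' r : tree_at tau r -> tree_at tau' r -> tau = tau'.
Proof.
elim: tau tau' r => [|a IHa b IHb] [|a' b'] r //=.
- by move=> /andP[_ /lt_le_trans H] [/H]; rewrite ltxx.
- by move=> [+ _ _] /andP[_ /lt_le_trans H] => /H; rewrite ltxx.
- by move=> [_ ta tb] [_ ta' tb']; rewrite (IHa _ _ ta ta') (IHb _ _ tb tb').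
Qed.

Lemma ltree_shape_label tau r S : ltree_shape (label_tree tau r S) = tau.
Proof. by elim: tau r => //= a IHa b IHb r; rewrite IHa IHb. Qed.

Lemma end_label_final e tau r S :
  end_label X e r (label_tree tau r S) w = S (final e tau r).
Proof. by elim: tau r => //= a IHa b IHb r; case: ifP. Qed.

Lemma alive_final e tau r : tree_at tau r -> alive X t w (final e tau r).
Proof.
elim: tau r => //= a IHa b IHb r [_ ta tb].
by case: ifP => _; [exact: IHb|exact: IHa].
Qed.

Definition trace_from (e : edge) (r : vertex) (j : nat) : vertex :=
  iter j (fun u : vertex => side X e u w :: u) r.

Lemma trace_from_final e tau r : exists j, trace_from e r j = final e tau r.
Proof.
elim: tau r => [|a IHa b IHb] r /=; first by exists 0%N.
case: ifP => sr.
  by have [j <-] := IHb (true :: r); exists j.+1; rewrite /trace_from iterSr sr.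
by have [j <-] := IHa (false :: r); exists j.+1; rewrite /trace_from iterSr sr.
Qed.

Lemma suffix_trace_from e r i j : (i <= j)%N -> suffix (trace_from e r i) (trace_from e r j).
Proof.
move=> ij; rewrite -(subnK ij) /trace_from iterD.
elim: (j - i)%N => [|n IHn] /=; first exact: suffix_refl.
by apply: (suffix_trans IHn); exact: suffix_cons.
Qed.

Lemma uniform_label tau r S c : label_tree tau r S = uniform c tau ->
  forall v, leaf_in tau r v -> S v = c.
Proof.
elim: tau r => [|a IHa b IHb] r /= [].
  by move=> <- v ->.
by move=> Ea Eb v [/(IHa _ Ea)|/(IHb _ Eb)].
Qed.

Lemma leaf_in_suffix tau r v : leaf_in tau r v -> suffix r v.
Proof.
elim: tau r => [|a IHa b IHb] r /=; first by move=> ->; exact: suffix_refl.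
by move=> [/IHa|/IHb] /suffix_child.
Qed.

Lemma label_tree_off tau r v : ~~ suffix r v ->
  label_tree tau r (pred1 v) = uniform false tau.
Proof.
elim: tau r => [|a IHa b IHb] r /= rv.
  by congr LLeaf; apply/negP => /eqP rv'; move: rv; rewrite rv' suffix_refl.
by rewrite IHa ?IHb//; apply: contra rv => /suffix_child.
Qed.

Lemma marked_leaf_label tau r x : x \in marked_leaf tau ->
  exists2 v, leaf_in tau r v & x = label_tree tau r (pred1 v).
Proof.
elim: tau r x => [|a IHa b IHb] r x /=.
  by rewrite inE => /eqP ->; exists r => //=; rewrite eqxx.
rewrite mem_cat => /orP[] /mapP[y my ->].
  have [v lv ->] := IHa (false :: r) _ my; exists v; first by left.
  rewrite [label_tree b _ _]label_tree_off//; apply/negP.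
  exact: (suffix_children (leaf_in_suffix lv)).
have [v lv ->] := IHb (true :: r) _ my; exists v; first by right.
rewrite [label_tree a _ _]label_tree_off//; apply/negP => H.
exact: (suffix_children H (leaf_in_suffix lv)).
Qed.

Lemma leaf_in_alive tau r v : tree_at tau r -> leaf_in tau r v -> alive X t w v.
Proof.
elim: tau r => [|a IHa b IHb] r /=; first by move=> ? ->.
by move=> [_ ta tb] [/(IHa _ ta)|/(IHb _ tb)].
Qed.

Lemma suffix_split (r v : vertex) : suffix r v ->
  v = r \/ exists b, suffix (b :: r) v.
Proof.
move=> /suffixP[s ->]; case/lastP: s => [|s b]; first by left.
by right; exists b; rewrite cat_rcons suffix_suffix.
Qed.

Fixpoint upto (n : nat) (r : vertex) : seq vertex :=
  if n is m.+1 then r :: upto m (false :: r) ++ upto m (true :: r) else [::].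

Fixpoint level (n : nat) (r : vertex) : seq vertex :=
  if n is m.+1 then level m (false :: r) ++ level m (true :: r) else [:: r].

Definition births (n : nat) (r : vertex) : nat :=
  count (fun v => birth_time X v w <= t) (upto n r).

(** The tree is unfolded from [r]; it must stop before level [n], where nobody is born, and each of
    its leaves is one of the vertices counted by [births]. *)
Lemma tree_exists n r : birth_time X r w <= t ->
  (forall v, v \in level n r -> t < birth_time X v w) ->
  exists2 tau, tree_at tau r & (leaves tau <= births n r)%N.
Proof.
elim: n r => [|n IHn] r br /= nb.
  by have := nb r; rewrite inE eqxx => /(_ isT); rewrite ltNge br.
have [sr|sr] := ltP t (splitting_time X r w).
  by exists BLeaf; [apply/andP|rewrite /births /= br].
have [|a ta la] := IHn (false :: r) sr.
  by move=> v lv; apply: nb; rewrite mem_cat lv.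
have [|b tb lb] := IHn (true :: r) sr.
  by move=> v lv; apply: nb; rewrite mem_cat lv orbT.
exists (BNode a b) => //=; rewrite /births /= count_cat.
by apply: (leq_trans (leq_add la lb)); rewrite leq_addl.
Qed.

Hypothesis lifetime_ge0 : forall v, 0 <= lifetime X v w.

Lemma birth_le_split v : birth_time X v w <= splitting_time X v w.
Proof. by rewrite /splitting_time lerDl. Qed.

Lemma split_le_birth r b v : suffix (b :: r) v -> splitting_time X r w <= birth_time X v w.
Proof.
move=> /suffixP[s ->]; elim: s => [//|c s IHs] /=.
by apply: (le_trans IHs); rewrite lerDl.
Qed.

(** A proper descendant of [r] is born no earlier than the splitting of [r], so the living vertices
    form an antichain. *)
Lemma alive_suffix r v : alive X t w r -> alive X t w v -> suffix r v -> v = r.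
Proof.
move=> /andP[_ tr] /andP[bv _] /suffix_split[//|[b /split_le_birth sb]].
by have := lt_le_trans tr (le_trans sb bv); rewrite ltxx.
Qed.

Lemma alive_leaf tau r v : tree_at tau r -> alive X t w v -> suffix r v -> leaf_in tau r v.
Proof.
elim: tau r => [|a IHa b IHb] r /=; first exact: alive_suffix.
move=> [sr ta tb] av /suffix_split[vr|[[] sv]].
- by move: av => /andP[_]; rewrite vr => /lt_le_trans /(_ sr); rewrite ltxx.
- by right; exact: IHb.
- by left; exact: IHa.
Qed.

Lemma edges_ok_internal Rl tau r S : tree_at tau r ->
  edges_ok X Rl r (label_tree tau r S) w ->
  forall u k, suffix r u -> splitting_time X u w <= t -> (k < new_edges X u w)%N ->
  exists a b, [/\ tree_at a (false :: u), tree_at b (true :: u) &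
    Rl (S (final (u, k) a (false :: u))) (S (final (u, k) b (true :: u)))].
Proof.
elim: tau r => [|a IHa b IHb] r /=.
  move=> /andP[_ tr] _ u k /suffix_split[->|[c /split_le_birth sb]].
    by move=> /(lt_le_trans tr); rewrite ltxx.
  move=> su _; have := le_trans sb (birth_le_split u).
  by move=> /(lt_le_trans tr)/lt_le_trans/(_ su); rewrite ltxx.
move=> [sr ta tb] [H oka okb] u k /suffix_split[->|[[] su]].
- by move=> _ /H; rewrite !end_label_final => Hab; exists a, b.
- exact: (IHb _ tb okb).
- exact: (IHa _ ta oka).
Qed.

Local Notation G := (full_process X t w).

Lemma final_ends k u tau (b : bool) : tree_at tau (b :: u) ->
  ends G (u, k) (final (u, k) tau (b :: u)).
Proof.
move=> tb; split; first exact: alive_final.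
by exists b => //; have [j <-] := trace_from_final (u, k) tau (b :: u); exists j.
Qed.

(** Leaves are labelled by whether [u0] reaches them. The final ends of an edge coincide or are
    adjacent, so they carry the same label and no edge crosses this cut. *)
Lemma cut_edges_ok (u0 : vertex) tau r : tree_at tau r ->
  edges_ok X eqb r (label_tree tau r
    (fun v => `[< Relation_Operators.clos_refl_trans vertex (adjacent_vertices G) u0 v >])) w.
Proof.
elim: tau r => //= a IHa b IHb r [sr ta tb]; split; [|exact: IHa|exact: IHb].
move=> k kn; rewrite !end_label_final.
set v := final _ a _; set v' := final _ b _.
have eqbb (c : bool) : eqb c c by case: c.
have [<-|vv'] := pselect (v = v'); first exact: eqbb.
have ev : ends G (r, k) v by exact: final_ends.
have ev' : ends G (r, k) v' by exact: final_ends.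
have adj : adjacent_vertices G v v' /\ adjacent_vertices G v' v.
  have [av av'] : alive X t w v /\ alive X t w v' by split; exact: alive_final.
  by split; split => //; [|exact: nesym|]; exists (r, k).
rewrite (_ : `[< _ >] = `[< Relation_Operators.clos_refl_trans vertex (adjacent_vertices G) u0 v' >])//.
apply: asbool_equiv_eq; split => H; apply: Relation_Operators.rt_trans H _;
  by apply: Relation_Operators.rt_step; case: adj.
Qed.

Lemma disconnected_mixed tau : tree_at tau [::] -> ~ connected_graph G ->
  exists2 s, s \in mixed tau & edges_ok X eqb [::] s w.
Proof.
move=> ttau nconn.
have [v0 av0] : exists v, alive X t w v.
  by exists (final ([::], 0%N) tau [::]); exact: alive_final.
have [u [v [au [av nuv]]]] : exists u v, [/\ alive X t w u, alive X t w v &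
    ~ Relation_Operators.clos_refl_trans vertex (adjacent_vertices G) u v].
  apply: contrapT => H; apply: nconn; split; first by exists v0.
  move=> u v au av; apply: contrapT => nuv; apply: H; exists u, v; split=> //.
pose S v := `[< Relation_Operators.clos_refl_trans vertex (adjacent_vertices G) u v >].
exists (label_tree tau [::] S); last exact: cut_edges_ok.
have := mixedP (label_tree tau [::] S); rewrite ltree_shape_label => -[E|E|//].
  have := uniform_label E (alive_leaf ttau au (suffix0s _)).
  by rewrite /S asboolT//; exact: Relation_Operators.rt_refl.
have := uniform_label E (alive_leaf ttau av (suffix0s _)).
by rewrite /S asboolF.
Qed.

Lemma untouched_isolated tau x : tree_at tau [::] -> x \in marked_leaf tau ->
  edges_ok X untouched [::] x w -> exists v, isolated_vertex G v.
Proof.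
move=> ttau /(marked_leaf_label [::])[v lv ->] okv; exists v.
have av := leaf_in_alive ttau lv; split=> // -[u k] [/= su kn] [_ [b _ [j _ jv]]].
have [a [c [ta tc]]] := edges_ok_internal ttau okv (suffix0s u) su kn.
(* [ends] only asks for a living vertex on the trace. A trace is a chain for [suffix] and the living
   vertices form an antichain, so they meet only in the final end. *)
have fin tau' : tree_at tau' (b :: u) -> final (u, k) tau' (b :: u) = v.
  move=> t'; have [i iE] := trace_from_final (u, k) tau' (b :: u).
  have af := alive_final (u, k) t'; rewrite -iE in af *.
  rewrite -/(trace_from _ _ _) in jv; rewrite -jv in av *.
  have [ij|/ltnW ij] := leqP i j.
    by rewrite (alive_suffix af av (suffix_trace_from _ _ ij)).
  by rewrite (alive_suffix av af (suffix_trace_from _ _ ij)).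
rewrite /untouched => /andP[/= na nc].
case: b fin {jv} => fin; first by move: nc; rewrite fin// eqxx.
by move: na; rewrite fin// eqxx.
Qed.

(** With a single leaf the graph is one vertex, both isolated and connected. Otherwise there are two
    living vertices, and nothing but the isolated vertex itself can be reached from it. *)
Lemma isolated_disconnected tau : tree_at tau [::] -> (1 < leaves tau)%N ->
  (exists v, isolated_vertex G v) -> ~ connected_graph G.
Proof.
case: tau => //= a b [_ ta tb] _ [v [av iso]] [_ conn].
pose va := final ([::], 0%N) a [:: false]; pose vb := final ([::], 0%N) b [:: true].
have ava : alive X t w va by exact: alive_final.
have avb : alive X t w vb by exact: alive_final.
have vab : va <> vb.
  move=> E; have [i iE] := trace_from_final ([::], 0%N) a [:: false].
  have [j jE] := trace_from_final ([::], 0%N) b [:: true].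
  apply: (@suffix_children [::] va).
    by rewrite /va -iE; exact: (@suffix_trace_from _ _ 0).
  by rewrite E /vb -jE; exact: (@suffix_trace_from _ _ 0).
have stuck u u' : Relation_Operators.clos_refl_trans vertex (adjacent_vertices G) u u' ->
    u = v -> u' = v.
  elim=> // [x y [_ _ _ [e [eG ex _]]] xv|x y z _ IH1 _ IH2 /IH1/IH2//].
  by case: (iso e eG); rewrite -xv.
apply: vab; rewrite (stuck _ _ (conn v va av ava) erefl).
by rewrite (stuck _ _ (conn v vb av avb) erefl).
Qed.

End Graph.


Fixpoint btree_code (t : btree) : GenTree.tree unit :=
  if t is BNode a b then GenTree.Node 0 [:: btree_code a; btree_code b]
  else GenTree.Leaf tt.

Fixpoint btree_decode (c : GenTree.tree unit) : btree :=
  if c is GenTree.Node _ [:: a; b] then BNode (btree_decode a) (btree_decode b)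
  else BLeaf.

Lemma btree_codeK : cancel btree_code btree_decode.
Proof. by elim=> //= a -> b ->. Qed.

HB.instance Definition _ := Countable.copy btree (can_type btree_codeK).

Lemma bigsetU_exists (T : Type) (I : eqType) (l : seq I) (A : I -> set T) :
  [set w | exists i, i \in l /\ A i w] = \big[setU/set0]_(i <- l) A i.
Proof.
elim: l => [|i l IHl]; first by rewrite big_nil; apply/seteqP; split => w //= [i []].
rewrite big_cons -IHl; apply/seteqP; split => w /=.
  by move=> [j []]; rewrite inE => /orP[/eqP ->|jl Aj]; [left|right; exists j].
by move=> [Ai|[j [jl Aj]]]; [exists i|exists j]; rewrite inE ?eqxx ?jl ?orbT.
Qed.

(** * Measurability, and conditioning on the tree *)

Section ProcessMeasurability.
Variables (R : realType) (d : measure_display) (T : measurableType d).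
Variables (P : probability T R) (X : randomness P).
Local Notation pr := (pr P).
Local Notation block := (block (sources X)).

Definition anc_block (v : vertex) : set (vertex + vertex + edge * vertex) :=
  [set i | if i is inl (inl u) then suffix u v && (u != v) else False].

Lemma block_birth_time v : 
  measurable_fun (setT : set (g_sigma_algebraType (\bigcup_(i in anc_block v) sources X i)))
    (birth_time X v : g_sigma_algebraType (\bigcup_(i in anc_block v) sources X i) -> R).
Proof.
have H v' (J : set (vertex + vertex + edge * vertex)) : anc_block v' `<=` J ->
  measurable_fun (setT : set (g_sigma_algebraType (\bigcup_(i in J) sources X i)))
    (birth_time X v' : g_sigma_algebraType (\bigcup_(i in J) sources X i) -> R).
  elim: v' => [|b u IHu] uJ /=; first exact: measurable_cst.
  apply: measurable_realfun.measurable_funD.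
    apply: IHu => -[[x|x]|[e x]]//= /andP[xu neq]; apply: uJ => /=.
    rewrite (suffix_trans xu (suffix_cons _ _)) /=.
    by apply/eqP => E; move: (size_suffix xu); rewrite E /= ltnn.
  move=> _ B mB; rewrite setTI; apply: sub_sigma_algebra.
  exists (inl (inl u)); last by exists B; rewrite ?setTI.
  apply: uJ => /=; rewrite suffix_cons /=; apply/eqP => /(congr1 size) /= E.
  by move: (ltnn (size u)); rewrite {2}E ltnS leqnn.
exact: H.
Qed.

Lemma block_birth_le v t : block (anc_block v) [set w | birth_time X v w <= t].
Proof.
have := @block_birth_time v measurableT `]-oo, t]%classic (measurable_itv _).
rewrite setTI; congr (block _ _); apply/seteqP; split => w /=; by rewrite in_itv.
Qed.

Lemma anc_block_life v : anc_block v `<=` life_block [::].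
Proof. by case=> [[u|u]|[e u]] //= _; exact: suffix0s. Qed.

Lemma block_split_le v t : block (life_block [::]) [set w | splitting_time X v w <= t].
Proof.
exact: (block_sub (@anc_block_life _) (@block_birth_le (true :: v) t)).
Qed.

Lemma block_alive t v : block (life_block [::]) [set w | alive X t w v].
Proof.
have sB := block_sigma_algebra (sources X) (life_block [::]).
have H : block (life_block [::]) [set w | birth_time X v w <= t /\ ~ splitting_time X v w <= t].
  apply: (sigma_and sB).
    exact: (block_sub (@anc_block_life _) (@block_birth_le v t)).
  exact: (sigma_not sB (@block_split_le v t)).
move: H; congr (block _ _); apply/seteqP; split => w /=.
  by move=> [bt /negP st]; rewrite /alive /= bt ltNge.
by move=> /andP[bt st]; split=> //; apply/negP; rewrite -ltNge.
Qed.

Lemma block_tree_at t tau r : block (life_block [::]) [set w | tree_at X t w tau r].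
Proof.
have sB := block_sigma_algebra (sources X) (life_block [::]).
elim: tau r => [|a IHa b IHb] r; first exact: block_alive.
have := sigma_and sB (@block_split_le r t) (sigma_and sB (IHa (false :: r)) (IHb (true :: r))).
by congr (block _ _); apply/seteqP; split => w /=; [case=> ? []|case].
Qed.

Lemma mlife A : block (life_block [::]) A -> measurable A.
Proof. exact: mblock. Qed.

(** Paths of a given length turn reachability into a countable union of measurable conditions. *)
Fixpoint chain (V : Type) (Rel : V -> V -> Prop) (v : V) (n : nat) (u : V) : Prop :=
  if n is m.+1 then exists x, Rel u x /\ chain Rel v m x else u = v.

Lemma clos_rt_chain (V : Type) (Rel : V -> V -> Prop) (u v : V) :
  Relation_Operators.clos_refl_trans V Rel u v <-> exists n, chain Rel v n u.
Proof.
split; last first.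
  move=> [n]; elim: n u => [|n IHn] u /=; first by move=> ->; exact: Relation_Operators.rt_refl.
  move=> [x [ux /IHn xv]]; apply: Relation_Operators.rt_trans xv.
  exact: Relation_Operators.rt_step.
suff H y : Relation_Operators.clos_refl_trans V Rel u y ->
    forall m, chain Rel v m y -> exists n, chain Rel v n u.
  by move=> uv; exact: (H _ uv 0%N).
elim=> {u y} [x y xy|x|x y z _ IH1 _ IH2] m cm; last by have [n cn] := IH2 _ cm; exact: IH1 cn.
  by exists m.+1; exists y.
by exists m.
Qed.

Local Notation sM := (sigma_algebra_measurable T).

Lemma measurable_trace_from e r j v : measurable [set w | trace_from X w e r j = v].
Proof.
elim: j v => [|j IHj] v; first exact: (sigma_cst sM (r = v)).
have H : measurable [set w | exists u, trace_from X w e r j = u /\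
    (forall b, side X e u w = b -> b :: u = v)].
  apply: (sigma_exists sM) => u; apply: (sigma_and sM) => //.
  apply: (sigma_forall sM) => b; apply: (sigma_imply sM).
    exact: (measurable_funPTI (side X e u) (Y := [set b])).
  exact: (sigma_cst sM (b :: u = v)).
move: H; congr measurable; apply/seteqP; split => w /=.
  by move=> [u [uE H]]; rewrite /trace_from /= -/(trace_from _ _ _ _ _) uE; exact: H.
by move=> H; exists (trace_from X w e r j); split=> // b <-.
Qed.

Lemma measurable_ends t e v : measurable [set w | ends (full_process X t w) e v].
Proof.
have H : measurable [set w | alive X t w v /\ exists b j, trace_from X w e (b :: e.1) j = v].
  apply: (sigma_and sM); first exact: (mlife (@block_alive _ _)).
  apply: (sigma_exists sM) => b; apply: (sigma_exists sM) => j.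
  exact: measurable_trace_from.
move: H; congr measurable; apply/seteqP; split => w /=.
  by move=> [av [b [j jv]]]; split=> //; exists b => //; exists j.
by move=> [av [b _ [j _ jv]]]; split=> //; exists b, j.
Qed.

Lemma measurable_edges t e : measurable [set w | edges (full_process X t w) e].
Proof.
apply: (sigma_and sM); first exact: (mlife (@block_split_le _ _)).
exact: (measurable_funPTI (new_edges X e.1) (Y := [set n | (e.2 < n)%N])).
Qed.

Lemma measurable_adjacent t u v :
  measurable [set w | adjacent_vertices (full_process X t w) u v].
Proof.
have H : measurable [set w | alive X t w u /\ (alive X t w v /\ (u <> v /\
  exists e, edges (full_process X t w) e /\ (ends (full_process X t w) e u /\
    ends (full_process X t w) e v)))].
  apply: (sigma_and sM); first exact: (mlife (@block_alive _ _)).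
  apply: (sigma_and sM); first exact: (mlife (@block_alive _ _)).
  apply: (sigma_and sM); first exact: (sigma_cst sM (u <> v)).
  apply: (sigma_exists sM) => e; apply: (sigma_and sM); first exact: measurable_edges.
  by apply: (sigma_and sM); exact: measurable_ends.
move: H; congr measurable; apply/seteqP; split => w.
  by move=> [? [? [? [e [? [? ?]]]]]]; split=> //; exists e.
by move=> [? ? ? [e [? ? ?]]]; split=> //; split=> //; split=> //; exists e.
Qed.

Lemma measurable_connected t : measurable [set w | connected_graph (full_process X t w)].
Proof.
have H : measurable [set w | (exists v, alive X t w v) /\
    forall u v, alive X t w u -> alive X t w v ->
    exists n, chain (adjacent_vertices (full_process X t w)) v n u].
  apply: (sigma_and sM); first by apply: (sigma_exists sM) => v; exact: (mlife (@block_alive _ _)).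
  apply: (sigma_forall sM) => u; apply: (sigma_forall sM) => v.
  apply: (sigma_imply sM); first exact: (mlife (@block_alive _ _)).
  apply: (sigma_imply sM); first exact: (mlife (@block_alive _ _)).
  apply: (sigma_exists sM) => n; elim: n u => [|n IHn] u; first exact: (sigma_cst sM (u = v)).
  apply: (sigma_exists sM) => x; apply: (sigma_and sM); first exact: measurable_adjacent.
  exact: IHn.
move: H; congr measurable; apply/seteqP; split => w /=.
  move=> [ex H]; split=> // u v au av; apply/clos_rt_chain; exact: H.
by move=> [ex H]; split=> // u v au av; apply/clos_rt_chain; exact: H.
Qed.

Lemma measurable_isolated t :
  measurable [set w | exists v, isolated_vertex (full_process X t w) v].
Proof.
apply: (sigma_exists sM) => v; apply: (sigma_and sM); first exact: (mlife (@block_alive _ _)).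
apply: (sigma_forall sM) => e; apply: (sigma_imply sM); first exact: measurable_edges.
exact: (sigma_not sM (measurable_ends t e v)).
Qed.

Definition lifetimes_ge0 : set T := [set w | forall v, 0 <= lifetime X v w].

Lemma measurable_lifetimes_ge0 : measurable lifetimes_ge0.
Proof.
apply: (sigma_forall sM) => v.
have := measurable_funPTI (lifetime X v) (Y := `[0, +oo[%classic) (measurable_itv _).
by congr measurable; apply/seteqP; split => w /=; rewrite in_itv /= andbT.
Qed.

Lemma measurable_tree t (Q : btree -> bool) :
  measurable [set w | exists2 tau, tree_at X t w tau [::] & Q tau].
Proof.
have H : measurable [set w | exists tau, tree_at X t w tau [::] /\ Q tau].
  apply: (sigma_exists sM) => tau; apply: (sigma_and sM).
    exact: (mlife (@block_tree_at _ _ _)).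
  exact: (sigma_cst sM (Q tau)).
by move: H; congr measurable; apply/seteqP; split => w [tau]; [case|]; exists tau.
Qed.

Variable lambda : R.
Hypothesis lambda_gt0 : 0 < lambda.
Hypothesis XP : full_process_randomness X lambda.

Lemma measurable_lifetime v (B : set R) : measurable B ->
  measurable [set w | B (lifetime X v w)].
Proof. exact: (measurable_funPTI (lifetime X v)). Qed.

Lemma measurable_lifetime_le v x : measurable [set w | lifetime X v w <= x].
Proof.
have := measurable_lifetime v (measurable_itv `]-oo, x]).
by congr measurable; apply/seteqP; split => w /=; rewrite in_itv.
Qed.

Lemma measurable_lifetime_lt0 v : measurable [set w | lifetime X v w < 0].
Proof.
have := measurable_lifetime v (measurable_itv `]-oo, 0[).
by congr measurable; apply/seteqP; split => w /=; rewrite in_itv.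
Qed.

Lemma measurable_lifetime_itv v x : measurable [set w | 0 <= lifetime X v w <= x].
Proof.
have := measurable_lifetime v (measurable_itv `[0, x]).
by congr measurable; apply/seteqP; split => w /=; rewrite in_itv.
Qed.

Lemma pr_lifetime_itv v x : 0 < x ->
  pr [set w | 0 <= lifetime X v w <= x] = 1 - expR (- x).
Proof.
move=> x0; case: XP => /(_ v `[0, x]%classic) + _ _ _.
rewrite /distribution /pushforward /pr => H.
rewrite (_ : [set w | _] = lifetime X v @^-1` `[0, x]%classic); last first.
  by apply/seteqP; split => w /=; rewrite in_itv.
by rewrite H// exponential_prob_itv0c//= mulN1r.
Qed.

Lemma expR_small (e : R) : 0 < e -> exists2 x : R, 0 < x & expR (- x) <= e.
Proof.
move=> e0; exists (1 + `|ln e|); first by rewrite ltr_pwDl.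
rewrite -[leRHS]lnK ?posrE// ler_expR.
by have := ler_norm (- ln e); rewrite normrN; lra.
Qed.

Lemma pr_lifetime_lt0 v : pr [set w | lifetime X v w < 0] = 0.
Proof.
apply/eqP; rewrite eq_le pr_ge0 andbT; apply/ler_addgt0Pr => e /expR_small[x x0 xe].
have mI := measurable_lifetime_itv v x.
rewrite add0r; apply: (@le_trans _ _ (pr (~` [set w | 0 <= lifetime X v w <= x]))).
  apply: pr_le; [exact: measurable_lifetime_lt0|exact: measurableC|].
  by move=> w /= lt0 /andP[]; rewrite leNgt lt0.
by rewrite prC// pr_lifetime_itv// opprB addrC subrK.
Qed.

Lemma pr_no_lifetimes_ge0 : pr (~` lifetimes_ge0) = 0.
Proof.
rewrite -(pr_null_exists measurable_lifetime_lt0 pr_lifetime_lt0); congr pr; apply/seteqP; split => w /=.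
  by rewrite /lifetimes_ge0 /= -existsNE => -[v /negP]; rewrite -ltNge; exists v.
by move=> [v lv] /(_ v); rewrite leNgt lv.
Qed.

Lemma graph_block_life : graph_block [::] `&` life_block [::] = set0.
Proof. by apply/seteqP; split => -[[u|u]|[e u]] //= []. Qed.

Lemma measurable_edges_ok Rl r s : measurable [set w | edges_ok X Rl r s w].
Proof. exact: mblock (@block_edges_ok _ _ _ _ X Rl r s). Qed.

(* The tree depends on the lifetimes only, so it is independent of [C]. *)
Lemma pr_given_tree_le t (Q : btree -> bool) (B : set T) (c : R) : 0 <= c ->
  measurable B ->
  (forall tau, Q tau -> exists C : set T,
    [/\ block (graph_block [::]) C, pr C <= c &
      forall w, lifetimes_ge0 w -> tree_at X t w tau [::] -> B w -> C w]) ->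
  pr B <= pr (~` [set w | exists2 tau, tree_at X t w tau [::] & Q tau]) + c.
Proof.
move=> c0 mB H.
pose A tau := [set w | tree_at X t w tau [::]].
have mA tau : measurable (A tau) by exact: (mlife (@block_tree_at _ _ _)).
pose E := [set w | exists2 tau, tree_at X t w tau [::] & Q tau].
have mE : measurable E by exact: measurable_tree.
have mN : measurable (~` E) by exact: measurableC.
have mG : measurable (~` lifetimes_ge0) by apply: measurableC; exact: measurable_lifetimes_ge0.
have mB' : measurable (B `&` E `&` lifetimes_ge0).
  by apply: measurableI; [exact: measurableI|exact: measurable_lifetimes_ge0].
have HB : pr (B `&` E `&` lifetimes_ge0) <= c.
  pose A' (tau : btree) := if Q tau then A tau else set0.
  have mA' tau : measurable (A' tau) by rewrite /A'; case: ifP.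
  apply: (pr_partition_le (B := A')) => //.
  - by move=> i j w; rewrite /A'; case: (Q i) => //; case: (Q j) => // ti tj; exact: tree_at_inj ti tj.
  - by move=> w [[_ [tau ttau Qtau]] _]; exists tau; rewrite /A' Qtau.
  - move=> tau; rewrite /A'; case: ifP => Qtau; last by rewrite setI0 pr0 mulr0.
    have [C [bC Cc BC]] := H _ Qtau.
    have mC : measurable C by exact: mblock bC.
    apply: (@le_trans _ _ (pr (C `&` A tau))).
      apply: pr_le; [exact: measurableI|exact: measurableI|].
      by move=> w [[[Bw _] gw] tw]; split=> //; exact: BC.
    rewrite (indep_blocks XP graph_block_life bC); last exact: block_tree_at.
    by rewrite ler_wpM2r// pr_ge0.
apply: (@le_trans _ _ (pr ((~` E `|` ~` lifetimes_ge0) `|` (B `&` E `&` lifetimes_ge0)))).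
  apply: pr_le => //; first by apply: measurableU => //; exact: measurableU.
  move=> w Bw; case: (pselect (E w)) => Ew; last by left; left.
  by case: (pselect (lifetimes_ge0 w)) => gw; [right|left; right].
apply: le_trans (pr_leU _ _ _) _ => //; first exact: measurableU.
apply: lerD => //; apply: le_trans (pr_leU _ _ _) _ => //.
by rewrite pr_no_lifetimes_ge0 addr0.
Qed.

Lemma pr_disconnected_le t (Q : btree -> bool) (c : R) : 0 <= c ->
  (forall tau, Q tau -> \sum_(s <- mixed tau) expR (- (lambda * energy R eqb s)) <= c) ->
  pr (~` [set w | connected_graph (full_process X t w)]) <=
  pr (~` [set w | exists2 tau, tree_at X t w tau [::] & Q tau]) + c.
Proof.
move=> c0 H; apply: pr_given_tree_le => //.
  by apply: measurableC; exact: measurable_connected.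
move=> tau Qtau; pose C := [set w | exists s, s \in mixed tau /\ edges_ok X eqb [::] s w].
exists C.
have bs s : block (graph_block [::]) [set w | edges_ok X eqb [::] s w].
  exact: block_edges_ok.
have ms s := mblock (bs s).
have CE : C = \big[setU/set0]_(s <- mixed tau) [set w | edges_ok X eqb [::] s w].
  exact: bigsetU_exists.
split.
- rewrite CE; elim: (mixed tau) => [|s l IHl].
    by rewrite big_nil; case: (block_sigma_algebra (sources X) (graph_block [::])).
  rewrite big_cons; exact: (sigma_or (block_sigma_algebra (sources X) (graph_block [::])) (bs s) IHl).
- rewrite CE; apply: le_trans (pr_bigcup_seq _ _ ms) _.
  apply: le_trans (H _ Qtau); apply: ler_sum => s _.
  by rewrite (pr_edges_ok _ lambda_gt0 XP).
- by move=> w gw tw nc; have [s ms' os] := disconnected_mixed gw tw nc; exists s.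
Qed.

Lemma end_label_lunion e r x y w : ltree_shape x = ltree_shape y ->
  end_label X e r (lunion x y) w = end_label X e r x w || end_label X e r y w.
Proof.
elim: x y r => [c|a IHa b IHb] [c'|a' b'] r //= [ea eb].
by case: ifP => _; [exact: IHb|exact: IHa].
Qed.

Lemma edges_ok_lunion r x y w : ltree_shape x = ltree_shape y ->
  edges_ok X untouched r (lunion x y) w <->
  edges_ok X untouched r x w /\ edges_ok X untouched r y w.
Proof.
elim: x y r => [c|a IHa b IHb] [c'|a' b'] r //= [ea eb].
have uE (p q p' q' : bool) : untouched (p || p') (q || q') = untouched p q && untouched p' q'.
  by case: p; case: q; case: p'; case: q'.
split.
  move=> [H /(IHa _ _ ea)[oa oa'] /(IHb _ _ eb)[ob ob']].
  by split; split=> // k /H; rewrite !end_label_lunion// uE => /andP[].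
move=> [[H oa ob] [H' oa' ob']]; split; last 2 first.
- by apply/(IHa _ _ ea).
- by apply/(IHb _ _ eb).
by move=> k kn; rewrite !end_label_lunion// uE H ?H'.
Qed.

(** Chebyshev's inequality: with mean [m], the variance of the number of untouched leaves is at most
    [(1 + lambda) * m], so the probability of none is at most [(1 + lambda) / m], and [m] is at
    least [leaves tau] times [expR (- lambda)]. *)
Lemma pr_no_untouched_le tau :
  pr [set w | forall s, s \in marked_leaf tau -> ~ edges_ok X untouched [::] s w] <=
  (1 + lambda) * expR lambda / (leaves tau)%:R.
Proof.
set A := [set w | _]; set l := marked_leaf tau in A *.
pose O s := [set w | edges_ok X untouched [::] s w].
have mO s : measurable (O s) by exact: measurable_edges_ok.
have mA : measurable A.
  apply: (sigma_forall sM) => s; apply: (sigma_imply sM); last exact: (sigma_not sM (mO s)).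
  exact: (sigma_cst sM (s \in l)).
set m := first_moment lambda 0 tau.
(* These are the coefficients of [(N - m) ^+ 2 - m ^+ 2 * \1_A], where [N] counts the untouched
   leaves; this is nonnegative because [N = 0] on [A]. *)
pose c (i : (ltree * ltree) + ltree + bool) : R := match i with
  | inl (inl _) => 1 | inl (inr _) => - (2 * m)
  | inr true => m ^+ 2 | inr false => - m ^+ 2 end.
pose S (i : (ltree * ltree) + ltree + bool) : set T := match i with
  | inl (inl (x, y)) => O x `&` O y | inl (inr x) => O x
  | inr true => setT | inr false => A end.
pose L : seq ((ltree * ltree) + ltree + bool) :=
  [seq inl (inl (x, y)) | x <- l, y <- l] ++ [seq inl (inr x) | x <- l] ++
  [:: inr true; inr false].
have bigL (F : (ltree * ltree) + ltree + bool -> R) : \sum_(i <- L) F i =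
    \sum_(x <- l) \sum_(y <- l) F (inl (inl (x, y))) +
    (\sum_(x <- l) F (inl (inr x)) + (F (inr true) + F (inr false))).
  by rewrite !big_cat/= big_allpairs_dep big_map !big_cons big_nil addr0.
have mS i : measurable (S i) by case: i => [[[x y]|x]|[]] //=; exact: measurableI.
have := @indic_combination_ge0 _ _ _ P _ L c S mS.
rewrite !bigL /= prT => Hind.
have pointwise w : 0 <= \sum_(i <- L) c i * \1_(S i) w.
   rewrite bigL /=.
  have -> : \sum_(x <- l) \sum_(y <- l) 1 * \1_(O x `&` O y) w =
      (\sum_(x <- l) \1_(O x) w) ^+ 2 :> R.
    rewrite expr2 big_distrlr /=; apply: eq_bigr => x _; apply: eq_bigr => y _.
    by rewrite mul1r indicI.
  rewrite -mulr_sumr !indicE in_setT mulr1.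
  set Sw := \sum_(x <- l) _.
  have [wA|wA] := boolP (w \in A).
    have -> : Sw = 0.
      rewrite /Sw big_seq big1// => x xl; rewrite indicE memNset//.
      by move: wA; rewrite inE => /(_ x xl).
    by rewrite mulr1; lra.
  rewrite mulr0 addr0; have := sqr_ge0 (Sw - m); lra.
have {Hind pointwise} := Hind pointwise.
have -> : \sum_(x <- l) \sum_(y <- l) 1 * pr (O x `&` O y) = second_moment lambda 0 tau.
  rewrite /second_moment !big_seq; apply: eq_bigr => x xl.
  rewrite !big_seq; apply: eq_bigr => y yl; rewrite mul1r.
  rewrite (_ : _ `&` _ = O (lunion x y)); last first.
    apply/seteqP; split => w /=.
      by move=> [? ?]; apply/edges_ok_lunion => //; rewrite !(ltree_shape_marked_leaf (t := tau)).
    by move=> /edges_ok_lunion []//; rewrite !(ltree_shape_marked_leaf (t := tau)).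
  by rewrite (pr_edges_ok _ lambda_gt0 XP) /iso_weight mul0r addr0.
rewrite -mulr_sumr.
have -> : \sum_(x <- l) pr (O x) = m.
  apply: eq_bigr => x xl.
  by rewrite (pr_edges_ok _ lambda_gt0 XP) /iso_weight mul0r addr0.
have := second_moment0_le lambda_gt0 tau; rewrite -/m => M2 H.
have m1 := first_moment0_ge lambda_gt0 tau; rewrite -/m in m1.
have N0 : 0 < (leaves tau)%:R :> R.
  by rewrite ltr0n; elim: (tau) => //= a Ha b Hb; rewrite addn_gt0 Ha.
have m0 : 0 < m by apply: lt_le_trans m1; rewrite mulr_gt0// expR_gt0.
have pA0 := pr_ge0 P A.
have mA1 : m * pr A <= 1 + lambda.
  have : m * (m * pr A) <= m * (1 + lambda) by lra.
  by rewrite ler_pM2l.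
rewrite ler_pdivlMr//.
have : (leaves tau)%:R * expR (- lambda) * pr A <= 1 + lambda.
  by apply: le_trans mA1; rewrite ler_wpM2r.
move=> /(ler_wpM2r (expR_ge0 lambda)).
rewrite (_ : (leaves tau)%:R * expR (- lambda) * pr A * expR lambda =
             pr A * (leaves tau)%:R * (expR (- lambda) * expR lambda)).
  by rewrite -expRD addNr expR0 mulr1.
by ring.
Qed.

Lemma pr_not_isolated_le t (Q : btree -> bool) (c : R) : 0 <= c ->
  (forall tau, Q tau -> (1 < leaves tau)%N) ->
  (forall tau, Q tau -> (1 + lambda) * expR lambda / (leaves tau)%:R <= c) ->
  pr (~` [set w | ~ connected_graph (full_process X t w) /\
                  exists v, isolated_vertex (full_process X t w) v]) <=
  pr (~` [set w | exists2 tau, tree_at X t w tau [::] & Q tau]) + c.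
Proof.
move=> c0 Q1 Qc; apply: pr_given_tree_le => //.
  apply: measurableC; apply: (sigma_and sM); last exact: measurable_isolated.
  exact: (sigma_not sM (measurable_connected t)).
move=> tau Qtau.
exists [set w | forall s, s \in marked_leaf tau -> ~ edges_ok X untouched [::] s w]; split.
- have sB := block_sigma_algebra (sources X) (graph_block [::]).
  apply: (sigma_forall sB) => s; apply: (sigma_imply sB).
    exact: (sigma_cst sB (s \in marked_leaf tau)).
  by apply: (sigma_not sB); exact: block_edges_ok.
- by apply: le_trans (Qc _ Qtau); exact: pr_no_untouched_le.
- move=> w gw tw /= nB s ms os; apply: nB.
  have iso := untouched_isolated gw tw ms os; split=> //.
  exact: (isolated_disconnected tw (Q1 _ Qtau) iso).
Qed.

End ProcessMeasurability.


(** * The number of leaves *)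

Section Yule.
Variables (R : realType) (d : measure_display) (T : measurableType d).
Variables (P : probability T R) (X : randomness P).
Local Notation pr := (pr P).
Local Notation block := (block (sources X)).
Variable lambda : R.
Hypothesis lambda_gt0 : 0 < lambda.
Hypothesis XP : full_process_randomness X lambda.
Local Notation sM := (sigma_algebra_measurable T).

Lemma pr_lifetime_le v x : 0 <= x ->
  pr [set w | lifetime X v w <= x] = 1 - expR (- x).
Proof.
have Hpos y : 0 < y -> pr [set w | lifetime X v w <= y] = 1 - expR (- y).
  move=> y0; rewrite (_ : [set w | _] =
    [set w | lifetime X v w < 0] `|` [set w | 0 <= lifetime X v w <= y]).
    rewrite prU ?pr_lifetime_lt0 ?(pr_lifetime_itv XP)// ?add0r//.
    - by rewrite (pr_lifetime_lt0 XP) add0r.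
    - exact: measurable_lifetime_lt0.
    - exact: measurable_lifetime_itv.
    - by apply/seteqP; split => w //= [lt0 /andP[]]; rewrite leNgt lt0.
  apply/seteqP; split => w /=; last by move=> [/ltW/le_trans ->//|/andP[]//]; exact: ltW.
  by move=> ly; case: (ltP (lifetime X v w) 0) => l0; [left|right; rewrite ly].
rewrite le_eqVlt => /orP[/eqP <-|/Hpos//].
rewrite oppr0 expR0 subrr; apply/eqP; rewrite eq_le pr_ge0 andbT.
apply/ler_addgt0Pr => e e0; rewrite add0r.
apply: (@le_trans _ _ (pr [set w | lifetime X v w <= e])).
  apply: pr_le; [exact: measurable_lifetime_le|exact: measurable_lifetime_le|].
  by move=> w /= /le_trans; apply; exact: ltW.
by rewrite Hpos//; have := expR_ge1Dx (- e); lra.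
Qed.

Lemma measurable_lifetime_gt v x : measurable [set w | x < lifetime X v w].
Proof.
have := sigma_not sM (measurable_lifetime_le X v x).
congr measurable; apply/seteqP; split => w /=; first by move/negP; rewrite -ltNge.
by rewrite ltNge => /negP.
Qed.

Lemma pr_lifetime_gt v x : 0 <= x -> pr [set w | x < lifetime X v w] = expR (- x).
Proof.
move=> x0; rewrite (_ : [set w | _] = ~` [set w | lifetime X v w <= x]).
  by rewrite prC ?pr_lifetime_le//; [ring|exact: measurable_lifetime_le].
by apply/seteqP; split => w /=; rewrite ltNge => /negP.
Qed.

Lemma measurable_lifetime_oc v x y : measurable [set w | x < lifetime X v w <= y].
Proof.
have := measurable_lifetime X v (measurable_itv `]x, y]).
by congr measurable; apply/seteqP; split => w /=; rewrite in_itv.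
Qed.

Lemma pr_lifetime_oc v x y : 0 <= x -> x <= y ->
  pr [set w | x < lifetime X v w <= y] = expR (- x) - expR (- y).
Proof.
move=> x0 xy; rewrite -(pr_lifetime_gt v x0) -(pr_lifetime_gt v (le_trans x0 xy)).
rewrite (_ : [set w | x < lifetime X v w] =
  [set w | x < lifetime X v w <= y] `|` [set w | y < lifetime X v w]).
  rewrite prU; [ring|exact: measurable_lifetime_oc|exact: measurable_lifetime_gt|].
  by apply/seteqP; split => w //= [/andP[_]]; rewrite leNgt => /negP.
apply/seteqP; split => w /=.
  by move=> xl; case: (leP (lifetime X v w) y) => ly; [left; rewrite xl|right].
by move=> [/andP[]//|]; exact: le_lt_trans.
Qed.

Variable h : R.
Hypothesis h_gt0 : 0 < h.
Local Notation q := (expR (- h)).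

Lemma expR_step n : expR (- (n%:R * h)) = q ^+ n.
Proof. by rewrite -expRM_natl; congr expR; rewrite mulrN. Qed.

Lemma q_lt1 : q < 1.
Proof. by rewrite expR_lt1 oppr_lt0. Qed.

Lemma pr_lifetime_cell v k :
  pr [set w | k%:R * h < lifetime X v w <= k.+1%:R * h] = q ^+ k * (1 - q).
Proof.
rewrite pr_lifetime_oc; last 2 first.
- by rewrite mulr_ge0// ltW.
- by rewrite ler_wpM2r ?ltW// ltr_nat.
by rewrite !expR_step exprSr; ring.
Qed.

Lemma geom_small (e : R) : 0 < e -> exists M : nat, q ^+ M <= e.
Proof.
move=> /expR_small[x x0 xe]; exists (Num.Def.archi_bound (x / h)).
rewrite -expR_step; apply: le_trans xe; rewrite ler_expR lerN2.
by rewrite -ler_pdivrMr// ltW// archi_boundP// divr_ge0 ?ltW.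
Qed.

(** * Upper bound on the number of leaves *)

Section UpperBound.
Variable theta : R.
Hypothesis theta_gt0 : 0 < theta.
Local Notation z := (expR (- ((1 + theta) * h))).
(** The Laplace transform at [theta] of a lifetime rounded down to a multiple of [h], a discrete
    substitute for [1 / (1 + theta)]. *)
Let rho := (1 - q) / (1 - z).

Lemma z_lt1 : z < 1.
Proof. by rewrite expR_lt1 oppr_lt0 mulr_gt0//; move: theta_gt0; lra. Qed.

Lemma rho_ge0 : 0 <= rho.
Proof. by rewrite divr_ge0// subr_ge0 ltW// ?q_lt1// z_lt1. Qed.

Lemma measurable_birth_le v t : measurable [set w | birth_time X v w <= t].
Proof. exact: mblock (@block_birth_le _ _ _ _ X v t). Qed.

(** A Chernoff bound: a birth time is a sum of [size v] independent lifetimes, and each of them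
    contributes one factor [rho]. *)
Lemma pr_birth_le v t :
  pr [set w | birth_time X v w <= t] <= expR (theta * t) * rho ^+ size v.
Proof.
elim: v t => [|b u IHu] t /=.
  have [t0|t0] := leP 0 t.
    rewrite expr0 mulr1; apply: (@le_trans _ _ 1).
      by apply: pr_le1; exact: (sigma_cst sM _).
    by rewrite -[leLHS]expR0 ler_expR mulr_ge0// ltW.
  rewrite (_ : [set w | _] = set0) ?pr0 ?mulr_ge0 ?exprn_ge0 ?expR_ge0 ?rho_ge0//.
  by apply/seteqP; split => w //=.
(* Lifetimes beyond [M * h] have total probability at most [e], which leaves finitely many cells to
   sum over. *)
apply/ler_addgt0Pr => e /geom_small[M qM].
pose D k := [set w | k%:R * h < lifetime X u w <= k.+1%:R * h].
pose B k := [set w | birth_time X u w <= t - k%:R * h].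
have mDB k : measurable (D k `&` B k).
  by apply: measurableI; [exact: measurable_lifetime_oc|exact: measurable_birth_le].
have mU : measurable (\big[setU/set0]_(k <- iota 0 M) (D k `&` B k)).
  exact: bigsetU_measurable.
have m1 := measurable_lifetime_le X u 0.
have m2 := measurable_lifetime_gt u (M%:R * h).
have cell (l : R) : 0 < l -> l <= M%:R * h ->
    exists2 k, (k < M)%N & k%:R * h < l <= k.+1%:R * h.
  move=> l0; elim: (M) => [|n IHn] ln; first by move: l0; rewrite ltNge (le_trans ln)// mul0r.
  have [ln'|nl] := leP l (n%:R * h); last by exists n => //; rewrite nl ln.
  by have [k kn kl] := IHn ln'; exists k => //; exact: ltnW.
apply: (@le_trans _ _ (pr ([set w | lifetime X u w <= 0] `|`
   ([set w | M%:R * h < lifetime X u w] `|` \big[setU/set0]_(k <- iota 0 M) (D k `&` B k))))).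
  apply: pr_le; [exact: (@measurable_birth_le (b :: u) t)| |].
    by apply: measurableU => //; exact: measurableU.
  move=> w /= bt; have [l0|l0] := leP (lifetime X u w) 0; first by left.
  have [lM|Ml] := leP (lifetime X u w) (M%:R * h); last by right; left.
  right; right; have [k kM kl] := cell _ l0 lM.
  rewrite -bigsetU_exists; exists k; rewrite mem_iota; split=> //; split=> //.
  by move: kl => /andP[kl _]; rewrite /B /= lerBrDr; move: bt; apply: le_trans; rewrite lerD2l ltW.
apply: le_trans (pr_leU _ _ _) _ => //; first exact: measurableU.
rewrite pr_lifetime_le// oppr0 expR0 subrr add0r.
apply: le_trans (pr_leU _ _ _) _ => //.
rewrite addrC; apply: lerD; last by rewrite pr_lifetime_gt ?expR_step// mulr_ge0// ltW.
apply: le_trans (pr_bigcup_seq _ _ mDB) _.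
have prDB k : pr (D k `&` B k) <= z ^+ k * (expR (theta * t) * rho ^+ size u * (1 - q)).
  have dis : [set inl (inl u)] `&` anc_block u = set0.
    by apply/seteqP; split => i //= [-> ] /=; rewrite eqxx andbF.
  have bD : block [set inl (inl u)] (D k).
    have := @block_lifetime _ _ _ _ X [set inl (inl u)] u `]k%:R * h, k.+1%:R * h]%classic erefl (measurable_itv _).
    by congr (block _ _); apply/seteqP; split => w /=; rewrite in_itv.
  rewrite (indep_blocks XP dis bD (@block_birth_le _ _ _ _ X u _)).
  rewrite pr_lifetime_cell; apply: (@le_trans _ _
      (q ^+ k * (1 - q) * (expR (theta * (t - k%:R * h)) * rho ^+ size u))).
    rewrite ler_wpM2l// mulr_ge0 ?exprn_ge0 ?expR_ge0// subr_ge0 ltW//; exact: q_lt1.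
  rewrite -!expRM_natl le_eqVlt; apply/orP; left; apply/eqP.
  have -> : expR (theta * (t - k%:R * h)) = expR (theta * t) * expR (- (k%:R * theta * h)).
    by rewrite -expRD; congr expR; ring.
  have -> : expR (k%:R * - ((1 + theta) * h)) = expR (k%:R * - h) * expR (- (k%:R * theta * h)).
    by rewrite -expRD; congr expR; ring.
  by ring.
apply: (@le_trans _ _ (\sum_(k <- iota 0 M)
    z ^+ k * (expR (theta * t) * rho ^+ size u * (1 - q)))); first by apply: ler_sum => k _.
rewrite -mulr_suml.
have -> : \sum_(k <- iota 0 M) z ^+ k = (1 - z ^+ M) / (1 - z).
  have z1 : 1 - z != 0 by rewrite subr_eq0 eq_sym lt_eqF// z_lt1.
  move: z1; move: (z) => y y1; elim: (M) => [|n IHn]; first by rewrite big_nil expr0 subrr mul0r.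
  rewrite -addn1 iotaD big_cat big_seq1 /= IHn add0n addn1 exprSr; field; exact: y1.
rewrite exprSr /rho.
have -> : expR (theta * t) * (((1 - q) / (1 - z)) ^+ size u * ((1 - q) / (1 - z))) =
   (1 / (1 - z)) * (expR (theta * t) * ((1 - q) / (1 - z)) ^+ size u * (1 - q)) by ring.
have z0 : 0 < 1 - z by rewrite subr_gt0 z_lt1.
rewrite ler_wpM2r//.
  rewrite mulr_ge0//; last by rewrite subr_ge0 ltW// q_lt1.
  by rewrite mulr_ge0 ?expR_ge0// exprn_ge0// rho_ge0.
apply: ler_wpM2r; first by rewrite invr_ge0 ltW.
by have : 0 <= z ^+ M; [rewrite exprn_ge0// expR_ge0|lra].
Qed.

Hypothesis rho_lt : 2 * rho < 1.

Lemma sum_level n r : \sum_(v <- level n r) rho ^+ size v = (2 * rho) ^+ n * rho ^+ size r.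
Proof.
elim: n r => [|n IHn] r /=; first by rewrite big_seq1 expr0 mul1r.
by rewrite big_cat !IHn /= !exprS; ring.
Qed.

Lemma sum_upto n r : \sum_(v <- upto n r) rho ^+ size v <= rho ^+ size r / (1 - 2 * rho).
Proof.
have r1 : 0 < 1 - 2 * rho by rewrite subr_gt0.
elim: n r => [|n IHn] r /=.
  by rewrite big_nil divr_ge0 ?exprn_ge0 ?rho_ge0// ltW.
rewrite big_cons big_cat /=.
have := IHn (false :: r); have := IHn (true :: r); rewrite /= exprS.
have -> : rho ^+ size r / (1 - 2 * rho) = rho ^+ size r +
   (rho * rho ^+ size r / (1 - 2 * rho) + rho * rho ^+ size r / (1 - 2 * rho)).
  by field; rewrite gt_eqF.
lra.
Qed.

Lemma pr_level_born n t :
  pr [set w | exists v, v \in level n [::] /\ birth_time X v w <= t] <=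
  expR (theta * t) * (2 * rho) ^+ n.
Proof.
rewrite bigsetU_exists; apply: le_trans (pr_bigcup_seq _ _ (fun v => measurable_birth_le v t)) _.
apply: (@le_trans _ _ (\sum_(v <- level n [::]) expR (theta * t) * rho ^+ size v)).
  by apply: ler_sum => v _; exact: pr_birth_le.
by rewrite -mulr_sumr sum_level expr0 mulr1.
Qed.

Lemma rho_small (e : R) : 0 < e -> exists n, (2 * rho) ^+ n <= e.
Proof.
move=> e0; have r0 := rho_ge0.
have : (2 * rho) ^+ n @[n --> \oo] --> 0.
  by apply: cvg_expr; rewrite ger0_norm// mulr_ge0.
move=> /cvgrPdist_le/(_ _ e0)[n _ H]; exists n.
have := H n (leqnn n); rewrite sub0r normrN ger0_norm//.
by rewrite exprn_ge0// mulr_ge0.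
Qed.

(** Markov's inequality for the number of births, whose mean is a geometric series of ratio
    [2 * rho]. Counting stops at a level [n] reached with probability at most an arbitrary [e]. *)
Lemma pr_tree_upper t m : 0 <= t ->
  pr (~` [set w | exists2 tau, tree_at X t w tau [::] & (leaves tau <= m)%N]) <=
  expR (theta * t) / (1 - 2 * rho) / m.+1%:R.
Proof.
move=> t0; apply/ler_addgt0Pr => e e0.
have [n ne] := rho_small (divr_gt0 e0 (expR_gt0 (theta * t))).
pose E := [set w | exists v, v \in level n [::] /\ birth_time X v w <= t].
pose B := [set w | (m.+1 <= births X t w n [::])%N].
have mE : measurable E.
  apply: (sigma_exists sM) => v; apply: (sigma_and sM); last exact: measurable_birth_le.
  exact: (sigma_cst sM (v \in level n [::])).
have mB : measurable B.
  rewrite /B /births; move: (upto n [::]) => l.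
  have : forall k, measurable [set w | (k <= count (fun v => (birth_time X v w <= t)%R) l)%N].
    elim: l => [|v l IHl] k /=; first exact: (sigma_cst sM (k <= 0)%N).
    have H : measurable [set w | (birth_time X v w <= t ->
         (k.-1 <= count (fun v => (birth_time X v w <= t)%R) l)%N) /\
       (~ birth_time X v w <= t -> (k <= count (fun v => (birth_time X v w <= t)%R) l)%N)].
      apply: (sigma_and sM); apply: (sigma_imply sM) => //; first exact: measurable_birth_le.
      exact: (sigma_not sM (measurable_birth_le v t)).
    move: H; congr measurable; apply/seteqP; split => w /=.
      move=> [H1 H2]; case: (birth_time X v w <= t) H1 H2 => /= H1 H2.
        by have := H1 isT; lia.
      by have := H2 (fun b => notF b); lia.
    by case: (birth_time X v w <= t) => /= H; split => //; lia.
  exact.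
have prB : pr B <= expR (theta * t) / (1 - 2 * rho) / m.+1%:R.
  rewrite ler_pdivlMr ?ltr0n//.
  apply: (@le_trans _ _ (\sum_(v <- upto n [::]) pr [set w | birth_time X v w <= t])).
    pose S (o : option vertex) := if o is Some v then [set w | birth_time X v w <= t] else B.
    pose c (o : option vertex) : R := if o is Some v then 1 else - m.+1%:R.
    have := @indic_combination_ge0 _ _ _ P _ (None :: map Some (upto n [::])) c S.
    rewrite big_cons big_map /=; under eq_bigr do rewrite mul1r.
    move=> H; suff : 0 <= - m.+1%:R * pr B + \sum_(v <- upto n [::]) pr [set w | birth_time X v w <= t].
      lra.
    apply: H; first by case=> [v|] //; exact: measurable_birth_le.
    move=> w; rewrite big_cons big_map /=; under eq_bigr do rewrite mul1r.
    have -> : \sum_(v <- upto n [::]) \1_[set w | birth_time X v w <= t] w =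
        (births X t w n [::])%:R :> R.
      rewrite /births; elim: (upto n [::]) => [|v l IHl]; first by rewrite big_nil.
      rewrite big_cons IHl /= natrD indicE; congr (_%:R + _).
      by congr nat_of_bool; apply/idP/idP; rewrite inE.
    rewrite indicE; have [wB|wB] := boolP (w \in B).
      by rewrite mulr1 addrC subr_ge0 ler_nat; rewrite inE in wB.
    by rewrite mulr0 add0r.
  apply: (@le_trans _ _ (\sum_(v <- upto n [::]) expR (theta * t) * rho ^+ size v)).
    by apply: ler_sum => v _; exact: pr_birth_le.
  rewrite -mulr_sumr ler_wpM2l ?expR_ge0//.
  by have := sum_upto n [::]; rewrite expr0 div1r.
apply: (@le_trans _ _ (pr (B `|` E))).
  apply: pr_le; [|exact: measurableU|].
    apply: measurableC; exact: (measurable_tree X t (fun tau => (leaves tau <= m)%N)).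
  move=> w /= nt; have [bm|] := ltnP m (births X t w n [::]); first by left.
  move=> bm; right; apply: contrapT => nE; apply: nt.
  have [v lv|tau tt le_tau] := @tree_exists _ _ _ _ X t w n [::] t0.
    by rewrite ltNge; apply/negP => bv; apply: nE; exists v.
  by exists tau => //; exact: leq_trans bm.
apply: le_trans (pr_leU _ _ _) _ => //; apply: lerD => //.
apply: le_trans (pr_level_born _ _) _.
by rewrite mulrC -ler_pdivlMr// expR_gt0.
Qed.

Lemma pr_tree_exists t : 0 <= t ->
  pr (~` [set w | exists2 tau, tree_at X t w tau [::] & true]) = 0.
Proof.
move=> t0; apply/eqP; rewrite eq_le pr_ge0 andbT; apply/ler_addgt0Pr => e e0; rewrite add0r.
have [n ne] := rho_small (divr_gt0 e0 (expR_gt0 (theta * t))).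
pose E := [set w | exists v, v \in level n [::] /\ birth_time X v w <= t].
have mE : measurable E.
  apply: (sigma_exists sM) => v; apply: (sigma_and sM); last exact: measurable_birth_le.
  exact: (sigma_cst sM (v \in level n [::])).
apply: (@le_trans _ _ (pr E)).
  apply: pr_le => //.
    apply: measurableC; exact: (measurable_tree X t (fun tau => true)).
  move=> w /= nt; apply: contrapT => nE; apply: nt.
  have [v lv|tau tt le_tau] := @tree_exists _ _ _ _ X t w n [::] t0; last by exists tau.
  by rewrite ltNge; apply/negP => bv; apply: nE; exists v.
apply: le_trans (pr_level_born _ _) _.
by rewrite mulrC -ler_pdivlMr// expR_gt0.
Qed.

End UpperBound.

End Yule.


(** * Lower bound on the number of leaves *)

Section YuleLower.
Variables (R : realType) (d : measure_display) (T : measurableType d).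
Variables (P : probability T R) (X : randomness P).
Local Notation pr := (pr P).
Local Notation block := (block (sources X)).
Variable lambda : R.
Hypothesis lambda_gt0 : 0 < lambda.
Hypothesis XP : full_process_randomness X lambda.
Local Notation sM := (sigma_algebra_measurable T).
Variable h : R.
Hypothesis h_gt0 : 0 < h.
Local Notation q := (expR (- h)).

(* The number of leaves after [i] more steps of length [h] below a vertex of
   age [a * h], when every splitting is postponed to the end of its step. *)
Fixpoint slow_leaves (i : nat) (r : vertex) (a : nat) (w : T) : nat :=
  if i is j.+1 then
    if lifetime X r w <= a.+1%:R * h then
      (slow_leaves j (false :: r) 0 w + slow_leaves j (true :: r) 0 w)%N
    else slow_leaves j r a.+1 w
  else 1%N.

(** Postponed children are really born earlier than the slow process assumes. The time hypothesis is
    an inequality so that it passes to them with age reset to [0]. *)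
Lemma slow_leaves_le t i r a w tau : tree_at X t w tau r ->
  birth_time X r w + (a + i)%:R * h <= t -> (slow_leaves i r a w <= leaves tau)%N.
Proof.
have h0 := ltW h_gt0.
have leaves_gt0 u : (0 < leaves u)%N by elim: u => //= x Hx y _; rewrite addn_gt0 Hx.
elim: i r a tau => [|i IHi] r a tau tt bt /=; first exact: leaves_gt0.
case: ifP => la; last by apply: IHi => //; rewrite addSn -addnS.
have ai : a.+1%:R * h <= (a + i.+1)%:R * h by rewrite ler_wpM2r// ler_nat; lia.
have bi : i%:R * h <= t - (birth_time X r w + a.+1%:R * h).
  rewrite lerBrDr addrC -addrA -mulrDl -natrD; apply: le_trans bt.
  by rewrite lerD2l addSnnS.
case: tau tt => [|x y] /= tt.
  have := tt => /andP[_]; rewrite /splitting_time => tl.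
  have : birth_time X r w + lifetime X r w <= t.
    apply: (le_trans _ bt); rewrite lerD2l; exact: le_trans ai.
  by rewrite leNgt tl.
case: tt => _ tx ty; apply: leq_add; apply: IHi => //=; rewrite add0n.
  by move: bi la; lra.
by move: bi la; lra.
Qed.

Lemma block_slow_leaves i r a n :
  block (life_block r) [set w | slow_leaves i r a w = n].
Proof.
elim: i r a n => [|i IHi] r a n /=.
  exact: (sigma_cst (block_sigma_algebra (sources X) _) (1%N = n)).
have sB := block_sigma_algebra (sources X) (life_block r).
have sub c : life_block (c :: r) `<=` life_block r.
  by case=> [[u|u]|[e u]] //= /suffix_child.
have bL : block (life_block r) [set w | lifetime X r w <= a.+1%:R * h].
  have rr : life_block r (inl (inl r)) by exact: suffix_refl.
  have := @block_lifetime _ _ _ _ X _ r `]-oo, a.+1%:R * h]%classic rr (measurable_itv _).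
  by congr (block _ _); apply/seteqP; split => w /=; rewrite in_itv.
have H : block (life_block r) [set w |
    (lifetime X r w <= a.+1%:R * h -> exists k l,
       (slow_leaves i (false :: r) 0 w = k /\ slow_leaves i (true :: r) 0 w = l) /\ (k + l = n)%N) /\
    (~ lifetime X r w <= a.+1%:R * h -> slow_leaves i r a.+1 w = n)].
  apply: (sigma_and sB); apply: (sigma_imply sB) => //; last exact: (sigma_not sB bL).
  apply: (sigma_exists sB) => k; apply: (sigma_exists sB) => l.
  apply: (sigma_and sB); last exact: (sigma_cst sB (k + l = n)%N).
  by apply: (sigma_and sB); exact: (block_sub (sub _) (IHi _ _ _)).
move: H; congr (block _ _); apply/seteqP; split => w /=.
  move=> [H1 H2]; case: ifP => [/H1[k [l [[-> ->]]]]//|/negP/H2//].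
case: ifP => lw H; split => //.
by move=> _; exists (slow_leaves i (false :: r) 0 w), (slow_leaves i (true :: r) 0 w).
Qed.

Lemma measurable_slow_leaves i r a n : measurable [set w | slow_leaves i r a w = n].
Proof. exact: mblock (@block_slow_leaves i r a n). Qed.

Fixpoint slow_pgf (i : nat) : {poly R} :=
  if i is j.+1 then q *: slow_pgf j + (1 - q) *: (slow_pgf j ^+ 2) else 'X.

(** Lack of memory at multiples of [h]: given survival to age [a * h], the count has a law
    independent of [a]. A split in the next step has probability [1 - q] and yields two independent
    copies, hence the convolution. *)
Lemma pr_slow_leaves i r a n :
  pr ([set w | a%:R * h < lifetime X r w] `&` [set w | slow_leaves i r a w = n]) =
  q ^+ a * (slow_pgf i)`_n.
Proof.
have mS := measurable_slow_leaves.
have mL := measurable_lifetime_gt X.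
elim: i r a n => [|i IHi] r a n.
  rewrite /= coefX; have [->|n1] := eqVneq n 1%N.
    rewrite (_ : _ `&` _ = [set w | a%:R * h < lifetime X r w]).
      by rewrite (pr_lifetime_gt XP) ?expR_step ?mulr1// mulr_ge0// ltW.
    by apply/seteqP; split => w /= [].
  rewrite mulr0 (_ : _ `&` _ = set0) ?pr0//.
  by apply/seteqP; split => w //= -[_ /eqP]; rewrite eq_sym (negbTE n1).
have pr0S c k : pr [set w | slow_leaves i (c :: r) 0 w = k] = (slow_pgf i)`_k.
  rewrite -[RHS]mul1r -(expr0 q) -(IHi (c :: r) 0%N k).
  apply/eqP; rewrite eq_le; apply/andP; split; last first.
    by apply: pr_le; [exact: measurableI|by []|exact: subIsetr].
  have m0 := measurable_lifetime_le X (c :: r) 0.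
  apply: (@le_trans _ _ (pr ([set w | lifetime X (c :: r) w <= 0] `|`
     ([set w | 0%:R * h < lifetime X (c :: r) w] `&` [set w | slow_leaves i (c :: r) 0 w = k])))).
    apply: pr_le => //; first by apply: measurableU => //; exact: measurableI.
    move=> w /= wk; rewrite mul0r.
    by case: (leP (lifetime X (c :: r) w) 0) => l0; [left|right].
  apply: le_trans (pr_leU _ _ _) _ => //; first exact: measurableI.
  by rewrite (pr_lifetime_le XP)// oppr0 expR0 subrr add0r.
pose C k := [set w | slow_leaves i (false :: r) 0 w = k] `&`
            [set w | slow_leaves i (true :: r) 0 w = (n - k)%N].
pose D := [set w | a%:R * h < lifetime X r w <= a.+1%:R * h].
pose E := [set w | (slow_leaves i (false :: r) 0 w + slow_leaves i (true :: r) 0 w = n)%N].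
have mC k : measurable (C k) by exact: measurableI.
have prCk k : pr (C k) = (slow_pgf i)`_k * (slow_pgf i)`_(n - k).
  have dis : life_block (false :: r) `&` life_block (true :: r) = set0.
    by apply/seteqP; split => -[[u|u]|[e u]] //= [] //; exact: suffix_children.
  rewrite (indep_blocks XP dis (@block_slow_leaves _ _ _ _) (@block_slow_leaves _ _ _ _)).
  by rewrite !pr0S.
have EC (m : nat) : (m <= n.+1)%N ->
    pr [set w | exists k, k \in iota 0 m /\ C k w] =
    \sum_(0 <= k < m) (slow_pgf i)`_k * (slow_pgf i)`_(n - k).
  elim: m => [|m IHm] mn.
    rewrite big_geq// (_ : [set w | _] = set0) ?pr0//.
    by apply/seteqP; split => w //= [k []].
  have mEm : measurable [set w | exists k, k \in iota 0 m /\ C k w].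
    apply: (sigma_exists sM) => k; apply: (sigma_and sM); last exact: mC.
    exact: (sigma_cst sM (k \in iota 0 m)).
  rewrite big_nat_recr// [RHS]/= -IHm 1?ltnW// -prCk -prU//.
    congr pr; apply/seteqP; split => w.
      move=> [k []]; rewrite mem_iota add0n /= ltnS leq_eqVlt => /orP[/eqP -> Ck|km Ck].
        by right.
      have km' : k \in iota 0 m by rewrite mem_iota.
      by left; exists k.
    move=> [[k []]|Cm]; last first.
      have mm : m \in iota 0 m.+1 by rewrite mem_iota add0n /=.
      by exists m.
    rewrite mem_iota add0n /= => km Ck.
    have km' : k \in iota 0 m.+1 by rewrite mem_iota add0n /= ltnS ltnW.
    by exists k.
  apply/seteqP; split => w // [[k [+ [kE _]]] [mE _]].
  by rewrite mem_iota add0n /= -kE mE ltnn.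
have EE : E = [set w | exists k, k \in iota 0 n.+1 /\ C k w].
  apply/seteqP; split => w.
    rewrite /E /= => En.
    have kn : slow_leaves i (false :: r) 0 w \in iota 0 n.+1 by rewrite mem_iota; lia.
    by exists (slow_leaves i (false :: r) 0 w); split=> //; split=> //=; lia.
  by move=> [k []]; rewrite mem_iota /E /C /= => kn [-> ->]; lia.
have bE : block (life_block (false :: r) `|` life_block (true :: r)) E.
  have sB := block_sigma_algebra (sources X) (life_block (false :: r) `|` life_block (true :: r)).
  rewrite EE; apply: (sigma_exists sB) => k; apply: (sigma_and sB).
    exact: (sigma_cst sB (k \in iota 0 n.+1)).
  apply: (sigma_and sB).
    by apply: (block_sub _ (@block_slow_leaves _ _ _ _)); exact: subsetUl.
  by apply: (block_sub _ (@block_slow_leaves _ _ _ _)); exact: subsetUr.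
have bD : block [set inl (inl r)] D.
  have := @block_lifetime _ _ _ _ X [set inl (inl r)] r `]a%:R * h, a.+1%:R * h]%classic erefl (measurable_itv _).
  by congr (block _ _); apply/seteqP; split => w /=; rewrite in_itv.
have disD : [set inl (inl r)] `&` (life_block (false :: r) `|` life_block (true :: r)) = set0.
  apply/seteqP; split => i' //= [-> []] /=; exact/negP/suffix_child_self.
have lt_a : a%:R * h <= a.+1%:R * h by rewrite ler_wpM2r ?ler_nat// ltW.
rewrite (_ : _ `&` _ = (D `&` E) `|` ([set w | a.+1%:R * h < lifetime X r w] `&`
    [set w | slow_leaves i r a.+1 w = n])).
  rewrite prU; last 3 first.
  - by apply: measurableI; [exact: mblock bD|exact: mblock bE].
  - exact: measurableI.
  - by apply/seteqP; split => w //= [[/andP[_ lw] _] []]; rewrite ltNge lw.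
  rewrite IHi (indep_blocks XP disD bD bE) /D (pr_lifetime_cell XP h_gt0) EE EC//.
  rewrite /= coefD !coefZ expr2 coefM big_mkord exprS.
  by ring.
apply/seteqP; split => w /=; rewrite /D /E /=.
  move=> [la]; case: ifP => [lw En|/negbT lw En]; first by left; split => //; apply/andP.
  by right; rewrite ltNge.
move=> [[/andP[la lw] En]|[la En]]; first by rewrite lw.
by split; [exact: le_lt_trans la|rewrite leNgt la].
Qed.

Lemma slow_pgf_ge0 i n : 0 <= (slow_pgf i)`_n.
Proof.
by have := pr_slow_leaves i [::] 0 n; rewrite expr0 mul1r => <-; exact: pr_ge0.
Qed.

Lemma horner_slow_pgf_ge0 i x : 0 <= x -> 0 <= (slow_pgf i).[x].
Proof.
move=> x0; rewrite horner_coef; apply: sumr_ge0 => j _.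
by rewrite mulr_ge0 ?exprn_ge0// slow_pgf_ge0.
Qed.

(** In continuous time the generating function of this branching process multiplies [1 / x - 1] by
    [expR t] exactly. With [x = (1 + v)^-1] the discrete recursion does so at rate at least the mean
    [2 - q] per step, because [q * (2 - q) <= 1]. *)
Lemma horner_slow_pgf_le i v : 0 < v ->
  (slow_pgf i).[(1 + v)^-1] <= (1 + (2 - q) ^+ i * v)^-1.
Proof.
move=> v0; have q0 : 0 < q := expR_gt0 _; have q1 := q_lt1 h_gt0.
elim: i => [|i IHi] /=; first by rewrite hornerX expr0 mul1r.
have F0 : 0 <= (slow_pgf i).[(1 + v)^-1].
  by apply: horner_slow_pgf_ge0; rewrite invr_ge0; lra.
rewrite hornerD !hornerZ horner_exp [(2 - q) ^+ _]exprS.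
set F := (slow_pgf i).[_] in IHi F0 *.
set u := (2 - q) ^+ i * v in IHi *.
have u0 : 0 < u by rewrite mulr_gt0// exprn_gt0//; lra.
rewrite -mulrA -/u.
apply: (@le_trans _ _ (q * (1 + u)^-1 + (1 - q) * (1 + u)^-1 ^+ 2)).
  apply: lerD; first by rewrite ler_wpM2l// ltW.
  by rewrite ler_wpM2l ?lerXn2r ?nnegrE ?invr_ge0//; lra.
have -> : q * (1 + u)^-1 + (1 - q) * (1 + u)^-1 ^+ 2 = (1 + q * u) / (1 + u) ^+ 2.
  by field; lra.
rewrite ler_pdivrMr ?exprn_gt0//; last by lra.
rewrite [leRHS]mulrC ler_pdivlMr; last by rewrite addr_gt0// mulr_gt0//; lra.
have : q * (2 - q) * u ^+ 2 <= 1 * u ^+ 2 by rewrite ler_wpM2r ?sqr_ge0//; nra.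
by rewrite !expr2; lra.
Qed.

Lemma pr_slow_leaves_le i m : (0 < m)%N ->
  pr [set w | (slow_leaves i [::] 0 w <= m)%N] <= expR 1 * m%:R / (2 - q) ^+ i.
Proof.
move=> m0; have q0 : 0 < q := expR_gt0 _; have q1 := q_lt1 h_gt0.
have m0' : 0 < m%:R :> R by rewrite ltr0n.
(* At this point [x ^- m <= expR 1], so bounding the first [m + 1] coefficients by [x ^- m] times
   the generating function loses only a constant. *)
pose x : R := (1 + m%:R^-1)^-1.
have x0 : 0 < x by rewrite invr_gt0 addr_gt0// invr_gt0.
have x1 : x <= 1 by rewrite invf_le1 ?addr_gt0 ?invr_gt0// lerDl invr_ge0 ltW.
have mS := measurable_slow_leaves.
have H1 : pr [set w | (slow_leaves i [::] 0 w <= m)%N] <= \sum_(n < m.+1) (slow_pgf i)`_n.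
  have S n : pr [set w | slow_leaves i [::] 0 w = n] <= (slow_pgf i)`_n.
    have := pr_slow_leaves i [::] 0 n; rewrite expr0 mul1r => <-.
    have m0l := measurable_lifetime_le X [::] 0.
    have mI : measurable ([set w | 0%:R * h < lifetime X [::] w] `&`
       [set w | slow_leaves i [::] 0 w = n]).
      by apply: measurableI => //; exact: measurable_lifetime_gt.
    apply: (@le_trans _ _ (pr ([set w | lifetime X [::] w <= 0] `|`
       ([set w | 0%:R * h < lifetime X [::] w] `&` [set w | slow_leaves i [::] 0 w = n])))).
      apply: pr_le => //; first exact: measurableU.
      move=> w /= wk; rewrite mul0r.
      by case: (leP (lifetime X [::] w) 0) => l0; [left|right].
    apply: le_trans (pr_leU _ _ _) _ => //.
    by rewrite (pr_lifetime_le XP)// oppr0 expR0 subrr add0r.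
  rewrite -(big_mkord xpredT (fun n => (slow_pgf i)`_n)).
  apply: le_trans (ler_sum _ (fun n _ => S n)).
  apply: pr_union_bound => //; rewrite -?bigsetU_exists.
    have := sigma_exists sM (fun n => sigma_and sM (mS i [::] 0%N n) (sigma_cst sM (n <= m)%N)).
    by congr measurable; apply/seteqP; split => w /=; [move=> [n [<-]]|exists (slow_leaves i [::] 0 w)].
  by move=> w /= wm; exists (slow_leaves i [::] 0 w); rewrite mem_index_iota ltnS.
have H2 : x ^+ m * \sum_(n < m.+1) (slow_pgf i)`_n <= (slow_pgf i).[x].
  rewrite (@horner_coef_wide _ (size (slow_pgf i) + m.+1) _ _ (leq_addr _ _)).
  rewrite addnC big_split_ord /= mulr_sumr.
  apply: (@le_trans _ _ (\sum_(n < m.+1) (slow_pgf i)`_n * x ^+ n)).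
    apply: ler_sum => n _; rewrite mulrC ler_wpM2l ?slow_pgf_ge0//.
    by apply: ler_wiXn2l => //; [exact: ltW|rewrite -ltnS].
  rewrite lerDl; apply: sumr_ge0 => n _.
  by rewrite mulr_ge0 ?slow_pgf_ge0// exprn_ge0// ltW.
have H3 := horner_slow_pgf_le i (v := m%:R^-1); rewrite invr_gt0 in H3.
have {}H3 := H3 m0'; rewrite -/x in H3.
have z0 : 0 < (2 - q) ^+ i by rewrite exprn_gt0//; lra.
have H4 : (1 + (2 - q) ^+ i * m%:R^-1)^-1 <= m%:R / (2 - q) ^+ i.
  rewrite -[leRHS]invf_div lef_pV2 ?posrE ?divr_gt0//; first by rewrite lerDr.
  by rewrite addr_gt0// divr_gt0.
have H5 : x ^- m <= expR 1.
  rewrite -exprVn /x invrK; apply: (@le_trans _ _ (expR (m%:R^-1) ^+ m)).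
    by rewrite lerXn2r ?nnegrE ?expR_ge0 ?expR_ge1Dx// addr_ge0// invr_ge0 ltW.
  by rewrite -expRM_natl mulfV// gt_eqF.
have xm : 0 < x ^+ m by rewrite exprn_gt0.
apply: (le_trans H1).
have : \sum_(n < m.+1) (slow_pgf i)`_n <= x ^- m * (m%:R / (2 - q) ^+ i).
  rewrite -ler_pdivrMl ?invr_gt0// invrK; apply: (le_trans H2); exact: le_trans H4.
move=> /le_trans; apply; rewrite -[leRHS]mulrA ler_wpM2r//.
by rewrite divr_ge0// ltW.
Qed.

Lemma pr_tree_lower t i m : 0 <= t -> i%:R * h <= t -> (0 < m)%N ->
  pr (~` [set w | exists2 tau, tree_at X t w tau [::] & true]) = 0 ->
  pr (~` [set w | exists2 tau, tree_at X t w tau [::] & (m < leaves tau)%N]) <=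
  expR 1 * m%:R / (2 - q) ^+ i.
Proof.
move=> t0 it m0 ex0; apply: le_trans (pr_slow_leaves_le i m0).
have mtree (Q : btree -> bool) : measurable (~` [set w | exists2 tau, tree_at X t w tau [::] & Q tau]).
  by apply: measurableC; exact: measurable_tree.
have mS : measurable [set w | (slow_leaves i [::] 0 w <= m)%N].
  have := sigma_exists sM (fun n => sigma_and sM (@measurable_slow_leaves i [::] 0%N n) (sigma_cst sM (n <= m)%N)).
  by congr measurable; apply/seteqP; split => w /=; [move=> [n [<-]]|exists (slow_leaves i [::] 0 w)].
rewrite -[leRHS]add0r -[X in X + _]ex0; apply: le_trans (pr_leU _ _ _) => //.
  apply: pr_le => //; first exact: measurableU.
  move=> w /= nt; have [slow|fast] := leqP (slow_leaves i [::] 0 w) m; first by right.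
  left => -[tau tt _]; apply: nt; exists tau => //.
  apply: (leq_trans fast); apply: slow_leaves_le tt _.
  by rewrite /= add0r add0n.
Qed.

End YuleLower.


(** * The threshold *)

Section Assembly.
Variable R : realType.

Lemma expRN_le_inv (x : R) : 0 < x -> expR (- x) <= x^-1.
Proof.
by move=> x0; rewrite expRN lef_pV2 ?posrE ?expR_gt0//; have := expR_ge1Dx x; lra.
Qed.

Lemma expRN_le (x y : R) : 0 < y -> y^-1 <= x -> expR (- x) <= y.
Proof.
move=> y0 yx; have x0 : 0 < x by apply: lt_le_trans yx; rewrite invr_gt0.
apply: (le_trans (expRN_le_inv x0)).
by rewrite -[leRHS]invrK lef_pV2 ?posrE ?invr_gt0.
Qed.

Lemma with_high_probability_exp (d : measure_display) (T : R -> measurableType d)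
    (P : forall lambda, probability (T lambda) R) (A : forall lambda, set (T lambda))
    (C M c : R) : 0 < c -> 0 < C ->
  (forall lambda, 0 < lambda -> measurable (A lambda)) ->
  (forall lambda, 0 < lambda -> M <= lambda ->
     pr (P lambda) (~` A lambda) <= C * expR (- (c * lambda))) ->
  with_high_probability P A.
Proof.
move=> c0 C0 mA H; split => //; apply: cvg_EFin.
  near=> lambda; have l0 : 0 < lambda by near: lambda; exact: nbhs_pinfty_gt.
  by rewrite fin_num_measure//; exact: mA.
apply/cvgrPdist_le => e e0; near=> lambda.
have l0 : 0 < lambda by near: lambda; exact: nbhs_pinfty_gt.
have lM : M <= lambda by apply: ltW; near: lambda; apply: nbhs_pinfty_gt; exact: num_real.
have le : (C / (e * c)) <= lambda.
  by apply: ltW; near: lambda; apply: nbhs_pinfty_gt; exact: num_real.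
rewrite /= -/(pr (P lambda) (A lambda)) -prC ?mA//; last exact: mA.
rewrite ger0_norm ?pr_ge0//; apply: (le_trans (H _ l0 lM)).
rewrite mulrC -ler_pdivlMr//; apply: expRN_le; first exact: divr_gt0.
by rewrite invf_div; move: le; rewrite !ler_pdivrMr ?mulr_gt0//; lra.
Unshelve. all: by end_near. Qed.

(** With [theta = 1 + b], the limit of [2 * rho] as the step tends to [0] is [2 / (2 + b) < 1]; the
    step [b / 16] is small enough to keep it below [1]. *)
Lemma rho_half (b : R) : 0 < b -> b <= 1 ->
  2 * ((1 - expR (- (b / 16))) / (1 - expR (- ((1 + (1 + b)) * (b / 16))))) < 1.
Proof.
move=> b0 b1; pose h := b / 16; rewrite -/h.
have h0 : 0 < h by rewrite divr_gt0.
have y0 := expR_gt0 (- h); set y := expR (- h) in y0 *.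
have yh : 1 - h <= y by have := expR_ge1Dx (- h); rewrite -/y; lra.
have y1 : y < 1 by rewrite expR_lt1 oppr_lt0.
pose E := expR (- (b * h)).
have E0 : 0 < E := expR_gt0 _.
have EE : E * (1 + b * h) <= 1.
  have := expR_ge1Dx (b * h); rewrite -(ler_pM2l E0) /E -expRD addNr expR0; exact.
have -> : expR (- ((1 + (1 + b)) * h)) = y ^+ 2 * E.
  by rewrite /y /E -expRM_natl -expRD; congr expR; ring.
have bh : 0 < b * h by rewrite mulr_gt0.
have bh1 : b * h <= 1 by rewrite mulr_ile1//; rewrite /h; lra.
have E1 : E <= 1 - b * h / 2 by nra.
have yy : y ^+ 2 * E < 2 * y - 1.
  (* The goal [y ^+ 2 * E < 2 * y - 1] rearranges to [(1 - y) ^+ 2 < y ^+ 2 * (1 - E)], and [1 - E]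
     is at least [b * h / 2]. *)
  have : (1 - y) ^+ 2 < y ^+ 2 * (b * h / 2).
    apply: (@le_lt_trans _ _ (h ^+ 2)); first by rewrite lerXn2r ?nnegrE; lra.
    have -> : h ^+ 2 = (1 / 4) * (b * h / 2) * (1 / 2).
      by rewrite /h; field.
    have y15 : 15 / 16 <= y by move: yh; rewrite /h; lra.
    have y2 : 1 / 2 <= y ^+ 2 by nra.
    have : 1 / 2 * (b * h / 2) <= y ^+ 2 * (b * h / 2) by rewrite ler_pM2r//; lra.
    lra.
  nra.
have z0 : 0 < 1 - y ^+ 2 * E by nra.
by rewrite mulrA ltr_pdivrMr// mul1r; lra.
Qed.

Lemma truncn_bounds (x : R) : 0 <= x ->
  (Num.truncn x)%:R <= x /\ x <= (Num.truncn x).+1%:R.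
Proof. by move=> /truncn_itv/andP[? /ltW]. Qed.

(** * Choice of the constants before and after the threshold *)

Section Connected.
Variables (d : measure_display) (T : measurableType d) (P : probability T R).
Variables (X : randomness P) (lambda eps : R).
Hypotheses (lambda_gt0 : 0 < lambda) (eps_gt0 : 0 < eps).
Hypothesis XP : full_process_randomness X lambda.

(** The choice of [J] gives slope at least [1 - eta] from depth [J] on, so a deep cherry weighs at
    most [expR (- (lambda * (1 - 3 * eta)))]. Against at most [expR ((1 - eps / 2) * lambda)] leaves
    and the factor [K], the exponent left is [4 * eta - eps / 2 = - (7 / 16) * eps]. *)
Lemma cut_sum_few_leaves tau J : eps <= 1 ->
  (eps / 64)^-1 <= 2 ^+ J ->
  64 / (eps / 64) ^+ 2 <= lambda -> 256 * (2 ^+ J + 1) / eps <= lambda ->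
  (leaves tau)%:R <= expR ((1 - eps / 2) * lambda) ->
  \sum_(s <- mixed tau) expR (- (lambda * energy R eqb s)) <=
  4 * (2 ^+ J + 1) * expR (- (eps / 4 * lambda)).
Proof.
move=> eps1 J_large l1 l2 few; pose eta := eps / 64.
have eta0 : 0 < eta by rewrite divr_gt0.
have eta1 : eta <= 1 / 48 by rewrite /eta; lra.
have J0 : (0 : R) < 2 ^+ J by rewrite exprn_gt0.
have lam_large : expR (- (lambda * (eta ^+ 2 / 2))) <= 1 / 32.
  apply: expRN_le => //.
  by move: l1; rewrite ler_pdivrMr ?exprn_gt0// -/eta; lra.
pose Y := cherry_sum eta lambda 0 tau.
pose B := (2 ^+ J + 1) * expR (- (eps / 4 * lambda)).
have Y0 : 0 <= Y := cherry_sum_ge0 _ _ _ _.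
have K0 : 0 < expR (- (lambda * - eta)) := expR_gt0 _.
have K1 : 1 <= expR (- (lambda * - eta)).
  by rewrite -[leLHS]expR0 ler_expR mulrN opprK mulr_ge0// ltW.
have KY : expR (- (lambda * - eta)) * Y <= B.
  have := cherry_sum_le eta0 eta1 lambda_gt0 J tau (s := 0); rewrite lexx ler01 => /(_ isT).
  rewrite -/Y subr0 => HY.
  apply: (@le_trans _ _ (expR (- (lambda * - eta)) * (2 ^+ J * cherry_weight eta lambda 0 +
     expR ((1 - eps / 2) * lambda) * cherry_weight eta lambda (1 - 1 / 2 ^+ J)))).
    rewrite ler_pM2l//; apply: (le_trans HY); rewrite lerD2l ler_wpM2r// expR_ge0//.
  rewrite mulrDr /B [leRHS]mulrDl [X in _ <= _ + X]mul1r; apply: lerD.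
    rewrite mulrCA ler_pM2l// /cherry_weight -expRD ler_expR /cherry_cost /eta.
    by move: lambda_gt0 eps_gt0 => l0 e0; nra.
  have s_large : 1 - eta <= 1 - 1 / 2 ^+ J.
    by rewrite lerD2l lerN2 div1r -[leRHS]invrK lef_pV2 ?posrE// invr_gt0.
  apply: (@le_trans _ _ (expR (- (lambda * - eta)) *
     (expR ((1 - eps / 2) * lambda) * cherry_weight eta lambda (1 - eta)))).
    by rewrite ler_pM2l// ler_pM2l ?expR_gt0//; exact: cherry_weight_nincr.
  rewrite /cherry_weight -!expRD ler_expR /cherry_cost.
  have cost : 1 - 3 * eta <= (1 - 2 * eta) * (1 + (1 - eta) * (1 - eta)) / 2 by nra.
  have : lambda * (1 - 3 * eta) <= lambda * ((1 - 2 * eta) * (1 + (1 - eta) * (1 - eta)) / 2).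
    by rewrite ler_pM2l.
  have le0 : 0 < lambda * eps by rewrite mulr_gt0.
  by rewrite /eta in cost *; lra.
have B_small : 2 * B <= 1 / 32.
  rewrite /B; have : expR (- (eps / 4 * lambda)) <= (64 * (2 ^+ J + 1))^-1.
    apply: expRN_le; first by rewrite invr_gt0; lra.
    by rewrite invrK; move: l2; rewrite ler_pdivrMr//; lra.
  rewrite -(ler_pM2l (_ : 0 < 2 ^+ J + 1)); last by lra.
  rewrite invfM mulrCA mulfV ?mulr1; last by rewrite gt_eqF//; lra.
  by lra.
have := cut_sum_bound eta0 eta1 lambda_gt0 lam_large (t := tau) (s := 0).
rewrite lexx ler01 -/Y => /(_ isT) [|+ _]; first by lra.
have KY0 : 0 <= 2 * expR (- (lambda * - eta)) * Y by rewrite !mulr_ge0// ltW.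
have : expR (2 * expR (- (lambda * - eta)) * Y) <= 1 + 2 * (2 * expR (- (lambda * - eta)) * Y).
  by apply: expR_le_1D2x; rewrite KY0 /=; lra.
have -> : \sum_(s <- mixed tau) expR (- (lambda * energy R eqb s)) = cut_sum eta lambda 0 tau.
  by apply: eq_bigr => s _; rewrite /weight mul0r addr0.
have W0 := cut_sum_ge0 eta lambda 0 tau.
move=> h1 h2; move: KY; rewrite /B => KY.
have : cut_sum eta lambda 0 tau <= expR (- (lambda * - eta)) * cut_sum eta lambda 0 tau.
  by rewrite ler_peMl.
by lra.
Qed.

Lemma pr_disconnected_early J : eps <= 1 ->
  (eps / 64)^-1 <= 2 ^+ J ->
  64 / (eps / 64) ^+ 2 <= lambda -> 256 * (2 ^+ J + 1) / eps <= lambda ->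
  pr P (~` [set w | connected_graph (full_process X ((1 - eps) * lambda) w)]) <=
  ((1 - 2 * ((1 - expR (- (eps / 4 / 16))) /
      (1 - expR (- ((1 + (1 + eps / 4)) * (eps / 4 / 16))))))^-1 +
   4 * (2 ^+ J + 1)) * expR (- (eps / 4 * lambda)).
Proof.
(* The mean number of births grows with exponent [(1 + eps / 4) * (1 - eps)], at most
   [1 - 3 * eps / 4]; the margin [eps / 4] to [1 - eps / 2] is the decay rate. *)
move=> eps1 J_large l1 l2; pose m := Num.truncn (expR ((1 - eps / 2) * lambda)).
have [m1 m2] := truncn_bounds (expR_ge0 ((1 - eps / 2) * lambda)); rewrite -/m in m1 m2.
have J0 : (0 : R) < 2 ^+ J by rewrite exprn_gt0.
have b0 : 0 < eps / 4 by rewrite divr_gt0.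
have b1 : eps / 4 <= 1 by lra.
apply: le_trans (pr_disconnected_le lambda_gt0 XP _ (Q := fun tau => (leaves tau <= m)%N)
   (c := 4 * (2 ^+ J + 1) * expR (- (eps / 4 * lambda))) _ _) _.
- by rewrite mulr_ge0 ?expR_ge0//; lra.
- move=> tau taum; apply: cut_sum_few_leaves => //.
  by apply: le_trans m1; rewrite ler_nat.
rewrite [leRHS]mulrDl lerD2r.
have t0 : 0 <= (1 - eps) * lambda by apply: mulr_ge0; [rewrite subr_ge0|exact: ltW].
have h0 : 0 < eps / 4 / 16 by rewrite divr_gt0.
have th0 : 0 < 1 + eps / 4 by lra.
apply: le_trans (pr_tree_upper lambda_gt0 XP h0 th0 (rho_half b0 b1) m t0) _.
set D := _ - 2 * _; have D0 : 0 < D by rewrite subr_gt0 rho_half.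
rewrite mulrAC [leRHS]mulrC ler_pM2r ?invr_gt0// ler_pdivrMr ?ltr0n//.
apply: (@le_trans _ _ (expR (- (eps / 4 * lambda)) * expR ((1 - eps / 2) * lambda))); last first.
  by rewrite ler_pM2l ?expR_gt0.
rewrite -expRD ler_expR.
have : 0 < lambda * eps ^+ 2 by rewrite mulr_gt0// exprn_gt0.
by nra.
Qed.

(** Discretizing reduces the growth rate to at least [1 - delta], and [delta * (1 + eps) = eps / 4].
    So the exponent at this time is still at least [1 + 3 * eps / 4], above the [1 + eps / 2] of the
    threshold [m]. *)
Lemma pr_not_isolated_late (h delta : R) : delta = eps / (4 * (1 + eps)) -> h = delta / 2 ->
  pr P (~` [set w | ~ connected_graph (full_process X ((1 + eps) * lambda) w) /\
     exists v, isolated_vertex (full_process X ((1 + eps) * lambda) w) v]) <=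
  (expR 1 * expR h + (1 + 4 / eps)) * expR (- (eps / 4 * lambda)).
Proof.
move=> deltaE hE; pose m := Num.truncn (expR ((1 + eps / 2) * lambda)).
have [m1 m2] := truncn_bounds (expR_ge0 ((1 + eps / 2) * lambda)); rewrite -/m in m1 m2.
have le0 : 0 < lambda * eps by rewrite mulr_gt0.
have m0 : (0 < m)%N.
  rewrite -ltnS -(ltr_nat R); apply: lt_le_trans m2.
  rewrite -[ltLHS]expR0 ltr_expR mulr_gt0//.
  by move: eps_gt0; lra.
have d0 : 0 < delta by rewrite deltaE divr_gt0// mulr_gt0// addr_gt0.
have d1 : delta * (1 + eps) = eps / 4 by rewrite deltaE; field; move: eps_gt0; lra.
have d14 : delta <= 1 / 4.
  by rewrite deltaE ler_pdivrMr; move: eps_gt0; lra.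
have h0 : 0 < h by rewrite hE divr_gt0.
have t0 : 0 <= (1 + eps) * lambda by apply: mulr_ge0; [rewrite addr_ge0// ltW|exact: ltW].
apply: le_trans (pr_not_isolated_le lambda_gt0 XP _ (Q := fun tau => (m < leaves tau)%N)
   (c := (1 + 4 / eps) * expR (- (eps / 4 * lambda))) _ _ _) _.
- by rewrite mulr_ge0 ?expR_ge0// addr_ge0// divr_ge0// ltW.
- by move=> tau; apply: leq_ltn_trans.
- move=> tau taum; rewrite ler_pdivrMr; last by rewrite ltr0n; exact: leq_ltn_trans taum.
  apply: (@le_trans _ _ ((1 + 4 / eps) * expR (- (eps / 4 * lambda)) *
      expR ((1 + eps / 2) * lambda))); last first.
    rewrite ler_wpM2l//; first by rewrite mulr_ge0 ?expR_ge0// addr_ge0// divr_ge0// ltW.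
    by apply: (le_trans m2); rewrite ler_nat.
  rewrite -mulrA -expRD.
  have -> : - (eps / 4 * lambda) + (1 + eps / 2) * lambda = eps / 4 * lambda + lambda by lra.
  rewrite expRD mulrA ler_pM2r ?expR_gt0//.
  have := expR_ge1Dx (eps / 4 * lambda) => Hx.
  have x1 : 1 <= expR (eps / 4 * lambda) by lra.
  have : 4 / eps * (eps / 4 * lambda) <= 4 / eps * expR (eps / 4 * lambda).
    by rewrite ler_pM2l ?divr_gt0//; lra.
  have -> : 4 / eps * (eps / 4 * lambda) = lambda by field; rewrite gt_eqF.
  by lra.
rewrite [leRHS]mulrDl lerD2r.
pose i := Num.truncn ((1 + eps) * lambda / h).
have [i1 i2] := truncn_bounds (divr_ge0 t0 (ltW h0)); rewrite -/i in i1 i2.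
have ih : i%:R * h <= (1 + eps) * lambda by rewrite -ler_pdivlMr.
apply: le_trans (pr_tree_lower lambda_gt0 XP h0 t0 ih m0 _) _.
  have h16 : 0 < 1 / 16 :> R by rewrite divr_gt0.
  have th1 : 0 < 1 + 1 :> R by rewrite addr_gt0.
  exact: (pr_tree_exists XP h16 th1 (rho_half ltr01 (lexx _)) t0).
(* From [expR (- h) <= 1 / (1 + h)], the mean of one step is at least [(1 + 2 * h) / (1 + h)]; with
   [h = delta / 2] the second-order terms without a factor [delta * h] to spare cancel. *)
have step : expR ((1 - delta) * h) <= 2 - expR (- h).
  have Hh := expR_ge1Dx h; have H1 := expR_ge1Dx (- ((1 - delta) * h)).
  have e1 : 0 < expR ((1 - delta) * h) := expR_gt0 _.
  have E1 : expR ((1 - delta) * h) * (1 - (1 - delta) * h) <= 1.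
    by rewrite -(ler_pM2l e1) -expRD subrr expR0 in H1.
  have E2 : expR (- h) * (1 + h) <= 1.
    by rewrite -(ler_pM2l (expR_gt0 (- h))) -expRD addNr expR0 in Hh.
  have u0 : 0 < 1 - (1 - delta) * h by nra.
  rewrite -(ler_pM2r u0); apply: (le_trans E1).
  rewrite -(ler_pM2r (_ : 0 < 1 + h)); last by lra.
  have : (1 - (1 - delta) * h) * (expR (- h) * (1 + h)) <= (1 - (1 - delta) * h) * 1.
    by rewrite ler_pM2l.
  have : 1 + h <= (1 + 2 * h) * (1 - (1 - delta) * h) by rewrite hE; nra.
  by lra.
have pow : expR ((1 - delta) * ((1 + eps) * lambda) - h) <= (2 - expR (- h)) ^+ i.
  apply: (@le_trans _ _ (expR ((1 - delta) * h) ^+ i)); last first.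
    by rewrite lerXn2r ?nnegrE ?expR_ge0//; apply: le_trans step; exact: expR_ge0.
  rewrite -expRM_natl ler_expR.
  have : (1 + eps) * lambda <= i.+1%:R * h by rewrite -ler_pdivrMr.
  rewrite -natr1 mulrDl mul1r => Ht.
  have : (1 - delta) * ((1 + eps) * lambda) <= (1 - delta) * (i%:R * h + h).
    by rewrite ler_wpM2l//; lra.
  have : 0 < delta * h by rewrite mulr_gt0.
  by lra.
have z0 : 0 < (2 - expR (- h)) ^+ i by apply: lt_le_trans pow; exact: expR_gt0.
rewrite ler_pdivrMr//.
apply: (@le_trans _ _ (expR 1 * expR h * expR (- (eps / 4 * lambda)) *
   expR ((1 - delta) * ((1 + eps) * lambda) - h))); last first.
  by rewrite ler_pM2l// !mulr_gt0// expR_gt0.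
apply: (@le_trans _ _ (expR 1 * expR ((1 + eps / 2) * lambda))).
  by rewrite ler_pM2l// expR_gt0.
rewrite -!expRD ler_expR.
have -> : (1 - delta) * ((1 + eps) * lambda) = (1 + eps) * lambda - (delta * (1 + eps)) * lambda by ring.
by rewrite d1; lra.
Qed.

End Connected.
End Assembly.

Theorem theorem1p6 (R : realType) (d : measure_display)
    (T : R -> measurableType d) (P : forall lambda : R, probability (T lambda) R)
    (X : forall lambda : R, randomness (P lambda))
    (XP : forall lambda : R, 0 < lambda ->
       full_process_randomness (X lambda) lambda)
    (eps : R) (eps_gt0 : 0 < eps) :
  (eps <= 1 ->
     with_high_probability P (fun lambda =>
       [set w | connected_graph (full_process (X lambda) ((1 - eps) * lambda) w)])) /\
  with_high_probability P (fun lambda =>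
    [set w | ~ connected_graph (full_process (X lambda) ((1 + eps) * lambda) w) /\
             exists v, isolated_vertex
                (full_process (X lambda) ((1 + eps) * lambda) w) v]).
Proof.
have c0 : 0 < eps / 4 by rewrite divr_gt0.
split; last first.
  pose h := eps / (4 * (1 + eps)) / 2.
  apply: (@with_high_probability_exp _ _ _ _ _ (expR 1 * expR h + (1 + 4 / eps)) 0 _ c0).
  - by rewrite addr_gt0 ?mulr_gt0 ?expR_gt0// addr_gt0// divr_gt0.
  - move=> lambda l0; apply: (sigma_and (sigma_algebra_measurable _)).
      exact: (sigma_not (sigma_algebra_measurable _) (measurable_connected _ _)).
    exact: measurable_isolated.
  - by move=> lambda l0 _; exact: (pr_not_isolated_late l0 eps_gt0 (XP _ l0) erefl erefl).
move=> eps1.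
pose J := Num.Def.archi_bound ((eps / 64)^-1 : R).
have J_large : (eps / 64)^-1 <= 2 ^+ J.
  apply: (@le_trans _ _ J%:R).
    by apply/ltW/archi_boundP; rewrite invr_ge0 divr_ge0// ltW.
  by rewrite -natrX ler_nat ltnW// ltn_expl.
have b1 : eps / 4 <= 1 by lra.
have D0 := rho_half c0 b1.
apply: (@with_high_probability_exp _ _ _ _ _
   ((1 - 2 * ((1 - expR (- (eps / 4 / 16))) /
      (1 - expR (- ((1 + (1 + eps / 4)) * (eps / 4 / 16))))))^-1 + 4 * (2 ^+ J + 1))
   (Num.max (64 / (eps / 64) ^+ 2) (256 * (2 ^+ J + 1) / eps)) _ c0).
- by rewrite addr_gt0 ?invr_gt0 ?subr_gt0// mulr_gt0// addr_gt0// exprn_gt0.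
- by move=> lambda l0; exact: measurable_connected.
- move=> lambda l0; rewrite ge_max => /andP[l1 l2].
  exact: (pr_disconnected_early l0 eps_gt0 (XP _ l0) eps1 J_large l1 l2).
Qed.
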